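(* Let $\omega$ be a non-quasianalytic subadditive weight function, let $\psi,\gamma\in\mathcal{S}_\omega(\mathbb{R}^d)\setminus\{0\}$, and let $a$ be a measurable function on $\mathbb{R}^{2d}$ for which there exist $\tau,C>0$ such that $|a(z)|\le Ce^{\tau\omega(z)}$ for all $z\in\mathbb{R}^{2d}$. Then for every $u\in\mathcal{S}'_\omega(\mathbb{R}^d)$ the localization operator $L^a_{\psi,\gamma}$ satisfies $$\mathrm{WF}'_\omega(L^a_{\psi,\gamma}u)\subseteq\mathrm{WF}'_\omega(u).$$
   Context: A non-quasianalytic subadditive weight function is a continuous increasing $\omega:[0,+\infty)\to[0,+\infty)$ with: $(\alpha)$ $\omega(t_1+t_2)\le\omega(t_1)+\omega(t_2)$ for all $t_1,t_2\ge0$; $(\beta)$ $\int_1^{+\infty}\omega(t)t^{-2}dt<+\infty$; $(\gamma)$ $\log t=o(\omega(t))$ as $t\to+\infty$; $(\delta)$ $t\mapsto\omega(e^t)$ is convex. For vectors $\zeta$, $\omega(\zeta):=\omega(|\zeta|)$. Fourier transform: $\hat f(\xi)=\int_{\mathbb{R}^d}e^{-i\langle x,\xi\rangle}f(x)dx$. $\mathcal{S}_\omega(\mathbb{R}^d)$ is the set of Schwartz functions $u$ such that for all $\lambda>0$ and all multi-indices $\alpha$, $\sup_x e^{\lambda\omega(x)}|D^\alpha u(x)|<\infty$ and $\sup_\xi e^{\lambda\omega(\xi)}|D^\alpha\hat u(\xi)|<\infty$, with $D^\alpha=(-i)^{|\alpha|}\partial^\alpha$; it is a Fréchet space with these seminorms,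 and $\mathcal{S}'_\omega(\mathbb{R}^d)$ is its dual. The bracket $\langle u,\psi\rangle$ for $u\in\mathcal{S}'_\omega$, $\psi\in\mathcal{S}_\omega$ is conjugate linear in $\psi$ and consistent with $\langle f,g\rangle=\int f\bar g$. For $z=(x,\xi)\in\mathbb{R}^{2d}$, $\Pi(z)f(y)=e^{i\langle y,\xi\rangle}f(y-x)$. For a window $\varphi\in\mathcal{S}_\omega(\mathbb{R}^d)\setminus\{0\}$ and $f\in\mathcal{S}'_\omega(\mathbb{R}^d)$, the short-time Fourier transform is $V_\varphi f(z)=\langle f,\Pi(z)\varphi\rangle$. Its adjoint is $V_\gamma^*F=\int_{\mathbb{R}^{2d}}F(z)\Pi(z)\gamma\,dz$ for measurable $F$ on $\mathbb{R}^{2d}$, interpreted weakly: $\langle V_\gamma^*F,g\rangle=\int F(z)\overline{V_\gamma g(z)}dz$ for $g\in\mathcal{S}_\omega(\mathbb{R}^d)$. The localization operator is $L^a_{\psi,\gamma}f=V_\gamma^*(a\cdot V_\psi f)$; for $a$ as in the claim it is well defined from $\mathcal{S}'_\omega(\mathbb{R}^d)$ to $\mathcal{S}'_\omega(\mathbb{R}^d)$. $\mathrm{WF}'_\omega(u)$: given a window $\varphi\in\mathcal{S}_\omega(\mathbb{R}^d)\setminus\{0\}$, a point $z_0\in\mathbb{R}^{2d}\setminus\{0\}$ is not in $\mathrm{WF}'_\omega(u)$ if there is an open conic set $\Gamma\subseteq\mathbb{R}^{2d}\setminus\{0\}$ containing $z_0$ with $\sup_{z\in\Gamma}e^{\lambda\omega(z)}|V_\varphi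 u(z)|<+\infty$ for all $\lambda>0$. (This set does not depend on the choice of $\varphi$.) *)

(* Defs.v *)
From HB Require Import structures.
From mathcomp Require Import all_boot all_order all_algebra.
From mathcomp Require Import complex.
From mathcomp Require Import all_classical all_reals all_analysis.
From mathcomp Require Import measurable_realfun.

Set Implicit Arguments.
Unset Strict Implicit.
Unset Printing Implicit Defensive.

Import Order.TTheory GRing.Theory Num.Theory.
Import numFieldNormedType.Exports.

Local Open Scope classical_set_scope.
Local Open Scope ring_scope.

Notation normc := ComplexField.Normc.normc.

(* The sigma-algebra on ['rV[R]_n] is generated by the coordinate functions;
   as R is second countable, it is the Borel sigma-algebra of R^n. *)
Definition rV_display : measure_display.
Proof. exact: default_measure_display. Qed.

Section measurable_rV.
Context {R : realType} (n : nat).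

Let coord (i : 'I_n) (v : 'rV[R]_n) : R := v 0 i.

Let rV_set0 : g_sigma_preimage coord set0.
Proof. exact: sigma_algebra0. Qed.

Let rV_setC A : g_sigma_preimage coord A -> g_sigma_preimage coord (~` A).
Proof. exact: sigma_algebraC. Qed.

Let rV_bigcup (F : _^nat) : (forall i, g_sigma_preimage coord (F i)) ->
  g_sigma_preimage coord (\bigcup_i (F i)).
Proof. exact: sigma_algebra_bigcup. Qed.

HB.instance Definition _ := @isMeasurable.Build rV_display
  'rV[R]_n (g_sigma_preimage coord) rV_set0 rV_setC rV_bigcup.

Lemma measurable_coord (i : 'I_n) :
  measurable_fun [set: 'rV[R]_n] (fun v => v 0 i).
Proof.
move=> _ Y mY; rewrite setTI; apply: sub_sigma_algebra => /=.
rewrite -bigcup_seq/=; exists i => /=; first by rewrite mem_index_enum.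
by exists Y => //; rewrite setTI.
Qed.

Lemma measurable_fun_rV d (T : measurableType d) (f : T -> 'rV[R]_n) :
  (forall i, measurable_fun [set: T] (fun x => f x 0 i)) ->
  measurable_fun [set: T] f.
Proof.
move=> mf _ Y mY; rewrite setTI.
suff : measurable `<=` [set Y | measurable (f @^-1` Y)] by exact.
apply: smallest_sub.
  split=> /=; first by rewrite preimage_set0.
  - by move=> A mA; rewrite setTD preimage_setC; exact: measurableC.
  - by move=> F mF; rewrite preimage_bigcup; exact: bigcup_measurable.
rewrite -bigcup_seq => A [i _ [B mB <-]] /=.
by have := mf i measurableT B mB; rewrite !setTI.
Qed.

End measurable_rV.

Definition rV_cons {R : realType} {n : nat} (p : measurableTypeR R * 'rV[R]_n) : 'rV[R]_n.+1 :=
  row_mx (const_mx p.1 : 'rV_1) p.2.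

Definition rV_uncons {R : realType} {n : nat} (v : 'rV[R]_n.+1) : measurableTypeR R * 'rV[R]_n :=
  (lsubmx (v : 'rV_(1 + n)) 0 0, rsubmx (v : 'rV_(1 + n))).

Lemma rV_consK {R : realType} {n : nat} : cancel (@rV_cons R n) rV_uncons.
Proof. by move=> [x v]; rewrite /rV_uncons/= row_mxKl row_mxKr mxE. Qed.

Lemma rV_unconsK {R : realType} {n : nat} : cancel (@rV_uncons R n) rV_cons.
Proof.
move=> v; rewrite -[RHS](@hsubmxK _ 1 1 n); rewrite /rV_cons.
by congr (@row_mx R 1 1 n _ _); apply/rowP => i; rewrite [LHS]mxE (ord1 i).
Qed.

Lemma measurable_rV_cons {R : realType} {n : nat} :
  measurable_fun [set: measurableTypeR R * 'rV[R]_n] rV_cons.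
Proof.
apply: measurable_fun_rV => i; rewrite /rV_cons.
case: (split_ordP (i : 'I_(1 + n))) => j ->.
- rewrite (_ : (fun _ => _) = fst); first exact: measurable_fst.
  apply/funext => p; apply: (etrans (@row_mxEl R 1 1 n _ _ _ _)).
  by rewrite mxE.
- rewrite (_ : (fun _ => _) = (fun v : 'rV[R]_n => v 0 j) \o snd).
    by apply: measurableT_comp; [exact: measurable_coord|exact: measurable_snd].
  by apply/funext => p; exact: (@row_mxEr R 1 1 n).
Qed.

Lemma measurable_rV_uncons {R : realType} {n : nat} :
  measurable_fun [set: 'rV[R]_n.+1] rV_uncons.
Proof.
apply: measurable_fun_pair.
  rewrite (_ : (fun _ => _) = (fun v : 'rV[R]_n.+1 => v 0 (@lshift 1 n 0))).
    exact: measurable_coord.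
  by apply/funext => v; rewrite mxE.
apply: measurable_fun_rV => i.
rewrite (_ : (fun _ => _) = (fun v : 'rV[R]_n.+1 => v 0 (@rshift 1 n i))).
  exact: measurable_coord.
by apply/funext => v; rewrite mxE.
Qed.

Section lebesgue_rV.
Context {R : realType}.
Local Open Scope ereal_scope.

Section step.
Variables (n : nat) (mu : {sigma_finite_measure set 'rV[R]_n -> \bar R}).

Definition rV_prod : set 'rV[R]_n.+1 -> \bar R :=
  pushforward (@lebesgue_measure R \x mu) rV_cons.

Let pre A : measurable A -> measurable ((@rV_cons R n) @^-1` A).
Proof. by move=> mA; rewrite -[X in measurable X]setTI; exact: measurable_rV_cons. Qed.

Let rV_prod0 : rV_prod set0 = 0.
Proof. by rewrite /rV_prod /pushforward preimage_set0 measure0. Qed.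

Let rV_prod_ge0 A : 0 <= rV_prod A.
Proof. by rewrite /rV_prod /pushforward measure_ge0. Qed.

Let rV_prod_sigma_additive : semi_sigma_additive rV_prod.
Proof.
move=> F mF tF mUF; rewrite /rV_prod /pushforward preimage_bigcup.
apply: measure_semi_sigma_additive.
- by move=> k; exact: pre.
- apply/trivIsetP => /= i j _ _ ij; rewrite -preimage_setI.
  by move/trivIsetP : tF => /(_ _ _ _ _ ij) ->//; rewrite preimage_set0.
- by rewrite -preimage_bigcup; exact: pre.
Qed.

HB.instance Definition _ := isMeasure.Build _ _ _ rV_prod
  rV_prod0 rV_prod_ge0 rV_prod_sigma_additive.

Let rV_prod_sigma_finite : sigma_finite setT rV_prod.
Proof.
have /sigma_finiteP[F [TF ndF Foo]] := sigma_finiteT (@lebesgue_measure R).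
have /sigma_finiteP[G [TG ndG Goo]] := sigma_finiteT mu.
exists (fun k => @rV_uncons R n @^-1` (F k `*` G k)).
  rewrite -preimage_bigcup (_ : \bigcup_k _ = setT) ?preimage_setT//.
  rewrite -setXTT TF TG predeqE => -[x y]; split=> [[k _ []/= ? ?]|].
    by split; exists k.
  move=> [/= [i _ Fix] [j _ Gjy]]; exists (maxn i j) => //; split.
  - by move: x Fix; exact/subsetPset/ndF/leq_maxl.
  - by move: y Gjy; exact/subsetPset/ndG/leq_maxr.
move=> k; have [mF Fk] := Foo k; have [mG Gk] := Goo k; split.
  rewrite -[X in measurable X]setTI.
  by apply: measurable_rV_uncons => //; exact: measurableX.
rewrite /rV_prod /pushforward -comp_preimage.
rewrite (_ : _ \o _ = id) ?preimage_id; last first.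
  by apply/funext => p /=; rewrite rV_consK.
by rewrite product_measure1E// lte_mul_pinfty// ge0_fin_numE.
Qed.

HB.instance Definition _ := Measure_isSigmaFinite.Build _ _ _ rV_prod
  rV_prod_sigma_finite.

End step.

Fixpoint lebesgue_rV n : {sigma_finite_measure set 'rV[R]_n -> \bar R} :=
  match n with
  | 0 => @dirac _ 'rV[R]_0 0%R R
  | n.+1 => rV_prod (lebesgue_rV n)
  end.

End lebesgue_rV.

Section weight.
Context {R : realType}.

Record weight_function (w : R -> R) : Prop := WeightFunction {
  weight_ge0 : forall t, 0 <= t -> 0 <= w t ;
  weight_continuous : {within `[0, +oo[%classic, continuous w} ;
  (* "increasing" is meant in the wide sense: weights may be constant (for
     instance zero) near the origin. *)
  weight_nondecreasing : forall s t, 0 <= s -> s <= t -> w s <= w t ;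
  weight_subadditive : forall s t, 0 <= s -> 0 <= t -> w (s + t) <= w s + w t ;
  weight_nonquasianalytic :
    (\int[lebesgue_measure]_(t in `[1%R, +oo[) (w t / t ^+ 2)%:E < +oo)%E ;
  weight_log : forall e : R, 0 < e ->
    \forall t \near +oo, `|ln t| <= e * `|w t| ;
  weight_convex : convex_function [set: R^o] (fun t : R^o => w (expR t)) }.

End weight.

Section euclidean.
Context {R : realType} {n : nat}.
Implicit Types x y : 'rV[R]_n.

Definition dotv x y : R := \sum_i x 0 i * y 0 i.

(* The norm `|x| of the library is the sup norm. *)
Definition enorm x : R := Num.sqrt (dotv x x).

End euclidean.

Section complex_functions.
Context {R : realType}.
Local Open Scope complex_scope.

Definition cis (t : R) : R[i] := cos t +i* sin t.

(* Real and imaginary parts are integrated separately, with value 0 for a part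
   whose integral is infinite. [integral] is defined by a supremum over Borel
   simple functions, so that it also has the right value on integrable Lebesgue
   measurable functions that are not Borel. *)
Definition cintegral {d} {T : measurableType d} (mu : {measure set T -> \bar R})
    (f : T -> R[i]) : R[i] :=
  (\int[mu]_x complex.Re (f x)) +i* (\int[mu]_x complex.Im (f x)).

Definition lebesgue_measurable {n} (f : 'rV[R]_n -> R[i]) : Prop :=
  forall B : set R, measurable B ->
    completed_algebra_gen (lebesgue_rV n) ((fun x => complex.Re (f x)) @^-1` B) /\
    completed_algebra_gen (lebesgue_rV n) ((fun x => complex.Im (f x)) @^-1` B).

Section functions.
Context {n : nat}.
Implicit Types (f g : 'rV[R]_n -> R[i]) (i : 'I_n) (al : {ffun 'I_n -> nat}).

Definition re_fun f (x : 'rV[R]_n) : R^o := complex.Re (f x).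
Definition im_fun f (x : 'rV[R]_n) : R^o := complex.Im (f x).

Definition pderiv i f : 'rV[R]_n -> R[i] := fun x =>
  ('D_(delta_mx 0 i) (re_fun f) x : R) +i* ('D_(delta_mx 0 i) (im_fun f) x : R).

Definition pderivs (s : seq 'I_n) f := foldr pderiv f s.

Definition smooth f : Prop := forall s : seq 'I_n,
  [/\ continuous (re_fun (pderivs s f)), continuous (im_fun (pderivs s f)) &
      forall i x, derivable (re_fun (pderivs s f)) x (delta_mx 0 i) /\
                  derivable (im_fun (pderivs s f)) x (delta_mx 0 i)].

Definition mderiv al f :=
  foldr (fun i g => iter (al i) (pderiv i) g) f (enum 'I_n).

Definition Dop al f : 'rV[R]_n -> R[i] :=
  fun x => (0 -i* 1) ^+ (\sum_i al i)%N * mderiv al f x.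

Definition monom al (x : 'rV[R]_n) : R := \prod_i x 0 i ^+ al i.

Definition schwartz f : Prop := smooth f /\ forall al be,
  (ereal_sup (range (fun x : 'rV[R]_n =>
     (`|monom al x| * normc (mderiv be f x))%:E)) < +oo)%E.

Definition fourier f : 'rV[R]_n -> R[i] :=
  fun xi => cintegral (lebesgue_rV n) (fun x => cis (- dotv x xi) * f x).

Definition bracket f g : R[i] :=
  cintegral (lebesgue_rV n) (fun x => f x * conjc (g x)).

End functions.
End complex_functions.

Section ultradistributions.
Context {R : realType} {n : nat} (w : R -> R).
Implicit Types (f g : 'rV[R]_n -> R[i]).

Definition wsup (la : R) (al : {ffun 'I_n -> nat}) f : \bar R :=
  ereal_sup (range (fun x => (expR (la * w (enorm x)) * normc (Dop al f x))%:E)).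

Definition Sw f : Prop := schwartz f /\ forall la al, 0 < la ->
  (wsup la al f < +oo)%E /\ (wsup la al (fourier f) < +oo)%E.

(* The basic neighbourhoods of 0 for the topology defined by the seminorms
   [wsup la al] and [wsup la al \o fourier] with 0 < la. *)
Definition Sw_nbhs0 (s : seq (R * {ffun 'I_n -> nat})) (e : R) f : Prop :=
  forall la al, (la, al) \in s -> 0 < la ->
    (wsup la al f < e%:E)%E /\ (wsup la al (fourier f) < e%:E)%E.

(* Elements of S'_w are represented by functionals on all functions; only their
   restrictions to S_w are meaningful. *)
Definition functional := ('rV[R]_n -> R[i]) -> R[i].

Definition Sw_dual (u : functional) : Prop :=
  [/\ forall f g, Sw f -> Sw g -> u (fun x => f x + g x) = u f + u g,
      forall (c : R[i]) f, Sw f -> u (fun x => c * f x) = conjc c * u f &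
      forall f (e : R), Sw f -> 0 < e -> exists s, exists2 de : R, 0 < de &
        forall g, Sw g -> Sw_nbhs0 s de (fun x => g x - f x) ->
          normc (u g - u f) < e].

End ultradistributions.

Section time_frequency.
Context {R : realType} {d : nat}.
Implicit Types (f : 'rV[R]_d -> R[i]) (z : 'rV[R]_(d + d)).

Definition tfshift z f : 'rV[R]_d -> R[i] :=
  fun y => cis (dotv y (rsubmx z)) * f (y - lsubmx z).

Definition stft f (u : functional) : 'rV[R]_(d + d) -> R[i] :=
  fun z => u (tfshift z f).

Definition stft_adj f (F : 'rV[R]_(d + d) -> R[i]) : functional :=
  fun g => cintegral (lebesgue_rV (d + d))
             (fun z => F z * conjc (stft f (bracket g) z)).

Definition locop (a : 'rV[R]_(d + d) -> R[i]) psi gam (u : functional)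
    : functional :=
  stft_adj gam (fun z => a z * stft psi u z).

Definition conic (G : set 'rV[R]_(d + d)) : Prop :=
  forall z (t : R), G z -> 0 < t -> G (t *: z).

(* The wave front set computed with the window [phi]. *)
Definition WF (w : R -> R) (phi : 'rV[R]_d -> R[i]) (u : functional)
    : set 'rV[R]_(d + d) :=
  [set z0 | z0 <> 0 /\ ~ exists G : set 'rV[R]_(d + d),
    [/\ open G, conic G, ~ G 0, G z0 &
        forall la : R, 0 < la ->
          (ereal_sup [set (expR (la * w (enorm z)) * normc (stft phi u z))%:E
                     | z in G] < +oo)%E]].

End time_frequency.

(* Main.v *)
(* A function [V] on phase space that decays rapidly on a cone [G] and grows at
   most like [exp (mu w)] elsewhere keeps its rapid decay on any smaller cone
   [G'] under an integral against a kernel [K (z', z)] that is bounded by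
   [exp (- L w (z - z'))] for every [L]. Indeed, for [z'] in [G'] and [z] outside
   [G], [|z'|] is at most a multiple of [|z - z'|], hence [w z'] is at most a
   multiple of [w (z - z')], while for [z] in [G] subadditivity suffices.

   The short-time Fourier transform of [L^a u] with window [phi] is such an
   integral of [a * V_psi u], with kernel [conj (V_gam (Pi z' phi) z)]. It remains
   to pass from [V_phi u] to [V_psi u], which is again such an integral by the
   reconstruction formula
   [c * g = \int V_phi g (z) Pi(z) phi dz] for [g = Pi(z') psi].
   To apply [u] under this integral, one checks that Riemann sums converge to it
   in [S_w]. That is done with the seminorms that bound only [f] and its Fourier
   transform, not their derivatives; these define the topology of [S_w] too. *)

Require Import Defs.
From HB Require Import structures.
From mathcomp Require Import all_boot all_order all_algebra.
From mathcomp Require Import complex.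
From mathcomp Require Import all_classical all_reals all_analysis.
From mathcomp Require Import measurable_realfun ring lra.

Import Order.TTheory GRing.Theory Num.Theory.
Import numFieldNormedType.Exports.
Set Implicit Arguments.
Unset Strict Implicit.
Unset Printing Implicit Defensive.

Local Open Scope classical_set_scope.
Local Open Scope ring_scope.

(** * Complex-valued integrals *)

(** The functional [u] is known only through linearity and one seminorm bound ([Sw_dual_bound]), so
    the reconstruction formula reaches it only through finite sums. What is extracted is an
    inequality, [window_bound]: the Riemann sums are bounded uniformly in the mesh and the error
    tends to 0. The function [z |-> u (tfshift z phi)] is thus sampled at nodes and never
    integrated. Derivatives are left out because the Fourier transform turns the shift by [(x, xi)]
    into the shift by [(xi, - x)], up to a phase: both halves of a derivative-free seminorm then
    obey the same estimates. Domination rests on products of Cauchy kernels [1 / (1 + t^2)].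
    Condition (gamma) puts [expR (- w)] below such a product, so an integration costs one unit of
    the decay rate, or two on pairs. Up to a factor 2 the same kernel is the Fourier transform of
    [exp (- |t|)], and this pair, with its elementary antiderivatives, yields Fourier inversion. The
    change of window and the localization operator each shrink the cone once. *)

Section modulus.
Context {R : realType}.
Implicit Types (x y : R[i]) (r t : R).
Local Open Scope complex_scope.

Lemma normc_ge0 x : 0 <= normc x.
Proof. by case: x => a b; exact: sqrtr_ge0. Qed.

Lemma normcD x y : normc (x + y) <= normc x + normc y.
Proof. exact: le_normcD. Qed.

Lemma normcB x y : normc (x - y) <= normc x + normc y.
Proof. by rewrite -[normc y]normcN; exact: normcD. Qed.

Lemma normcM x y : normc (x * y) = normc x * normc y.
Proof. exact: ComplexField.Normc.normcM. Qed.

Lemma normc_conj x : normc (conjc x) = normc x.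
Proof. by case: x => a b /=; rewrite sqrrN. Qed.

Lemma normc_real r : normc r%:C = `|r|.
Proof. by rewrite /= expr0n /= addr0 sqrtr_sqr. Qed.

Lemma normcX x n : normc (x ^+ n) = normc x ^+ n.
Proof.
elim: n => [|n IH]; first by rewrite !expr0 ComplexField.Normc.normc1.
by rewrite !exprS normcM IH.
Qed.

Lemma normc_cis t : normc (cis t) = 1.
Proof. by rewrite /= cos2Dsin2 sqrtr1. Qed.

Lemma cisD s t : cis (s + t) = cis s * cis t.
Proof.
apply/eqP; rewrite eq_complex/= cosD sinD; apply/andP; split; apply/eqP => //.
by rewrite addrC.
Qed.

Lemma cis0 : cis 0 = 1 :> R[i].
Proof. by rewrite /cis cos0 sin0. Qed.

Lemma cisN t : cis (- t) = conjc (cis t).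
Proof. by rewrite /cis cosN sinN. Qed.

Lemma cisK t : cis t * cis (- t) = 1.
Proof. by rewrite -cisD subrr cis0. Qed.

Lemma Re_le_normc x : `|complex.Re x| <= normc x.
Proof.
case: x => a b /=; rewrite -sqrtr_sqr ler_wsqrtr// lerDl; exact: sqr_ge0.
Qed.

Lemma Im_le_normc x : `|complex.Im x| <= normc x.
Proof.
case: x => a b /=; rewrite -sqrtr_sqr ler_wsqrtr// lerDr; exact: sqr_ge0.
Qed.

Lemma normc_le_ReIm x : normc x <= `|complex.Re x| + `|complex.Im x|.
Proof.
case: x => a b /=; rewrite -[leRHS]ger0_norm ?addr_ge0// -sqrtr_sqr ler_wsqrtr//.
rewrite sqrrD !real_normK ?num_real// addrAC lerDl mulrn_wge0// mulr_ge0//.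
Qed.

Lemma mul_conjc x : x * conjc x = (normc x ^+ 2)%:C.
Proof.
case: x => a b; rewrite /= sqr_sqrtr ?addr_ge0 ?sqr_ge0//; simpc.
by rewrite !expr2; congr (_ +i* _); ring.
Qed.

Lemma normc_sum (I : Type) (s : seq I) (F : I -> R[i]) :
  normc (\sum_(i <- s) F i) <= \sum_(i <- s) normc (F i).
Proof.
elim: s => [|i s IH]; first by rewrite !big_nil ComplexField.Normc.normc0.
by rewrite !big_cons (le_trans (normcD _ _))// lerD2l.
Qed.

End modulus.

Section cintegral.
Context {d} {T : measurableType d} {R : realType}.
Variable mu : {measure set T -> \bar R}.
Local Open Scope complex_scope.
Implicit Types (f g : T -> R[i]) (B : T -> R).

Definition cmeas f := measurable_fun setT (fun x => complex.Re (f x)) /\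
  measurable_fun setT (fun x => complex.Im (f x)).

Definition cintegrable f := mu.-integrable setT (fun x => (complex.Re (f x))%:E) /\
  mu.-integrable setT (fun x => (complex.Im (f x))%:E).

Lemma cmeas_cst (c : R[i]) : cmeas (cst c).
Proof. by split; exact: measurable_cst. Qed.

Lemma cmeas_real (h : T -> R) : measurable_fun setT h -> cmeas (fun x => (h x)%:C).
Proof. by move=> mh; split => //=; exact: measurable_cst. Qed.

Lemma cmeasD f g : cmeas f -> cmeas g -> cmeas (fun x => f x + g x).
Proof.
move=> [f1 f2] [g1 g2]; split.
- rewrite (_ : (fun _ => _) = (fun x => complex.Re (f x)) \+ (fun x => complex.Re (g x))).
    exact: measurable_funD.
  by apply/funext => x /=; case: (f x) (g x) => ? ? [].
- rewrite (_ : (fun _ => _) = (fun x => complex.Im (f x)) \+ (fun x => complex.Im (g x))).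
    exact: measurable_funD.
  by apply/funext => x /=; case: (f x) (g x) => ? ? [].
Qed.

Lemma cmeasM f g : cmeas f -> cmeas g -> cmeas (fun x => f x * g x).
Proof.
move=> [f1 f2] [g1 g2]; split.
- rewrite (_ : (fun _ => _) = ((fun x => complex.Re (f x)) \* (fun x => complex.Re (g x)))
     \- ((fun x => complex.Im (f x)) \* (fun x => complex.Im (g x)))).
    by apply: measurable_funB; exact: measurable_funM.
  by apply/funext => x /=; case: (f x) (g x) => ? ? [].
- rewrite (_ : (fun _ => _) = ((fun x => complex.Re (f x)) \* (fun x => complex.Im (g x)))
     \+ ((fun x => complex.Im (f x)) \* (fun x => complex.Re (g x)))).
    by apply: measurable_funD; exact: measurable_funM.
  by apply/funext => x /=; case: (f x) (g x) => ? ? [].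
Qed.

Lemma cmeas_conj f : cmeas f -> cmeas (fun x => conjc (f x)).
Proof.
move=> [f1 f2]; split.
  by apply: eq_measurable_fun f1 => x _; case: (f x).
apply: eq_measurable_fun (measurable_funN f2) => x _ /=; by case: (f x).
Qed.

Lemma cmeas_cis (h : T -> R) : measurable_fun setT h -> cmeas (fun x => cis (h x)).
Proof.
move=> mh; split => /=.
- apply: (@measurableT_comp _ _ _ _ _ _ (@cos R)) => //.
  by apply: continuous_measurable_fun; exact: continuous_cos.
- apply: (@measurableT_comp _ _ _ _ _ _ (@sin R)) => //.
  by apply: continuous_measurable_fun; exact: continuous_sin.
Qed.

Lemma cmeas_normc f : cmeas f -> measurable_fun setT (fun x => normc (f x)).
Proof.
move=> [f1 f2].
rewrite (_ : (fun _ => _) = (@Num.sqrt R) \o (fun x => complex.Re (f x) ^+ 2 + complex.Im (f x) ^+ 2)).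
  apply: measurableT_comp; first by apply: continuous_measurable_fun; exact: sqrt_continuous.
  by apply: measurable_funD; exact: measurable_funX.
by apply/funext => x /=; case: (f x).
Qed.

Lemma cmeas_prod (I : Type) (s : seq I) (F : I -> T -> R[i]) :
  (forall i, cmeas (F i)) -> cmeas (fun x => \prod_(i <- s) F i x).
Proof.
move=> mF; elim: s => [|i s IH].
  rewrite (_ : (fun _ => _) = cst 1); first exact: cmeas_cst.
  by apply/funext => x; rewrite big_nil.
rewrite (_ : (fun _ => _) = (fun x => F i x * \prod_(i <- s) F i x)).
  exact: cmeasM.
by apply/funext => x; rewrite big_cons.
Qed.

Lemma le_cintegrable f B : cmeas f -> (forall x, normc (f x) <= B x) ->
  mu.-integrable setT (fun x => (B x)%:E) -> cintegrable f.
Proof.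
move=> [f1 f2] fB iB; split.
- apply: le_integrable iB => //; first exact/measurable_EFinP.
  move=> x _ /=; rewrite lee_fin (le_trans (Re_le_normc _))// (le_trans (fB x))//.
  exact: ler_norm.
- apply: le_integrable iB => //; first exact/measurable_EFinP.
  move=> x _ /=; rewrite lee_fin (le_trans (Im_le_normc _))// (le_trans (fB x))//.
  exact: ler_norm.
Qed.

Lemma cintegrable_cmeas f : cintegrable f -> cmeas f.
Proof. by move=> [/measurable_int/measurable_EFinP ? /measurable_int/measurable_EFinP ?]. Qed.

Lemma cintegrable_normc f : cintegrable f ->
  mu.-integrable setT (fun x => (normc (f x))%:E).
Proof.
move=> fi; have mf := cintegrable_cmeas fi; case: fi => f1 f2.
have := integrableD measurableT (integrable_norm f1) (integrable_norm f2).
apply: le_integrable => //.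
  by apply/measurable_EFinP; exact: cmeas_normc.
move=> x _ /=; rewrite lee_fin [`|normc _|]ger0_norm ?normc_ge0//.
by rewrite ger0_norm ?normc_le_ReIm// addr_ge0.
Qed.

Lemma eq_cintegral f g : (forall x, f x = g x) -> cintegral mu f = cintegral mu g.
Proof. by move=> fg; congr cintegral; apply/funext. Qed.

Lemma cintegralD f g : cintegrable f -> cintegrable g ->
  cintegral mu (fun x => f x + g x) = cintegral mu f + cintegral mu g.
Proof.
move=> [f1 f2] [g1 g2]; rewrite /cintegral; simpc; congr (_ +i* _).
- rewrite -RintegralD//; apply: eq_Rintegral => x _; by case: (f x) (g x) => ? ? [].
- rewrite -RintegralD//; apply: eq_Rintegral => x _; by case: (f x) (g x) => ? ? [].
Qed.

Lemma cintegrableZ (c : R[i]) f : cintegrable f -> cintegrable (fun x => c * f x).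
Proof.
move=> fi; apply: (@le_cintegrable _ (fun x => normc c * normc (f x))).
- by apply: cmeasM; [exact: cmeas_cst|exact: cintegrable_cmeas].
- by move=> x; rewrite normcM.
- have := integrableZl measurableT (normc c) (cintegrable_normc fi).
  by apply: eq_integrable => // x _; rewrite EFinM.
Qed.

Lemma cintegralZ (c : R[i]) f : cintegrable f ->
  cintegral mu (fun x => c * f x) = c * cintegral mu f.
Proof.
move=> [f1 f2]; rewrite /cintegral; case: c => a b; simpc; congr (_ +i* _).
- rewrite -!RintegralZl// -RintegralB//; last 2 first.
  + by have := integrableZl measurableT a f1; apply: eq_integrable => // x _; rewrite EFinM.
  + by have := integrableZl measurableT b f2; apply: eq_integrable => // x _; rewrite EFinM.
  by apply: eq_Rintegral => x _; case: (f x).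
- rewrite -!RintegralZl// -RintegralD//; last 2 first.
  + by have := integrableZl measurableT a f2; apply: eq_integrable => // x _; rewrite EFinM.
  + by have := integrableZl measurableT b f1; apply: eq_integrable => // x _; rewrite EFinM.
  by apply: eq_Rintegral => x _; case: (f x).
Qed.

Lemma cintegralZr (c : R[i]) f : cintegrable f ->
  cintegral mu (fun x => f x * c) = cintegral mu f * c.
Proof.
by move=> fi; rewrite mulrC -cintegralZ//; apply: eq_cintegral => x; rewrite mulrC.
Qed.

Lemma cintegrableD f g : cintegrable f -> cintegrable g -> cintegrable (fun x => f x + g x).
Proof.
move=> fi gi; apply: (@le_cintegrable _ (fun x => normc (f x) + normc (g x))).
- by apply: cmeasD; exact: cintegrable_cmeas.
- by move=> x; exact: normcD.
- exact: (integrableD measurableT (cintegrable_normc fi) (cintegrable_normc gi)).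
Qed.

Lemma cintegralB f g : cintegrable f -> cintegrable g ->
  cintegral mu (fun x => f x - g x) = cintegral mu f - cintegral mu g.
Proof.
move=> fi gi; rewrite -[- cintegral mu g]mulN1r -cintegralZ// -cintegralD//.
  by apply: eq_cintegral => x; rewrite mulN1r.
exact: cintegrableZ.
Qed.

Lemma cintegral0 : cintegral mu (fun _ => 0) = 0.
Proof.
rewrite /cintegral /=; congr (_ +i* _);
by rewrite /Rintegral integral0.
Qed.

Lemma cintegrable0 : cintegrable (fun _ => 0).
Proof. by split; exact: integrable0. Qed.

Lemma cintegrable_sum (I : Type) (s : seq I) (F : I -> T -> R[i]) :
  (forall i, cintegrable (F i)) -> cintegrable (fun x => \sum_(i <- s) F i x).
Proof.
move=> iF; elim: s => [|i s IH].
  rewrite (_ : (fun _ => _) = (fun=> 0)); first exact: cintegrable0.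
  by apply/funext => x; rewrite big_nil.
rewrite (_ : (fun _ => _) = (fun x => F i x + \sum_(j <- s) F j x)).
  exact: cintegrableD.
by apply/funext => x; rewrite big_cons.
Qed.

Lemma cintegral_sum (I : Type) (s : seq I) (F : I -> T -> R[i]) :
  (forall i, cintegrable (F i)) ->
  cintegral mu (fun x => \sum_(i <- s) F i x) = \sum_(i <- s) cintegral mu (F i).
Proof.
move=> iF; elim: s => [|i s IH].
  rewrite big_nil (_ : (fun _ => _) = (fun=> 0)); first exact: cintegral0.
  by apply/funext => x; rewrite big_nil.
rewrite big_cons (_ : (fun _ => _) = (fun x => F i x + \sum_(i <- s) F i x)); last first.
  by apply/funext => x; rewrite big_cons.
by rewrite cintegralD ?IH//; exact: cintegrable_sum.
Qed.

Lemma cintegral_conj f : cintegrable f ->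
  cintegral mu (fun x => conjc (f x)) = conjc (cintegral mu f).
Proof.
move=> [f1 f2]; rewrite /cintegral /=; congr (_ +i* _).
  by apply: eq_Rintegral => x _; case: (f x).
rewrite -mulN1r -RintegralZl//; apply: eq_Rintegral => x _; case: (f x) => a b /=.
by rewrite mulN1r.
Qed.

Lemma cintegral_real (h : T -> R) :
  cintegral mu (fun x => (h x)%:C) = (\int[mu]_x h x)%:C.
Proof. by rewrite /cintegral /=; congr (_ +i* _); rewrite /Rintegral integral0. Qed.

Import HBNNSimple.

(* No measurability is required of [f], since [integral] is a supremum over
   simple functions below it. *)
Lemma ge0_integral_le_nonmeas (f g : T -> \bar R) : (forall x, 0 <= f x)%E ->
  (forall x, f x <= g x)%E ->
  (\int[mu]_x f x <= \int[mu]_x g x)%E.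
Proof.
move=> f0 fg; have g0 x : (0 <= g x)%E by exact: le_trans (fg x).
rewrite !ge0_integralTE//.
apply: ereal_sup_le => _ /= [h hf <-]; exists h => // x.
by rewrite (le_trans (hf x)).
Qed.

(** The integrals of the positive and negative parts of [f] both lie between 0 and the integral of
    [B], hence so does the absolute value of their difference. The integrand of [locop] contains the
    symbol [a], which is only Lebesgue measurable, while [measurable_fun] refers to the Borel
    sigma-algebra. *)
Lemma normr_Rintegral_le (f B : T -> R) : (forall x, `|f x| <= B x) ->
  mu.-integrable setT (fun x => (B x)%:E) -> `|\int[mu]_x f x| <= \int[mu]_x B x.
Proof.
move=> fB iB.
have B0 x : 0 <= B x by exact: le_trans (fB x).
have BE : (\int[mu]_x (B x)%:E)%E = (\int[mu]_x B x)%:E.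
  by rewrite fineK//; exact: integrable_fin_num.
have IB (h : T -> \bar R) : (forall x, 0 <= h x <= (B x)%:E)%E ->
    exists2 r, 0 <= r <= \int[mu]_x B x & (\int[mu]_x h x)%E = r%:E.
  move=> h0.
  have h1 : (0 <= \int[mu]_x h x)%E by apply: integral_ge0 => x _; case/andP: (h0 x).
  have h2 : (\int[mu]_x h x <= (\int[mu]_x B x)%:E)%E.
    rewrite -BE; apply: ge0_integral_le_nonmeas => x; first by case/andP: (h0 x).
    by have /andP[] := h0 x.
  have hf : (\int[mu]_x h x)%E \is a fin_num.
    by rewrite ge0_fin_numE// (le_lt_trans h2)// ltry.
  exists (fine (\int[mu]_x h x)); last by rewrite fineK.
  by rewrite -!lee_fin fineK// h1 h2.
rewrite [X in `|X| <= _]/Rintegral integralE.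
have [x|r r0 ->] := IB (fun x => (EFin \o f)^\+ x)%E.
  by rewrite funepos_ge0 funeposE/= -EFin_max lee_fin ge_max B0 andbT (le_trans (ler_norm _)).
have [y|s s0 ->] := IB (fun x => (EFin \o f)^\- x)%E.
  by rewrite funeneg_ge0 funenegE/= -EFin_max lee_fin ge_max B0 andbT (le_trans _ (fB y))// -normrN ler_norm.
rewrite /=; case/andP: r0 => r0 rB; case/andP: s0 => s0 sB.
by rewrite ler_norml; apply/andP; split; lra.
Qed.

(** The factor 2 comes from bounding the real and imaginary integrals separately; the later
    estimates are insensitive to it. *)
Lemma normc_cintegral_le f B : (forall x, normc (f x) <= B x) ->
  mu.-integrable setT (fun x => (B x)%:E) ->
  normc (cintegral mu f) <= 2 * \int[mu]_x B x.
Proof.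
move=> fB iB; apply: (le_trans (normc_le_ReIm _)) => /=; rewrite mulr_natl mulr2n.
apply: lerD; apply: normr_Rintegral_le => // x; apply: le_trans (fB x).
  exact: Re_le_normc.
exact: Im_le_normc.
Qed.

End cintegral.

Lemma cmeas_comp {d d'} {T : measurableType d} {T' : measurableType d'} {R : realType}
  (f : T' -> R[i]) (g : T -> T') : measurable_fun setT g -> cmeas f ->
  cmeas (fun x => f (g x)).
Proof.
move=> mg [f1 f2]; split; [exact: (measurableT_comp f1 mg)|exact: (measurableT_comp f2 mg)].
Qed.

(** * Fubini and parameter integrals *)

Section fubini_complex.
Context {d1 d2} {T1 : measurableType d1} {T2 : measurableType d2} {R : realType}.
Variables (m1 : {sigma_finite_measure set T1 -> \bar R})
  (m2 : {sigma_finite_measure set T2 -> \bar R}).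
Local Open Scope complex_scope.

Lemma integrable_prod (B1 : T1 -> R) (B2 : T2 -> R) : (forall x, 0 <= B1 x) -> (forall y, 0 <= B2 y) ->
  m1.-integrable setT (fun x => (B1 x)%:E) ->
  m2.-integrable setT (fun y => (B2 y)%:E) ->
  (m1 \x m2)%E.-integrable setT (fun p => (B1 p.1 * B2 p.2)%:E) /\
  \int[(m1 \x m2)%E]_p (B1 p.1 * B2 p.2) = \int[m1]_x B1 x * \int[m2]_y B2 y.
Proof.
move=> B10 B20 i1 i2.
have mB : measurable_fun setT (fun p : T1 * T2 => (B1 p.1 * B2 p.2)%:E).
  apply/measurable_EFinP; apply: measurable_funM; apply: measurableT_comp => //.
    by move/measurable_int/measurable_EFinP : i1.
  by move/measurable_int/measurable_EFinP : i2.
have E : (\int[m1]_x \int[m2]_y (B1 x * B2 y)%:E = (\int[m1]_x B1 x * \int[m2]_y B2 y)%:E)%E.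
  under eq_integral => x _.
    under eq_integral do rewrite EFinM.
    rewrite integralZl//.
    over.
  have -> : (\int[m2]_y (B2 y)%:E)%E = (\int[m2]_y B2 y)%:E.
    by rewrite fineK//; exact: integrable_fin_num.
  rewrite integralZr// EFinM; congr (_ * _)%E.
  by rewrite fineK//; exact: integrable_fin_num.
split.
  apply/integrable12ltyP => //.
  under eq_integral => x _.
    under eq_integral do rewrite /= ger0_norm ?mulr_ge0//.
    over.
  by rewrite E ltry.
rewrite /Rintegral fubini_tonelli1//; last by move=> p; rewrite lee_fin mulr_ge0.
by rewrite /fubini_F/= E.
Qed.

Lemma cmeas_pair1 (f : T1 * T2 -> R[i]) y : cmeas f -> cmeas (fun x => f (x, y)).
Proof.
by move=> [f1 f2]; split; [apply: (measurable_fun_pair1 y f1)|apply: (measurable_fun_pair1 y f2)].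
Qed.

Lemma cmeas_pair2 (f : T1 * T2 -> R[i]) x : cmeas f -> cmeas (fun y => f (x, y)).
Proof.
by move=> [f1 f2]; split; [apply: (measurable_fun_pair2 x f1)|apply: (measurable_fun_pair2 x f2)].
Qed.

Variables (f : T1 * T2 -> R[i]) (B1 : T1 -> R) (B2 : T2 -> R).
Hypotheses (B10 : forall x, 0 <= B1 x) (B20 : forall y, 0 <= B2 y)
  (i1 : m1.-integrable setT (fun x => (B1 x)%:E))
  (i2 : m2.-integrable setT (fun y => (B2 y)%:E))
  (mf : cmeas f) (fB : forall x y, normc (f (x, y)) <= B1 x * B2 y).

(** A majorant in product form makes every section of [f] integrable, not merely almost every one,
    so the iterated integrals below can be rewritten pointwise. *)
Lemma cintegrable_dom_prod : cintegrable (m1 \x m2)%E f.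
Proof.
apply: (@le_cintegrable _ _ _ _ _ (fun p => B1 p.1 * B2 p.2)) => //.
  by move=> [x y]; exact: fB.
by have [] := integrable_prod B10 B20 i1 i2.
Qed.

Lemma cintegrable_dom_pair1 y : cintegrable m1 (fun x => f (x, y)).
Proof.
apply: (@le_cintegrable _ _ _ _ _ (fun x => B2 y * B1 x)) => //.
- exact: cmeas_pair1.
- by move=> x; rewrite mulrC.
- by have := integrableZl measurableT (B2 y) i1; apply: eq_integrable => // x _; rewrite EFinM.
Qed.

Lemma cintegrable_dom_pair2 x : cintegrable m2 (fun y => f (x, y)).
Proof.
apply: (@le_cintegrable _ _ _ _ _ (fun y => B1 x * B2 y)) => //.
- exact: cmeas_pair2.
- by have := integrableZl measurableT (B1 x) i2; apply: eq_integrable => // y _; rewrite EFinM.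
Qed.

Lemma cintegral_prod12 : cintegral (m1 \x m2)%E f =
  cintegral m1 (fun x => cintegral m2 (fun y => f (x, y))).
Proof.
have [f1 f2] := cintegrable_dom_prod.
rewrite /cintegral /Rintegral; congr (fine _ +i* fine _).
- rewrite -integral12_prod_meas1//; apply: eq_integral => x _ /=.
  by rewrite /fubini_F fineK//; apply: integrable_fin_num => //; case: (cintegrable_dom_pair2 x).
- rewrite -integral12_prod_meas1//; apply: eq_integral => x _ /=.
  by rewrite /fubini_F fineK//; apply: integrable_fin_num => //; case: (cintegrable_dom_pair2 x).
Qed.

Lemma cintegral_prod21 : cintegral (m1 \x m2)%E f =
  cintegral m2 (fun y => cintegral m1 (fun x => f (x, y))).
Proof.
have [f1 f2] := cintegrable_dom_prod.
rewrite /cintegral /Rintegral; congr (fine _ +i* fine _).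
- rewrite -integral21_prod_meas1//; apply: eq_integral => x _ /=.
  by rewrite /fubini_G fineK//; apply: integrable_fin_num => //; case: (cintegrable_dom_pair1 x).
- rewrite -integral21_prod_meas1//; apply: eq_integral => x _ /=.
  by rewrite /fubini_G fineK//; apply: integrable_fin_num => //; case: (cintegrable_dom_pair1 x).
Qed.

Lemma cintegral_fubini :
  cintegral m1 (fun x => cintegral m2 (fun y => f (x, y))) =
  cintegral m2 (fun y => cintegral m1 (fun x => f (x, y))).
Proof. by rewrite -cintegral_prod12 cintegral_prod21. Qed.

End fubini_complex.

Section param_integral.
Context {d1 d2} {T1 : measurableType d1} {T2 : measurableType d2} {R : realType}.
Variable (m2 : {sigma_finite_measure set T2 -> \bar R}).

(** The integrals of the positive and negative parts are measurable in the parameter by Tonelli, and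
    [fine] is measurable, also where it replaces an infinite value by 0. *)
Lemma measurable_Rintegral_param (h : T1 * T2 -> R) : measurable_fun setT h ->
  measurable_fun setT (fun x => \int[m2]_y h (x, y)).
Proof.
move=> mh; apply: (@measurableT_comp _ _ _ _ _ _ fine); first exact: fine_measurable.
rewrite (_ : (fun _ => _) = (fun x => \int[m2]_y (EFin \o h)^\+ (x, y) -
   \int[m2]_y (EFin \o h)^\- (x, y))%E); last first.
  apply/funext => x; rewrite integralE; congr (_ - _)%E;
  by apply: eq_integral => y _; rewrite ?funeposE ?funenegE.
have mh' : measurable_fun setT (EFin \o h) by exact/measurable_EFinP.
apply: emeasurable_funB.
- apply: (measurable_fun_fubini_tonelli_F ((EFin \o h)^\+)%E) => //; exact: measurable_funepos.
- apply: (measurable_fun_fubini_tonelli_F ((EFin \o h)^\-)%E) => //; exact: measurable_funeneg.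
Qed.

Lemma cmeas_cintegral (f : T1 * T2 -> R[i]) : cmeas f ->
  cmeas (fun x => cintegral m2 (fun y => f (x, y))).
Proof. by move=> [f1 f2]; split; [exact: (measurable_Rintegral_param f1)|exact: (measurable_Rintegral_param f2)]. Qed.

End param_integral.

Section dominated_complex.
Context {d} {T : measurableType d} {R : realType} (mu : {measure set T -> \bar R}).
Local Open Scope ereal_scope.

Lemma cvg_Rintegral_dom (F : nat -> T -> R) (f B : T -> R) :
  (forall n, measurable_fun setT (F n)) -> measurable_fun setT f ->
  (forall x, F n x @[n --> \oo] --> f x) ->
  (forall n x, (`|F n x| <= B x)%R) -> mu.-integrable setT (fun x => (B x)%:E) ->
  (\int[mu]_x F n x)%R @[n --> \oo] --> (\int[mu]_x f x)%R.
Proof.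
move=> mF mf Ff FB iB.
have [If _ cv] : [/\ mu.-integrable setT (EFin \o f),
    [sequence \int[mu]_x `|(F n x)%:E - (f x)%:E|]_n @ \oo --> 0 &
    [sequence \int[mu]_x (F n x)%:E]_n @ \oo --> \int[mu]_x (f x)%:E].
  apply: (@dominated_convergence _ _ _ mu setT measurableT _ _ (fun x => (B x)%:E)) => //.
  - by move=> n; exact/measurable_EFinP.
  - exact/measurable_EFinP.
  - by apply: aeW => x _; apply: cvg_EFin; [exact: nearW|exact: Ff].
  - by apply: aeW => x n _; rewrite lee_fin.
apply: fine_cvg; rewrite fineK//.
exact: integrable_fin_num.
Qed.

End dominated_complex.

(** * Integrals on the line *)

Section line.
Context {R : realType}.
Local Notation leb := (@lebesgue_measure R).
Implicit Types (x y s t : R).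
Local Open Scope complex_scope.

(** It serves twice: products over the coordinates are the integrable majorants of all domination
    arguments, and as half the Fourier transform of [exp (- |t|)] it provides the approximate
    identity behind Fourier inversion. *)
Definition cauchy_kernel t : R := (1 + t ^+ 2)^-1.

Lemma cauchy_kernel_gt0 t : 0 < cauchy_kernel t.
Proof. by rewrite invr_gt0 ltr_pwDl// sqr_ge0. Qed.

Lemma continuous_cauchy_kernel : continuous cauchy_kernel.
Proof.
move=> t; apply: cvgV; first by rewrite gt_eqF// ltr_pwDl// sqr_ge0.
by apply: cvgD; [exact: cvg_cst|exact: exprn_continuous].
Qed.

Lemma integral_cauchy_kernel : (\int[leb]_t (cauchy_kernel t)%:E = pi%:E)%E.
Proof.
rewrite ge0_symfun_integralT//=; last 3 first.
- by move=> t; rewrite ltW// cauchy_kernel_gt0.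
- exact: continuous_cauchy_kernel.
- by move=> t /=; rewrite /cauchy_kernel sqrrN.
rewrite -set_itvcy (@ge0_continuous_FTC2y _ cauchy_kernel (@atan R) 0 (pi / 2)).
- by rewrite atan0 sube0 -EFinM; congr EFin; field.
- by move=> t _; rewrite ltW// cauchy_kernel_gt0.
- by apply: continuous_subspaceT; exact: continuous_cauchy_kernel.
- exact: cvgy_atan.
- by move=> t _; exact: derivable_atan.
- by apply: cvg_at_right_filter; exact: continuous_atan.
- by move=> t _; rewrite derive1_atan.
Qed.

Lemma integrable_cauchy_kernel : leb.-integrable setT (fun t => (cauchy_kernel t)%:E).
Proof.
apply/integrableP; split.
  by apply/measurable_EFinP; apply: continuous_measurable_fun; exact: continuous_cauchy_kernel.
under eq_integral do rewrite /= gtr0_norm ?cauchy_kernel_gt0//.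
by rewrite integral_cauchy_kernel ltry.
Qed.

(** Lebesgue measure is determined by its values on half-open intervals. For negative [s] the
    preimage of such an interval is half-open on the other side, with the same length formula. *)
Lemma lebesgue_measure_affine y s (A : set R) : s != 0 -> measurable A ->
  (`|s|%:E * leb ((fun t => y + s * t)%R @^-1` A) = leb A)%E.
Proof.
move=> s0 mA.
have mT : measurable_fun setT ((fun t => y + s * t) : measurableTypeR R -> measurableTypeR R).
  by apply: measurable_funD => //; exact: measurable_funM.
pose T : measurableTypeR R -> measurableTypeR R := fun t => y + s * t.
pose nu : {measure set (measurableTypeR R) -> \bar R} :=
  mscale (NngNum (normr_ge0 s)) (pushforward leb T).
apply/esym; apply: (@lebesgue_measure_unique _ (nu mT)) => // _ [[a b]] _ <- /=.
rewrite /mscale/= /pushforward/=.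
have [s_gt0|s_le0] := ltP 0 s.
- rewrite (_ : _ @^-1` _ = `](a - y) / s, (b - y) / s]%classic); last first.
    apply/seteqP; split=> t /=; rewrite !in_itv/= /T ltr_pdivrMr// ler_pdivlMr//;
    by move=> /andP[? ?]; apply/andP; split; lra.
  rewrite !lebesgue_measure_itv/= !lte_fin ltr_pM2r ?invr_gt0// ltrD2r.
  case: ifPn => ab; last by rewrite mule0.
  by rewrite gtr0_norm// -EFinB -EFinM; congr EFin; field.
- have s_lt0 : s < 0 by rewrite lt_neqAle s0.
  rewrite (_ : _ @^-1` _ = `[(b - y) / s, (a - y) / s[%classic); last first.
    apply/seteqP; split=> t /=; rewrite !in_itv/= /T ltr_ndivlMr// ler_ndivrMr//;
    by move=> /andP[? ?]; apply/andP; split; lra.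
  rewrite !lebesgue_measure_itv/= !lte_fin ltr_nM2r ?invr_lt0// ltrD2r.
  case: ifPn => ab; last by rewrite mule0.
  by rewrite ltr0_norm// -!EFinB -EFinM; congr EFin; field.
Qed.

Lemma ge0_integral_affine y s (h : R -> \bar R) : s != 0 -> measurable_fun setT h ->
  (forall t, 0 <= h t)%E ->
  (\int[leb]_t h t = `|s|%:E * \int[leb]_t h (y + s * t)%R)%E.
Proof.
move=> s0 mh h0.
have mT : measurable_fun setT ((fun t => y + s * t) : measurableTypeR R -> measurableTypeR R).
  by apply: measurable_funD => //; exact: measurable_funM.
pose T : measurableTypeR R -> measurableTypeR R := fun t => y + s * t.
have := @ge0_integral_pushforward _ _ _ _ _ T mT leb setT h measurableT mh (fun t _ => h0 t).
rewrite preimage_setT /= => <-.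
rewrite -(@ge0_integral_mscale _ _ _ (pushforward leb T) setT measurableT (NngNum (normr_ge0 s)))//.
apply: eq_measure_integral => A mA _ /=.
by rewrite /mscale/= /pushforward lebesgue_measure_affine.
Qed.

End line.

(** * Change of variables, from nonnegative to complex integrands *)

Section change_of_variables.
Context {d} {T : measurableType d} {R : realType} (mu : {measure set T -> \bar R}).
Variables (T0 : T -> T) (c : R).
Hypotheses (mT : measurable_fun setT T0)
  (muT : forall h : T -> \bar R, measurable_fun setT h -> (forall x, 0 <= h x)%E ->
     (\int[mu]_x h x = c%:E * \int[mu]_x h (T0 x))%E)
  (c_gt0 : 0 < c).
Local Open Scope complex_scope.

Lemma integrable_change_of_variables (h : T -> R) :
  mu.-integrable setT (fun x => (h x)%:E) ->
  mu.-integrable setT (fun x => (h (T0 x))%:E) /\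
  \int[mu]_x h x = c * \int[mu]_x h (T0 x).
Proof.
move=> ih; have mh := measurable_int _ ih.
have mhT : measurable_fun setT (fun x => (h (T0 x))%:E).
  exact: (measurableT_comp mh mT).
have ihT : mu.-integrable setT (fun x => (h (T0 x))%:E).
  apply/integrableP; split => //.
  case/integrableP : ih => _; rewrite muT//; last exact: measurableT_comp.
  move=> H; rewrite ltey; apply: contraTneq H => ->.
  by rewrite gt0_muley// lte_fin.
have E (g : T -> \bar R) : measurable_fun setT g -> (forall x, 0 <= g x)%E ->
    (\int[mu]_x g (T0 x) \is a fin_num)%E ->
    fine (\int[mu]_x g x)%E = c * fine (\int[mu]_x g (T0 x))%E.
  by move=> mg g0 gf; rewrite muT// fineM.
split => //; rewrite /Rintegral [X in fine X = _]integralE [X in _ = c * fine X]integralE.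
have P1 : (\int[mu]_x ((EFin \o h)^\+ (T0 x)) = \int[mu]_x (EFin \o (h \o T0))^\+ x)%E.
  by apply: eq_integral => x _; rewrite !funeposE.
have P2 : (\int[mu]_x ((EFin \o h)^\- (T0 x)) = \int[mu]_x (EFin \o (h \o T0))^\- x)%E.
  by apply: eq_integral => x _; rewrite !funenegE.
have F1 := integrable_pos_fin_num measurableT ihT.
have F2 := integrable_neg_fin_num measurableT ihT.
have F3 := integrable_pos_fin_num measurableT ih.
have F4 := integrable_neg_fin_num measurableT ih.
rewrite [fine (_ - _)%E]fineB// [fine (_ - _)%E in RHS]fineB// mulrBr; congr (_ - _).
- rewrite (E (EFin \o h)^\+%E) ?P1//; exact: measurable_funepos.
- rewrite (E (EFin \o h)^\-%E) ?P2//; exact: measurable_funeneg.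
Qed.

Lemma cintegral_change_of_variables (f : T -> R[i]) : cintegrable mu f ->
  cintegrable mu (fun x => f (T0 x)) /\
  cintegral mu f = c%:C * cintegral mu (fun x => f (T0 x)).
Proof.
move=> [/integrable_change_of_variables [i1 e1] /integrable_change_of_variables [i2 e2]].
by split; [split|rewrite /cintegral e1 e2; simpc].
Qed.

End change_of_variables.

(** * The Laplace kernel and its Fourier transform *)

Section laplace_kernel.
Context {R : realType}.
Local Notation leb := (@lebesgue_measure R).
Local Open Scope complex_scope.

Lemma expR_bounded_cvg0 (h : R -> R) (M : R) : (forall t, `|h t| <= M) ->
  expR (- t) * h t @[t --> +oo] --> 0.
Proof.
move=> hM; apply: (@squeeze_cvgr _ _ _ _ (fun t => expR (- t) * - M) (fun t => expR (- t) * M)).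
- apply: nearW => t; rewrite !ler_pM2l ?expR_gt0//; move: (hM t).
  by rewrite ler_norml.
- rewrite -(mul0r (- M)); apply: cvgM; [exact: cvgr_expR|exact: cvg_cst].
- rewrite -(mul0r M); apply: cvgM; [exact: cvgr_expR|exact: cvg_cst].
Qed.

Lemma continuous_laplace : continuous (fun t : R => expR (- `|t|)).
Proof.
move=> t.
apply: (continuous_comp (f := fun t : R => - `|t|) (g := @expR R)); last exact: continuous_expR.
apply: (continuous_comp (f := fun t : R => `|t|) (g := fun t => - t)); last exact: opp_continuous.
exact: norm_continuous.
Qed.

(** Adding 1 to the cosine makes the integrand nonnegative, as the fundamental theorem of calculus
    on a half-line requires; the contribution of the 1 is subtracted afterwards, in
    [fourier_laplace]. *)
Lemma integral_laplace_1Dcos (x : R) :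
  (\int[leb]_t (expR (- `|t|) * (1 + cos (x * t)))%:E = (2 + 2 * cauchy_kernel x)%:E)%E.
Proof.
have cc : continuous (fun t : R => 1 + cos (x * t)).
  move=> t; apply: cvgD; first exact: cvg_cst.
  apply: (continuous_comp (f := fun t => x * t)); last exact: continuous_cos.
  by apply: cvgM; [exact: cvg_cst|exact: cvg_id].
have ce : continuous (fun t : R => expR (- t)).
  by move=> t; apply: (continuous_comp (f := fun t => - t)); [exact: opp_continuous|exact: continuous_expR].
rewrite ge0_symfun_integralT//.
  rewrite -set_itvcy.
  (* [expR (- t) * h t] is an antiderivative on the half-line: it tends to 0 at infinity and equals
     [- (1 + cauchy_kernel x)] at 0. *)
  pose h (t : R) := (x * sin (x * t) - cos (x * t)) * cauchy_kernel x - 1.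
  have h0 (t : R) : 0 <= expR (- t) * (1 + cos (x * t)).
    by rewrite mulr_ge0 ?expR_ge0// -lerBlDl sub0r; exact: cos_geN1.
  have -> : (\int[leb]_(t in `[0%R, +oo[) (expR (- `|t|) * (1 + cos (x * t)))%:E =
     \int[leb]_(t in `[0%R, +oo[) (expR (- t) * (1 + cos (x * t)))%:E)%E.
    by apply: eq_integral => t; rewrite inE/= in_itv/= andbT => t0; rewrite ger0_norm.
  have dG (t : R) : is_derive t 1 (fun t => expR (- t) * h t) (expR (- t) * (1 + cos (x * t))).
    apply: is_derive_eq; rewrite /GRing.scale/= /h /cauchy_kernel.
    by field; rewrite gt_eqF// ltr_pwDl// sqr_ge0.
  have cG : continuous (fun t => expR (- t) * h t).
    by move=> s; apply: differentiable_continuous; apply/derivable1_diffP; case: (dG s).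
  rewrite (@ge0_continuous_FTC2y _ _ (fun t => expR (- t) * h t) 0 0).
  + rewrite /h mulr0 sin0 cos0 oppr0 expR0 -EFinB -EFinM; congr EFin; ring.
  + by move=> t _; exact: h0.
  + by apply: continuous_subspaceT => t; apply: cvgM; [exact: ce|exact: cc].
  + apply: (@expR_bounded_cvg0 _ ((`|x| + 1) * cauchy_kernel x + 1)) => t.
    rewrite (le_trans (ler_normB _ _))// normr1 lerD2r normrM.
    rewrite [`|cauchy_kernel x|]gtr0_norm ?cauchy_kernel_gt0// ler_pM2r ?cauchy_kernel_gt0//.
    rewrite (le_trans (ler_normB _ _))// normrM lerD ?ler_piMr//.
      by rewrite ler_norml sin_geN1 sin_le1.
    by rewrite ler_norml cos_geN1 cos_le1.
  + by move=> t _; case: (dG t).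
  + by apply: cvg_at_right_filter; exact: cG.
  + by move=> t _; rewrite derive1E; case: (dG t).
- move=> t; apply: cvgM; last exact: cc.
  exact: continuous_laplace.
- by move=> t /=; rewrite normrN mulrN cosN.
Qed.

Lemma measurable_laplace : measurable_fun [set: measurableTypeR R] (fun t : R => expR (- `|t|)).
Proof.
exact: continuous_measurable_fun continuous_laplace.
Qed.

Lemma integrable_laplace : leb.-integrable setT (fun t => (expR (- `|t|))%:E).
Proof.
apply/integrableP; split; first by apply/measurable_EFinP; refine measurable_laplace.
have := integral_laplace_1Dcos 0.
under eq_integral do rewrite mul0r cos0.
move=> E; apply: (@le_lt_trans _ _ (\int[leb]_t (expR (- `|t|) * (1 + 1))%:E)%E); last first.
  by rewrite E ltry.
apply: ge0_integral_le_nonmeas => t; first by rewrite lee_fin.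
by rewrite lee_fin ger0_norm ?expR_ge0// ler_peMr ?expR_ge0//; lra.
Qed.

Lemma Rintegral_laplace : \int[leb]_t expR (- `|t|) = 2.
Proof.
have := integral_laplace_1Dcos 0.
under eq_integral do rewrite mul0r cos0 mulrC.
move/(congr1 fine); rewrite -/(Rintegral _ _ _) RintegralZl//; last exact: integrable_laplace.
rewrite /cauchy_kernel /= expr2 mulr0 addr0 invr1; lra.
Qed.

Lemma cintegrable_laplace (x : R) :
  cintegrable leb (fun t => (expR (- `|t|))%:C * cis (x * t)).
Proof.
refine (@le_cintegrable _ _ _ leb _ (fun t : R => expR (- `|t|)) _ _ integrable_laplace).
- apply: cmeasM; first by apply: cmeas_real; refine measurable_laplace.
  by apply: cmeas_cis; exact: measurable_funM.
- by move=> t; rewrite normcM normc_real normc_cis mulr1 ger0_norm ?expR_ge0.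
Qed.

Lemma fourier_laplace (x : R) :
  cintegral leb (fun t => (expR (- `|t|))%:C * cis (x * t)) = (2 * cauchy_kernel x)%:C.
Proof.
have [i1 i2] := cintegrable_laplace x.
rewrite /cintegral; congr (_ +i* _).
- have := integral_laplace_1Dcos x => /(congr1 fine).
  under eq_integral do rewrite mulrDr mulr1.
  rewrite -/(Rintegral _ _ _) RintegralD//; last 2 first.
  + exact: integrable_laplace.
  + by apply: eq_integrable i1 => // t _ /=; rewrite mul0r subr0.
  rewrite Rintegral_laplace /=.
  move=> E; apply: (@addrI _ 2); rewrite -{}E; congr (_ + _).
  by apply: eq_Rintegral => t _ /=; rewrite mul0r subr0.
(* The imaginary part is odd in [t], so the reflection of the line shows that its integral is its
   own opposite. *)
- set f := (X in Rintegral _ _ X).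
  have [] := @integrable_change_of_variables _ _ _ leb (fun t : R => 0 + -1 * t) `|-1| _ _ _ f i2.
  + by apply: measurable_funD => //; exact: measurable_funM.
  + by move=> g mg g0; apply: ge0_integral_affine => //; rewrite oppr_eq0 oner_eq0.
  + by rewrite normrN normr1.
  + move=> _; rewrite normrN normr1 mul1r.
  have -> : \int[leb]_t f (0 + -1 * t) = \int[leb]_t (-1 * f t).
    apply: eq_Rintegral => t _; rewrite /f add0r mulN1r /= normrN mulrN sinN.
    by rewrite !mul0r !addr0; ring.
  rewrite RintegralZl// => E; lra.
Qed.

End laplace_kernel.

(** * Lebesgue measure on row vectors *)

Section rV_measure.
Context {R : realType}.
Local Notation leb := (@lebesgue_measure R).
Local Notation lebn := (@lebesgue_rV R).
Local Open Scope complex_scope.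

Lemma rV_cons0 n (p : measurableTypeR R * 'rV[R]_n) : rV_cons p 0 ord0 = p.1.
Proof.
rewrite /rV_cons (_ : ord0 = lshift n (ord0 : 'I_1)); last exact/val_inj.
by rewrite (@row_mxEl R 1 1 n) mxE.
Qed.

Lemma rV_consS n (p : measurableTypeR R * 'rV[R]_n) (i : 'I_n) :
  rV_cons p 0 (lift ord0 i) = p.2 0 i.
Proof.
rewrite /rV_cons (_ : lift ord0 i = rshift 1 i); last exact/val_inj.
exact: (@row_mxEr R 1 1 n).
Qed.

Lemma ge0_integral_rV_S n (h : 'rV[R]_n.+1 -> \bar R) : measurable_fun setT h ->
  (forall x, 0 <= h x)%E ->
  (\int[lebn n.+1]_x h x = \int[leb]_t \int[lebn n]_v h (rV_cons (t, v)))%E.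
Proof.
move=> mh h0.
transitivity (\int[(leb \x lebn n)%E]_p h (rV_cons p))%E; last first.
  rewrite fubini_tonelli1//.
  exact: (measurableT_comp mh measurable_rV_cons).
have := @ge0_integral_pushforward _ _ _ _ _ (@rV_cons R n) measurable_rV_cons
  (leb \x lebn n)%E setT h measurableT mh (fun t _ => h0 t).
by rewrite preimage_setT => H; refine H.
Qed.

Lemma cintegral_rV_S n (f : 'rV[R]_n.+1 -> R[i]) : cmeas f ->
  cintegrable (leb \x lebn n)%E (fun p => f (rV_cons p)) ->
  cintegrable (lebn n.+1) f /\
  cintegral (lebn n.+1) f = cintegral (leb \x lebn n)%E (fun p => f (rV_cons p)).
Proof.
move=> [m1 m2] [i1 i2].
have E (h : 'rV[R]_n.+1 -> R) : measurable_fun setT h ->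
    (leb \x lebn n)%E.-integrable setT (fun p => (h (rV_cons p))%:E) ->
    (lebn n.+1).-integrable setT (fun x => (h x)%:E) /\
    \int[lebn n.+1]_x h x = \int[(leb \x lebn n)%E]_p h (rV_cons p).
  move=> mh ih; have mh' : measurable_fun setT (EFin \o h) by exact/measurable_EFinP.
  split.
    apply/integrableP; split => //.
    have := @ge0_integral_pushforward _ _ _ _ _ (@rV_cons R n) measurable_rV_cons
      (leb \x lebn n)%E setT (fun x => `|(h x)%:E|%E) measurableT
      (measurableT_comp (@abse_measurable _ setT) mh') (fun t _ => abse_ge0 _).
    rewrite preimage_setT => H; case/integrableP : ih => _; rewrite -{}H.
    by move=> H; refine H.
  have := @integral_pushforward _ _ _ _ _ (@rV_cons R n) measurable_rV_cons
    (leb \x lebn n)%E setT (EFin \o h) mh'.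
  rewrite preimage_setT => /(_ ih measurableT) H.
  by rewrite /Rintegral; congr fine; refine H.
have [j1 e1] := E _ m1 i1; have [j2 e2] := E _ m2 i2.
by split; [split|rewrite /cintegral e1 e2].
Qed.

Lemma rV0_eq (x y : 'rV[R]_0) : x = y.
Proof. by apply/rowP => -[]. Qed.

Lemma measurable_affine_rV n (y : 'rV[R]_n) (s : R) :
  measurable_fun setT (fun x : 'rV[R]_n => y + s *: x).
Proof.
apply: measurable_fun_rV => i.
rewrite (_ : (fun _ => _) = (fun x : 'rV[R]_n => y 0 i + s * x 0 i)); last first.
  by apply/funext => x; rewrite !mxE.
by apply: measurable_funD => //; apply: measurable_funM => //; exact: measurable_coord.
Qed.

(** Each coordinate contributes one factor [|s|]: the first coordinate is split off by [rV_cons],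
    and the formula on the line is applied to the inner integral as a function of it. *)
Lemma ge0_integral_affine_rV n (y : 'rV[R]_n) (s : R) (h : 'rV[R]_n -> \bar R) :
  s != 0 -> measurable_fun setT h -> (forall x, 0 <= h x)%E ->
  (\int[lebn n]_x h x = (`|s| ^+ n)%:E * \int[lebn n]_x h (y + s *: x)%R)%E.
Proof.
move=> s0; elim: n y h => [|n IH] y h mh h0.
  by rewrite expr0 mul1e; apply: eq_integral => x _; congr h; exact: rV0_eq.
have mhy : measurable_fun setT (fun x : 'rV[R]_n.+1 => h (y + s *: x)).
  exact: (measurableT_comp mh (measurable_affine_rV y s)).
rewrite !ge0_integral_rV_S//.
set y0 := y 0 ord0; set y' : 'rV[R]_n := \row_i y 0 (lift ord0 i).
have consE t v : y + s *: rV_cons (t, v) = rV_cons (y0 + s * t, y' + s *: v).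
  apply/rowP => i; rewrite 2!mxE.
  by case: (unliftP ord0 i) => [j ->|->]; rewrite ?rV_consS ?rV_cons0 /= ?mxE.
have mcons : measurable_fun setT (fun p : measurableTypeR R * 'rV[R]_n => h (rV_cons p)).
  exact: (measurableT_comp mh measurable_rV_cons).
pose H t := (\int[lebn n]_v h (rV_cons (t, v)))%E.
have mH : measurable_fun setT H.
  exact: (measurable_fun_fubini_tonelli_F (fun p => h (rV_cons p))).
have H0 t : (0 <= H t)%E by exact: integral_ge0.
rewrite -/H (ge0_integral_affine y0 s0 mH H0).
have HE t : H (y0 + s * t) = ((`|s| ^+ n)%:E * \int[lebn n]_v h (y + s *: rV_cons (t, v))%R)%E.
  rewrite /H (IH y'); last 2 first.
  - exact: (measurable_fun_pair2 _ mcons).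
  - by [].
  by congr (_ * _)%E; apply: eq_integral => v _; rewrite consE.
under eq_integral do rewrite HE.
rewrite ge0_integralZl_EFin//.
- by rewrite muleA -EFinM exprS.
- by move=> t _; exact: integral_ge0.
- apply: (measurable_fun_fubini_tonelli_F (fun p => h (y + s *: rV_cons p)%R)) => //.
  exact: (measurableT_comp mhy measurable_rV_cons).
Qed.

Lemma cintegral_affine_rV n (y : 'rV[R]_n) (s : R) (f : 'rV[R]_n -> R[i]) :
  s != 0 -> cintegrable (lebn n) f ->
  cintegrable (lebn n) (fun x => f (y + s *: x)) /\
  cintegral (lebn n) f = (`|s| ^+ n)%:C * cintegral (lebn n) (fun x => f (y + s *: x)).
Proof.
move=> s0 fi; apply: cintegral_change_of_variables => //.
- exact: measurable_affine_rV.
- by move=> h mh h0; exact: ge0_integral_affine_rV.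
- by rewrite exprn_gt0// normr_gt0.
Qed.

Lemma cintegral_shift_rV n (y : 'rV[R]_n) (f : 'rV[R]_n -> R[i]) :
  cintegrable (lebn n) f ->
  cintegrable (lebn n) (fun x => f (x + y)) /\
  cintegral (lebn n) (fun x => f (x + y)) = cintegral (lebn n) f.
Proof.
move=> fi; have [i1 ->] := cintegral_affine_rV y (oner_neq0 R) fi.
have E : (fun x => f (x + y)) = (fun x => f (y + 1 *: x)).
  by apply/funext => x; rewrite scale1r addrC.
by rewrite E normr1 expr1n mul1r.
Qed.

Lemma cintegral_opp_rV n (y : 'rV[R]_n) (f : 'rV[R]_n -> R[i]) :
  cintegrable (lebn n) f ->
  cintegrable (lebn n) (fun x => f (y - x)) /\
  cintegral (lebn n) (fun x => f (y - x)) = cintegral (lebn n) f.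
Proof.
have s0 : -1 != 0 :> R by rewrite oppr_eq0 oner_neq0.
move=> fi; have [i1 ->] := cintegral_affine_rV y s0 fi.
have E : (fun x => f (y - x)) = (fun x => f (y + -1 *: x)).
  by apply/funext => x; rewrite scaleN1r.
by rewrite E normrN normr1 expr1n mul1r.
Qed.

Lemma Rintegral_affine_rV n (y : 'rV[R]_n) (s : R) (f : 'rV[R]_n -> R) :
  s != 0 -> (lebn n).-integrable setT (fun x => (f x)%:E) ->
  (lebn n).-integrable setT (fun x => (f (y + s *: x))%:E) /\
  \int[lebn n]_x f x = (`|s| ^+ n) * \int[lebn n]_x f (y + s *: x).
Proof.
move=> s0 fi; apply: (integrable_change_of_variables (T0 := fun x : 'rV_n => y + s *: x)) => //.
- exact: measurable_affine_rV.
- by move=> h mh h0; exact: ge0_integral_affine_rV.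
- by rewrite exprn_gt0// normr_gt0.
Qed.

Lemma Rintegral_shift_rV n (y : 'rV[R]_n) (f : 'rV[R]_n -> R) :
  (lebn n).-integrable setT (fun x => (f x)%:E) ->
  (lebn n).-integrable setT (fun x => (f (x + y))%:E) /\
  \int[lebn n]_x f (x + y) = \int[lebn n]_x f x.
Proof.
move=> fi; have [i1 ->] := Rintegral_affine_rV y (oner_neq0 R) fi.
have E x : f (x + y) = f (y + 1 *: x) by rewrite scale1r addrC.
split; first by apply: eq_integrable i1 => // x _; rewrite E.
by rewrite normr1 expr1n mul1r; apply: eq_Rintegral => x _; rewrite E.
Qed.

Lemma cintegral_prod_coord n (h : 'I_n -> R -> R[i]) :
  (forall i, cintegrable leb (h i)) ->
  cintegrable (lebn n) (fun x => \prod_i h i (x 0 i)) /\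
  cintegral (lebn n) (fun x => \prod_i h i (x 0 i)) = \prod_i cintegral leb (h i).
Proof.
elim: n h => [|n IH] h hi.
  rewrite (_ : (fun _ => _) = (fun=> (1 : R)%:C)); last first.
    by apply/funext => x; rewrite big_ord0.
  have i1 : (lebn 0).-integrable setT (fun _ : 'rV[R]_0 => (1 : R)%:E).
    apply/integrableP; split; first exact: measurable_cst.
    by rewrite /= integral_dirac// diracT mul1e normr1 ltry.
  split.
    by apply: le_cintegrable i1 => [|x]; [exact: cmeas_cst|rewrite normc_real normr1].
  rewrite big_ord0 (cintegral_real _ (cst (1 : R))) /Rintegral/= integral_dirac// diracT mul1e.
  by [].
have [iv ev] := IH (fun i => h (lift ord0 i)) (fun i => hi _).
have mf : cmeas (fun x : 'rV[R]_n.+1 => \prod_i h i (x 0 i)).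
  apply: cmeas_prod => i; apply: (cmeas_comp (f := h i)).
    exact: measurable_coord.
  exact: cintegrable_cmeas (hi i).
have E p : \prod_i h i (rV_cons p 0 i) = h ord0 p.1 * \prod_i h (lift ord0 i) (p.2 0 i).
  rewrite big_ord_recl rV_cons0; congr (_ * _).
  by apply: eq_bigr => i _; rewrite rV_consS.
pose F := fun p : measurableTypeR R * 'rV[R]_n => h ord0 p.1 * \prod_i h (lift ord0 i) (p.2 0 i).
have FE : (fun p => \prod_i h i (rV_cons p 0 i)) = F by apply/funext.
have mF : cmeas F.
  rewrite -FE; apply: (cmeas_comp (g := @rV_cons R n) _ mf); exact: measurable_rV_cons.
have i1 := cintegrable_normc (hi ord0); have i2 := cintegrable_normc iv.
have FB t v : normc (F (t, v)) <= normc (h ord0 t) * normc (\prod_i h (lift ord0 i) (v 0 i)).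
  by rewrite /F/= normcM.
have n1 t : 0 <= normc (h ord0 t) by exact: normc_ge0.
have n2 (v : 'rV[R]_n) : 0 <= normc (\prod_i h (lift ord0 i) (v 0 i)) by exact: normc_ge0.
have iF := cintegrable_dom_prod (m1 := leb) (m2 := lebn n) n1 n2 i1 i2 mF FB.
have [j1 j2] := cintegral_rV_S mf (eq_ind_r (cintegrable _) iF FE).
split => //; rewrite {}j2 big_ord_recl -ev FE.
rewrite (cintegral_prod12 (m1 := leb) (m2 := lebn n) n1 n2 i1 i2 mF FB) -cintegralZr//.
by apply: eq_cintegral => t; rewrite /F /= -cintegralZ.
Qed.

Definition cauchy_rV n (x : 'rV[R]_n) : R := \prod_i cauchy_kernel (x 0 i).

Lemma cauchy_rV_gt0 n (x : 'rV[R]_n) : 0 < cauchy_rV x.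
Proof. by apply: prodr_gt0 => i _; exact: cauchy_kernel_gt0. Qed.

Lemma cauchy_rV_ge0 n (x : 'rV[R]_n) : 0 <= cauchy_rV x.
Proof. exact/ltW/cauchy_rV_gt0. Qed.

Lemma cintegral_cauchy_rV n :
  cintegrable (lebn n) (fun x => (cauchy_rV x)%:C) /\
  cintegral (lebn n) (fun x => (cauchy_rV x)%:C) = (pi ^+ n)%:C.
Proof.
have ci : cintegrable leb (fun t : R => (cauchy_kernel t)%:C).
  refine (@le_cintegrable _ _ _ leb _ (fun t : R => cauchy_kernel t) _ _ integrable_cauchy_kernel).
  - apply: cmeas_real; exact: (continuous_measurable_fun (@continuous_cauchy_kernel R)).
  - by move=> t; rewrite normc_real ger0_norm// ltW// cauchy_kernel_gt0.
have [i1 e1] := @cintegral_prod_coord n (fun _ t => (cauchy_kernel t)%:C) (fun=> ci).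
have E (x : 'rV[R]_n) : \prod_i (cauchy_kernel (x 0 i))%:C = (cauchy_rV x)%:C.
  by rewrite /cauchy_rV rmorph_prod.
have FE : (fun x : 'rV[R]_n => \prod_i (cauchy_kernel (x 0 i))%:C) = (fun x => (cauchy_rV x)%:C).
  exact/funext.
rewrite -FE; split => //; rewrite e1.
rewrite (cintegral_real leb (@cauchy_kernel R)) /Rintegral integral_cauchy_kernel/=.
by rewrite prodr_const card_ord rmorphXn.
Qed.

Lemma integrable_cauchy_rV n : (lebn n).-integrable setT (fun x => (cauchy_rV x)%:E).
Proof. by have [[]] := cintegral_cauchy_rV n. Qed.

Lemma Rintegral_cauchy_rV n : \int[lebn n]_x cauchy_rV x = pi ^+ n.
Proof.
have [_] := cintegral_cauchy_rV n.
by rewrite cintegral_real => /(congr1 (@complex.Re R)).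
Qed.

Lemma measurable_cauchy_rV n : measurable_fun setT (@cauchy_rV n).
Proof. by apply/measurable_EFinP; refine (measurable_int _ (integrable_cauchy_rV n)). Qed.

(** The exponent is the l1 norm, not the Euclidean one, so the kernel is a product over the
    coordinates and its transform is the product of those on the line. *)
Lemma fourier_laplace_rV n (x : 'rV[R]_n) :
  let F (xi : 'rV[R]_n) := (expR (- \sum_i `|xi 0 i|))%:C * cis (dotv x xi) in
  cintegrable (lebn n) F /\ cintegral (lebn n) F = (2 ^+ n * cauchy_rV x)%:C.
Proof.
move=> F.
have [i1 e1] := @cintegral_prod_coord n
  (fun i t => (expR (- `|t|))%:C * cis (x 0 i * t)) (fun i => cintegrable_laplace _).
have FE : F = (fun xi : 'rV[R]_n => \prod_i ((expR (- `|xi 0 i|))%:C * cis (x 0 i * xi 0 i))).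
  apply/funext => xi; rewrite big_split/= /F -rmorph_prod -expR_sum/= sumrN; congr (_ * _).
  rewrite /dotv; elim/big_ind2 : _ => [|a b c d <- <-|]//; first exact: cis0.
  exact: cisD.
rewrite FE; split => //; rewrite e1.
under eq_bigr do rewrite fourier_laplace.
by rewrite -rmorph_prod/= big_split/= prodr_const card_ord.
Qed.

Lemma rV_continuousP n (f : 'rV[R]_n -> R) (x : 'rV[R]_n) : {for x, continuous f} <->
  forall e : R, 0 < e -> exists2 de : R, 0 < de & forall y : 'rV[R]_n, (forall i, `|x 0 i - y 0 i| < de) ->
    `|f x - f y| < e.
Proof.
split=> [cf e e0|H].
  have /cvgr_dist_lt/(_ _ e0)/nbhs_ballP[de /= de0 H] := cf.
  exists de => // y xy; apply: H; split => // i j; rewrite (ord1 i); exact: xy.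
apply/(@cvgrPdist_lt _ _ _ (nbhs x) (nbhs_filter x)) => e e0; have [de de0 Hd] := H e e0.
apply/nbhs_ballP; exists de => //= y [_ xy]; apply: Hd => i; exact: xy.
Qed.

Lemma measurable_floor_coord n (s : R) (m : 'rV[int]_n) :
  measurable [set x : 'rV[R]_n | forall i, Num.floor (s * x 0 i) = m 0 i].
Proof.
rewrite (_ : mkset _ = \bigcap_(i in [set: 'I_n]) [set x : 'rV[R]_n | Num.floor (s * x 0 i) = m 0 i]); last first.
  by apply/seteqP; split => [x /= H i _|x H i]; [exact: H|exact: (H i I)].
apply: fin_bigcap_measurable => // i _.
have mc : measurable_fun setT (fun x : 'rV[R]_n => s * x 0 i).
  by apply: measurable_funM => //; exact: measurable_coord.
have := mc measurableT `[(m 0 i)%:~R, (m 0 i + 1)%:~R[%classic (measurable_itv _).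
rewrite setTI; congr measurable; apply/seteqP; split => x /=; rewrite in_itv/=.
  by move=> H; apply/floor_def.
by move=> <-; rewrite floor_le floorD1_gt.
Qed.

(** The sigma-algebra is generated by the coordinates, so it is not given by the open sets directly.
    Rounding each coordinate down to a multiple of [1 / k.+1] gives functions with countably many
    values, measurable by [measurable_floor_coord], that converge pointwise to [f]. *)
Lemma continuous_measurable_rV n (f : 'rV[R]_n -> R) : continuous f ->
  measurable_fun setT f.
Proof.
move=> cf.
pose r (k : nat) (x : 'rV[R]_n) : 'rV[R]_n :=
  \row_i ((Num.floor (k.+1%:R * x 0 i))%:~R / k.+1%:R).
apply: (@measurable_fun_cvg _ _ _ _ (fun k x => f (r k x))).
- move=> k _ Y mY; rewrite setTI.
  pose e (m : 'rV[int]_n) : 'rV[R]_n := \row_i ((m 0 i)%:~R / k.+1%:R).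
  rewrite (_ : _ @^-1` Y = \bigcup_(m in [set: 'rV[int]_n])
     (if f (e m) \in Y then [set x : 'rV[R]_n | forall i, Num.floor (k.+1%:R * x 0 i) = m 0 i] else set0)).
    apply: countable_bigcupT_measurable => [|m]; first exact: countableP.
    by case: ifP => _ //; exact: measurable_floor_coord.
  apply/seteqP; split => x /=.
    move=> Yx; exists (\row_i Num.floor (k.+1%:R * x 0 i)) => //.
    have -> : e (\row_i Num.floor (k.+1%:R * x 0 i)) = r k x.
      by apply/rowP => i; rewrite !mxE.
    by rewrite mem_set//= => i; rewrite mxE.
  move=> [m _]; case: ifPn => // /set_mem Ye /= H.
  suff -> : r k x = e m by [].
  by apply/rowP => i; rewrite !mxE H.
- move=> x _; apply/cvgrPdist_lt => e e0.
  have [de de0 Hd] := (rV_continuousP f x).1 (cf x) e e0.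
  near=> k; apply: Hd => i; rewrite mxE.
  have k0 : 0 < k.+1%:R :> R by rewrite ltr0n.
  have -> : x 0 i - (Num.floor (k.+1%:R * x 0 i))%:~R / k.+1%:R =
     (k.+1%:R * x 0 i - (Num.floor (k.+1%:R * x 0 i))%:~R) / k.+1%:R.
    by field; rewrite gt_eqF.
  have /andP[h1 h2] : ((Num.floor (k.+1%:R * x 0 i))%:~R <= k.+1%:R * x 0 i <
     (Num.floor (k.+1%:R * x 0 i) + 1)%:~R).
    by rewrite floor_le floorD1_gt.
  rewrite ger0_norm; last by rewrite divr_ge0// ?subr_ge0// ltW.
  rewrite (@le_lt_trans _ _ k.+1%:R^-1)//.
    rewrite -[leRHS]mul1r ler_pM2r ?invr_gt0//.
    by move: h2; rewrite intrD; lra.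
  near: k; exact: near_infty_natSinv_lt (PosNum de0).
Unshelve. all: end_near. Qed.
End rV_measure.

(** * Euclidean norm and weights *)

Section euclidean_facts.
Context {R : realType}.

Lemma dotvC n (x y : 'rV[R]_n) : dotv x y = dotv y x.
Proof. by apply: eq_bigr => i _; rewrite mulrC. Qed.

Lemma dotvDl n (x y z : 'rV[R]_n) : dotv (x + y) z = dotv x z + dotv y z.
Proof. by rewrite /dotv -big_split/=; apply: eq_bigr => i _; rewrite mxE mulrDl. Qed.

Lemma dotvZl n (s : R) (x z : 'rV[R]_n) : dotv (s *: x) z = s * dotv x z.
Proof. by rewrite /dotv mulr_sumr; apply: eq_bigr => i _; rewrite mxE mulrA. Qed.

Lemma dotvNl n (x z : 'rV[R]_n) : dotv (- x) z = - dotv x z.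
Proof. by rewrite -scaleN1r dotvZl mulN1r. Qed.

Lemma dotvBl n (x y z : 'rV[R]_n) : dotv (x - y) z = dotv x z - dotv y z.
Proof. by rewrite dotvDl dotvNl. Qed.

Lemma dotvDr n (x y z : 'rV[R]_n) : dotv z (x + y) = dotv z x + dotv z y.
Proof. by rewrite dotvC dotvDl !(dotvC z). Qed.

Lemma dotvZr n (s : R) (x z : 'rV[R]_n) : dotv z (s *: x) = s * dotv z x.
Proof. by rewrite dotvC dotvZl (dotvC z). Qed.

Lemma dotvNr n (x z : 'rV[R]_n) : dotv z (- x) = - dotv z x.
Proof. by rewrite dotvC dotvNl (dotvC z). Qed.

Lemma dotvBr n (x y z : 'rV[R]_n) : dotv z (x - y) = dotv z x - dotv z y.
Proof. by rewrite dotvDr dotvNr. Qed.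

Lemma dotv_ge0 n (x : 'rV[R]_n) : 0 <= dotv x x.
Proof. by apply: sumr_ge0 => i _; rewrite -expr2 sqr_ge0. Qed.

Lemma enorm_ge0 n (x : 'rV[R]_n) : 0 <= enorm x.
Proof. exact: sqrtr_ge0. Qed.

Lemma sqr_enorm n (x : 'rV[R]_n) : enorm x ^+ 2 = dotv x x.
Proof. by rewrite sqr_sqrtr// dotv_ge0. Qed.

Lemma enormN n (x : 'rV[R]_n) : enorm (- x) = enorm x.
Proof. by rewrite /enorm dotvNl dotvNr opprK. Qed.

Lemma enormZ n (s : R) (x : 'rV[R]_n) : enorm (s *: x) = `|s| * enorm x.
Proof.
by rewrite /enorm dotvZl dotvZr mulrA -expr2 sqrtrM ?sqr_ge0// sqrtr_sqr.
Qed.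

Lemma enorm0 n : enorm (0 : 'rV[R]_n) = 0.
Proof. by rewrite -(scale0r (0 : 'rV[R]_n)) enormZ normr0 mul0r. Qed.

Lemma coord_le_enorm n (x : 'rV[R]_n) i : `|x 0 i| <= enorm x.
Proof.
rewrite -sqrtr_sqr ler_wsqrtr// /dotv (bigD1 i)//= expr2 lerDl.
by apply: sumr_ge0 => j _; rewrite -expr2 sqr_ge0.
Qed.

Lemma dotv_le n (x y : 'rV[R]_n) : `|dotv x y| <= enorm x * enorm y.
Proof.
have [y0|y0] := eqVneq (enorm y) 0.
  have yi i : y 0 i = 0.
    by apply/eqP; rewrite -normr_le0 -y0 coord_le_enorm.
  rewrite /dotv big1 ?normr0 ?y0 ?mulr0// => i _; by rewrite yi mulr0.
have y2 : 0 < enorm y ^+ 2 by rewrite exprn_gt0// lt_neqAle eq_sym y0 enorm_ge0.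
rewrite -ler_sqr ?nnegrE ?normr_ge0 ?mulr_ge0 ?enorm_ge0//.
rewrite real_normK ?num_real// exprMn.
have := dotv_ge0 (enorm y ^+ 2 *: x - dotv x y *: y).
rewrite dotvBl !dotvBr !dotvZl !dotvZr -!sqr_enorm (dotvC y x).
set a := enorm x ^+ 2; set b := enorm y ^+ 2 in y2 *; set c := dotv x y => H.
have : 0 <= b * (a * b - c ^+ 2) by move: H; congr (_ <= _); ring.
by rewrite pmulr_rge0// subr_ge0.
Qed.

Lemma enormD n (x y : 'rV[R]_n) : enorm (x + y) <= enorm x + enorm y.
Proof.
rewrite -ler_sqr ?nnegrE ?addr_ge0 ?enorm_ge0// sqr_enorm dotvDl !dotvDr sqrrD.
rewrite -!sqr_enorm (dotvC y x).
have := le_trans (ler_norm _) (dotv_le x y); lra.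
Qed.

Lemma enorm_le_sum n (x : 'rV[R]_n) : enorm x <= \sum_i `|x 0 i|.
Proof.
have s0 : 0 <= \sum_i `|x 0 i| by exact: sumr_ge0.
rewrite -ler_sqr ?nnegrE ?enorm_ge0// sqr_enorm /dotv expr2 mulr_suml.
apply: ler_sum => i _; rewrite -expr2 -(real_normK (num_real (x 0 i))) expr2.
rewrite ler_wpM2l// (bigD1 i)//= lerDl; exact: sumr_ge0.
Qed.

Lemma dotv_row_mx n m (x x' : 'rV[R]_n) (y y' : 'rV[R]_m) :
  dotv (row_mx x y) (row_mx x' y') = dotv x x' + dotv y y'.
Proof.
by rewrite /dotv big_split_ord/=; congr (_ + _); apply: eq_bigr => i _;
  rewrite ?row_mxEl ?row_mxEr.
Qed.

Lemma enorm_row_mx_le n m (x : 'rV[R]_n) (y : 'rV[R]_m) :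
  enorm (row_mx x y) <= enorm x + enorm y.
Proof.
rewrite -ler_sqr ?nnegrE ?addr_ge0 ?enorm_ge0// sqr_enorm dotv_row_mx -!sqr_enorm sqrrD.
by rewrite addrAC lerDl mulrn_wge0// mulr_ge0// enorm_ge0.
Qed.

Lemma enorm_row_mx_gel n m (x : 'rV[R]_n) (y : 'rV[R]_m) :
  enorm x <= enorm (row_mx x y).
Proof. by rewrite ler_wsqrtr// dotv_row_mx lerDl dotv_ge0. Qed.

Lemma enorm_row_mx_ger n m (x : 'rV[R]_n) (y : 'rV[R]_m) :
  enorm y <= enorm (row_mx x y).
Proof. by rewrite ler_wsqrtr// dotv_row_mx lerDr dotv_ge0. Qed.

Lemma measurable_dotv d (T : measurableType d) n (f g : T -> 'rV[R]_n) :
  measurable_fun setT f -> measurable_fun setT g ->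
  measurable_fun setT (fun t => dotv (f t) (g t)).
Proof.
move=> mf mg; apply: measurable_sum => i; apply: measurable_funM.
- exact: (measurableT_comp (measurable_coord i) mf).
- exact: (measurableT_comp (measurable_coord i) mg).
Qed.

End euclidean_facts.

(** * Weights: subadditivity, and domination of powers *)

Section weight_facts.
Context {R : realType} (w : R -> R) (hw : weight_function w).

Definition weightv n (x : 'rV[R]_n) : R := w (enorm x).
Local Notation W := weightv.

Lemma weightv_ge0 n (x : 'rV[R]_n) : 0 <= W x.
Proof. by apply: (weight_ge0 hw); exact: enorm_ge0. Qed.

Lemma weightvN n (x : 'rV[R]_n) : W (- x) = W x.
Proof. by rewrite /W enormN. Qed.

Lemma weightv_le n m (x : 'rV[R]_n) (y : 'rV[R]_m) : enorm x <= enorm y -> W x <= W y.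
Proof. by move=> xy; apply: (weight_nondecreasing hw) => //; exact: enorm_ge0. Qed.

Lemma weightv_le_add n m p (x : 'rV[R]_n) (y : 'rV[R]_m) (z : 'rV[R]_p) :
  enorm x <= enorm y + enorm z -> W x <= W y + W z.
Proof.
move=> H; apply: le_trans (weight_subadditive hw (enorm_ge0 _) (enorm_ge0 _)).
by apply: (weight_nondecreasing hw) => //; exact: enorm_ge0.
Qed.

Lemma weightvD n (x y : 'rV[R]_n) : W (x + y) <= W x + W y.
Proof. by apply: weightv_le_add; exact: enormD. Qed.

Lemma weightvB n (x y : 'rV[R]_n) : W (x - y) <= W x + W y.
Proof. by rewrite -(weightvN y); exact: weightvD. Qed.

Lemma weightv_triangle n (x y : 'rV[R]_n) : W x <= W (x - y) + W y.
Proof. by rewrite -{1}(subrK y x); exact: weightvD. Qed.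

Lemma weight_le_muln (k : nat) (s t : R) : 0 <= s -> 0 <= t -> s <= t *+ k.+1 ->
  w s <= w t *+ k.+1.
Proof.
move=> s0 t0 st; apply: (le_trans (weight_nondecreasing hw s0 st)).
elim: k {st} => [|k IH]; first by rewrite !mulr1n.
rewrite mulrS [leRHS]mulrS (le_trans (weight_subadditive hw t0 _)) ?mulrn_wge0//.
by rewrite lerD2l.
Qed.

(** [weight_log] at [1 / N.+1] gives [t ^+ N.+1 <= expR (w t)] for large [t]; on the remaining
    bounded range the constant absorbs the power. The successor makes the quotient meaningful for
    [N = 0]. *)
Lemma weight_poly (N : nat) : exists2 C : R, 0 < C &
  forall t : R, 0 <= t -> (1 + t) ^+ N <= C * expR (w t).
Proof.
have N0 : 0 < N.+1%:R :> R by rewrite ltr0n.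
have [T [_ HT]] := weight_log hw (divr_gt0 (ltr01 : 0 < (1:R)) N0).
(* Beyond [T0] one also has [1 + t <= 2 * t] and [0 <= ln t]. *)
pose T0 := Num.max T 1.
have T01 : 1 <= T0 by rewrite le_max lexx orbT.
exists (2 ^+ N * (1 + T0) ^+ N) => [|t t0].
  by rewrite mulr_gt0 ?exprn_gt0//; lra.
have e1 : 1 <= expR (w t) by rewrite -expR0 ler_expR (weight_ge0 hw).
have [tT|tT] := leP t T0.
  rewrite -[leLHS]mul1r -[leLHS]mulr1 ler_pM ?mulr_ge0 ?exprn_ge0//; try lra.
  rewrite ler_pM//; try lra.
  - by apply: exprn_ge0; lra.
  - by apply: exprn_ege1; lra.
  - by rewrite lerXn2r ?nnegrE//; lra.
have t1 : 1 < t by lra.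
have tgT : T < t by apply: le_lt_trans tT; rewrite le_max lexx.
have H := HT _ tgT; rewrite [`|w t|]ger0_norm ?(weight_ge0 hw)// in H.
have H2 : ln t *+ N.+1 <= w t.
  rewrite -mulr_natl mulrC -ler_pdivlMr//.
  by apply: le_trans (le_trans (ler_norm _) H) _; rewrite mulrC mul1r.
have tN : t ^+ N <= expR (w t).
  have -> : t ^+ N = expR (ln t *+ N) by rewrite -mulr_natl expRM_natl lnK// posrE; lra.
  rewrite ler_expR; apply: le_trans H2; rewrite mulrSr lerDl ln_ge0//; lra.
apply: (@le_trans _ _ (2 ^+ N * t ^+ N)).
  by rewrite -exprMn lerXn2r ?nnegrE//; lra.
rewrite -mulrA ler_pM2l ?exprn_gt0// -[leLHS]mul1r ler_pM ?exprn_ge0//; try lra.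
by apply: exprn_ege1; lra.
Qed.

(** The product of the [1 + x_i ^+ 2] is at most [(1 + |x|) ^+ (2 * n)], which [weight_poly] bounds
    by [expR (W x)]. This is what makes one unit of decay rate integrable. *)
Lemma expRN_weightv_le_cauchy n : exists2 C : R, 0 < C &
  forall x : 'rV[R]_n, expR (- W x) <= C * cauchy_rV x.
Proof.
have [C C0 H] := weight_poly (2 * n); exists C => // x.
pose P := \prod_i (1 + x 0 i ^+ 2).
have P0 : 0 < P by apply: prodr_gt0 => i _; rewrite ltr_pwDl// sqr_ge0.
have -> : cauchy_rV x = P^-1 by rewrite /cauchy_rV /cauchy_kernel /P prodfV.
rewrite expRN ler_pdivlMr// mulrC ler_pdivrMr ?expR_gt0//.
apply: le_trans (H _ (enorm_ge0 x)).
rewrite exprM /P -[X in _ <= _ ^+ X](card_ord n) -prodr_const.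
apply: ler_prod => i _; rewrite addr_ge0 ?sqr_ge0//= sqrrD expr1n mul1r.
have : x 0 i ^+ 2 <= enorm x ^+ 2.
  by rewrite -(real_normK (num_real (x 0 i))) lerXn2r ?nnegrE ?enorm_ge0// coord_le_enorm.
have := enorm_ge0 x; lra.
Qed.

Lemma enorm_le_expR n (N : nat) : exists2 C : R, 0 < C &
  forall x : 'rV[R]_n, enorm x ^+ N <= C * expR (W x).
Proof.
have [C C0 H] := weight_poly N; exists C => // y.
apply: le_trans (H _ (enorm_ge0 y)).
by rewrite lerXn2r ?nnegrE ?enorm_ge0 ?addr_ge0 ?enorm_ge0// lerDr.
Qed.

End weight_facts.

Section dominated_cintegral.
Context {d} {T : measurableType d} {R : realType} (mu : {measure set T -> \bar R}).

Lemma cvg_cintegral_dom (F : nat -> T -> R[i]) (f : T -> R[i]) (B : T -> R) :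
  (forall n, cmeas (F n)) -> cmeas f ->
  (forall x, complex.Re (F n x) @[n --> \oo] --> complex.Re (f x)) ->
  (forall x, complex.Im (F n x) @[n --> \oo] --> complex.Im (f x)) ->
  (forall n x, normc (F n x) <= B x) -> mu.-integrable setT (fun x => (B x)%:E) ->
  complex.Re (cintegral mu (F n)) @[n --> \oo] --> complex.Re (cintegral mu f) /\
  complex.Im (cintegral mu (F n)) @[n --> \oo] --> complex.Im (cintegral mu f).
Proof.
move=> mF [f1 f2] cRe cIm FB iB; split.
- apply: (cvg_Rintegral_dom (B := B)) => // [n|n x]; first by case: (mF n).
  exact: le_trans (Re_le_normc _) (FB n x).
- apply: (cvg_Rintegral_dom (B := B)) => // [n|n x]; first by case: (mF n).
  exact: le_trans (Im_le_normc _) (FB n x).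
Qed.

End dominated_cintegral.

(** * Fourier inversion *)

Section fourier_inversion.
Context {R : realType}.
Local Notation leb := (@lebesgue_measure R).
Local Notation lebn := (@lebesgue_rV R).
Local Open Scope complex_scope.

Definition laplace_rV n (x : 'rV[R]_n) : R := expR (- \sum_i `|x 0 i|).

Lemma laplace_rV_ge0 n (x : 'rV[R]_n) : 0 <= laplace_rV x.
Proof. exact: expR_ge0. Qed.

Lemma laplace_rV_le1 n (x : 'rV[R]_n) : laplace_rV x <= 1.
Proof. by rewrite /laplace_rV expR_le1 oppr_le0 sumr_ge0. Qed.

Lemma measurable_laplace_rV n : measurable_fun setT (@laplace_rV n).
Proof.
apply: measurableT_comp => //; apply: measurable_funN; apply: measurable_sum => i.
by apply: measurableT_comp => //; exact: measurable_coord.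
Qed.

Lemma integrable_laplace_rV n : (lebn n).-integrable setT (fun x => (laplace_rV x)%:E).
Proof.
have [i1 _] := fourier_laplace_rV (0 : 'rV[R]_n).
have := cintegrable_normc i1; apply: eq_integrable => // x _.
by rewrite normcM normc_cis normc_real mulr1 ger0_norm ?expR_ge0.
Qed.

Lemma measurable_dotv_cst n (y : 'rV[R]_n) :
  measurable_fun setT (fun x : 'rV[R]_n => dotv y x).
Proof. by apply: measurable_dotv => //; exact: measurable_cst. Qed.

Lemma cmeas_fourier n (f : 'rV[R]_n -> R[i]) : cmeas f -> cmeas (fourier f).
Proof.
move=> mf; apply: (@cmeas_cintegral _ _ _ _ _ (lebn n) (fun p : 'rV[R]_n * 'rV[R]_n => cis (- dotv p.2 p.1) * f p.2)).
apply: cmeasM.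
- by apply: cmeas_cis; apply: measurable_funN; apply: measurable_dotv.
- exact: (cmeas_comp (g := snd)).
Qed.

Lemma cintegrable_cis n (f : 'rV[R]_n -> R[i]) (g : 'rV[R]_n -> R) :
  measurable_fun setT g -> cintegrable (lebn n) f ->
  cintegrable (lebn n) (fun x => cis (g x) * f x).
Proof.
move=> mg fi; apply: le_cintegrable (cintegrable_normc fi).
- by apply: cmeasM; [exact: cmeas_cis|exact: cintegrable_cmeas fi].
- by move=> x; rewrite normcM normc_cis mul1r.
Qed.

Lemma cintegrable_fourier n (f : 'rV[R]_n -> R[i]) (xi : 'rV[R]_n) :
  cintegrable (lebn n) f -> cintegrable (lebn n) (fun x => cis (- dotv x xi) * f x).
Proof.
apply: cintegrable_cis; apply: measurable_funN; apply: measurable_dotv => //.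
Qed.

(* Testing [fourier f] against the Laplace kernel dilated by [e] gives the mean
   of [f] around [y] against a Cauchy kernel of width [e]. *)
Lemma fourier_laplace_mean n (f : 'rV[R]_n -> R[i]) (y : 'rV[R]_n) (e : R) : 0 < e ->
  cintegrable (lebn n) f -> cintegrable (lebn n) (fourier f) ->
  cintegral (lebn n) (fun xi => (laplace_rV (e *: xi))%:C * (cis (dotv y xi) * fourier f xi)) =
  cintegral (lebn n) (fun t => (2 ^+ n * cauchy_rV t)%:C * f (y + e *: t)).
Proof.
move=> e0 fi Fi; have e_neq0 : e != 0 by rewrite gt_eqF.
have ei_neq0 : e^-1 != 0 by rewrite invr_eq0.
have mf := cintegrable_cmeas fi.
have i1 : cintegrable (lebn n)
    (fun xi => (laplace_rV (e *: xi))%:C * (cis (dotv y xi) * fourier f xi)).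
  have Gi := cintegrable_cis (measurable_dotv_cst y) Fi.
  apply: le_cintegrable (cintegrable_normc Gi).
  - apply: cmeasM; last exact: cintegrable_cmeas Gi.
    apply: cmeas_real; apply: (measurableT_comp (@measurable_laplace_rV n)).
    have := @measurable_affine_rV R n 0 e; apply: eq_measurable_fun => x _; by rewrite add0r.
  - move=> x; rewrite normcM normc_real ger0_norm ?laplace_rV_ge0//.
    by rewrite ler_piMl ?normc_ge0// laplace_rV_le1.
have [_ ->] := cintegral_affine_rV 0 ei_neq0 i1.
pose g t := f (y + e *: t).
have [gi _] := cintegral_affine_rV y e_neq0 fi.
have gE eta : fourier f (0 + e^-1 *: eta) =
    (`|e| ^+ n)%:C * (cis (- dotv y (e^-1 *: eta)) * fourier g eta).
  rewrite /fourier add0r.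
  have [_ ->] := cintegral_affine_rV y e_neq0 (cintegrable_fourier (e^-1 *: eta) fi).
  congr (_ * _); rewrite -cintegralZ; last exact: cintegrable_fourier.
  apply: eq_cintegral => t; rewrite mulrA -cisD; congr (cis _ * _).
  rewrite dotvDl opprD dotvZl dotvZr; congr (_ - _).
  by rewrite dotvZr mulrA divff// mul1r.
(* With [xi = eta / e] in the outer integral and [x = y + e * t] in the Fourier integral, the
   Jacobians are inverse to each other and the phases in [y] cancel. *)
transitivity (cintegral (lebn n) (fun eta => (laplace_rV eta)%:C * fourier g eta)).
  rewrite -cintegralZ; last first.
    by have [] := cintegral_affine_rV 0 ei_neq0 i1.
  apply: eq_cintegral => eta; rewrite gE add0r scalerA divff// scale1r.
  rewrite mulrCA; congr (_ * _); rewrite (mulrCA (cis _)) [cis _ * (cis _ * _)]mulrA cisK mul1r mulrA.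
  rewrite -rmorphM -exprMn -normrM mulVf// normr1 expr1n mul1r.
  by [].
pose H (p : 'rV[R]_n * 'rV[R]_n) := (laplace_rV p.1)%:C * (cis (- dotv p.2 p.1) * g p.2).
have mg := cintegrable_cmeas gi.
have mH : cmeas H.
  apply: cmeasM.
    by apply: cmeas_real; apply: measurableT_comp => //; exact: measurable_laplace_rV.
  apply: cmeasM; last exact: (cmeas_comp (g := snd)).
  by apply: cmeas_cis; apply: measurable_funN; apply: measurable_dotv.
have HB x1 x2 : normc (H (x1, x2)) <= laplace_rV x1 * normc (g x2).
  by rewrite /H/= !normcM normc_real normc_cis mul1r ger0_norm ?laplace_rV_ge0.
have B0 (x : 'rV[R]_n) : 0 <= normc (g x) by exact: normc_ge0.
have := cintegral_fubini (m1 := lebn n) (m2 := lebn n) (@laplace_rV_ge0 n) B0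
  (@integrable_laplace_rV n) (cintegrable_normc gi) mH HB.
rewrite /H/= => E.
transitivity (cintegral (lebn n) (fun x => cintegral (lebn n)
   (fun y0 => (laplace_rV x)%:C * (cis (- dotv y0 x) * g y0)))).
  by apply: eq_cintegral => eta; apply/esym; exact: (cintegralZ _ (cintegrable_fourier eta gi)).
rewrite {}E; apply: eq_cintegral => t.
have [j1 j2] := fourier_laplace_rV (- t).
have ct : cauchy_rV (- t) = cauchy_rV t.
  by apply: eq_bigr => i _; rewrite mxE /cauchy_kernel sqrrN.
rewrite -ct -j2 -cintegralZr//.
by apply: eq_cintegral => xi; rewrite mulrA dotvNl.
Qed.

(** Let [e] tend to 0 in [fourier_laplace_mean]. On one side the Laplace factor tends to 1 under the
    majorant [|fourier f|]; on the other [f (y + e * t)] tends to [f y] by continuity, under [M]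
    times the Cauchy kernel. In [(2 * pi) ^+ n], the 2 comes from the transform of the Laplace
    kernel and the [pi] from the mass of the Cauchy kernel. *)
Lemma fourier_inversion n (f : 'rV[R]_n -> R[i]) (M : R) (y : 'rV[R]_n) :
  continuous (re_fun f) -> continuous (im_fun f) ->
  cintegrable (lebn n) f -> cintegrable (lebn n) (fourier f) ->
  (forall x, normc (f x) <= M) ->
  fourier (fourier f) (- y) = ((2 * pi) ^+ n)%:C * f y.
Proof.
move=> c1 c2 fi Fi fM.
have mf := cintegrable_cmeas fi.
pose e (k : nat) : R := k.+1%:R^-1.
have e0 k : 0 < e k by rewrite invr_gt0 ltr0n.
have ecv : e k @[k --> \oo] --> 0 by exact: cvg_harmonic.
pose A (k : nat) (xi : 'rV[R]_n) := (laplace_rV (e k *: xi))%:C * (cis (dotv y xi) * fourier f xi).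
pose Q (k : nat) (t : 'rV[R]_n) := (2 ^+ n * cauchy_rV t)%:C * f (y + e k *: t).
have AQ k : cintegral (lebn n) (A k) = cintegral (lebn n) (Q k).
  exact: fourier_laplace_mean.
have Gi := cintegrable_cis (measurable_dotv_cst y) Fi.
have ReZ (r : R) (z : R[i]) : complex.Re (r%:C * z) = r * complex.Re z.
  by case: z => a b /=; rewrite mul0r subr0.
have ImZ (r : R) (z : R[i]) : complex.Im (r%:C * z) = r * complex.Im z.
  by case: z => a b /=; rewrite mul0r addr0.
have lcv (xi : 'rV[R]_n) : laplace_rV (e k *: xi) @[k --> \oo] --> (1 : R).
  have E k : laplace_rV (e k *: xi) = expR (e k * - \sum_i `|xi 0 i|).
    rewrite /laplace_rV mulrN; congr (expR (- _)); rewrite mulr_sumr.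
    by apply: eq_bigr => i _; rewrite mxE normrM gtr0_norm.
  rewrite (_ : (fun k => _) = (fun k => expR (e k * - \sum_i `|xi 0 i|))); last exact/funext.
  rewrite -(@expR0 R); apply: continuous_cvg; first exact: continuous_expR.
  by rewrite -[X in _ --> X](mul0r (- \sum_i `|xi 0 i|)); apply: cvgM => //; exact: cvg_cst.
have lcvM (xi : 'rV[R]_n) (z : R) : laplace_rV (e k *: xi) * z @[k --> \oo] --> z.
  have : laplace_rV (e k *: xi) * z @[k --> \oo] --> 1 * z.
    by apply: cvgM; [exact: lcv|exact: cvg_cst].
  by rewrite mul1r.
have [cA1 cA2] : complex.Re (cintegral (lebn n) (A k)) @[k --> \oo] -->
    complex.Re (cintegral (lebn n) (fun xi => cis (dotv y xi) * fourier f xi)) /\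
    complex.Im (cintegral (lebn n) (A k)) @[k --> \oo] -->
    complex.Im (cintegral (lebn n) (fun xi => cis (dotv y xi) * fourier f xi)).
  apply: cvg_cintegral_dom (cintegrable_normc Gi).
  - move=> k; apply: cmeasM; last exact: cintegrable_cmeas Gi.
    apply: cmeas_real; apply: (measurableT_comp (@measurable_laplace_rV n)).
    have := @measurable_affine_rV R n 0 (e k); apply: eq_measurable_fun => x _; by rewrite add0r.
  - exact: cintegrable_cmeas Gi.
  - by move=> x; under eq_fun do rewrite ReZ; exact: lcvM.
  - by move=> x; under eq_fun do rewrite ImZ; exact: lcvM.
  - move=> k x; rewrite /A normcM normc_real ger0_norm ?laplace_rV_ge0//.
    by rewrite ler_piMl ?normc_ge0// laplace_rV_le1.
have fcv (h : 'rV[R]_n -> R) (t : 'rV[R]_n) : continuous h ->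
    h (y + e k *: t) @[k --> \oo] --> h y.
  move=> ch; apply/cvgrPdist_lt => ep ep0.
  have [de de0 Hd] := (rV_continuousP h y).1 (ch y) ep ep0.
  have /cvgrPdist_lt/(_ (de / (1 + enorm t))) : e k @[k --> \oo] --> 0 by [].
  have t1 : 0 < 1 + enorm t by rewrite ltr_pwDl// enorm_ge0.
  rewrite divr_gt0// => /(_ isT); apply: filterS => k; rewrite sub0r normrN ltr_pdivlMr// => H.
  apply: Hd => i; rewrite !mxE opprD addNKr normrN normrM.
  by apply: le_lt_trans H; rewrite ler_wpM2l// (le_trans (coord_le_enorm _ _))// lerDr.
have [cQ1 cQ2] : complex.Re (cintegral (lebn n) (Q k)) @[k --> \oo] -->
    complex.Re (cintegral (lebn n) (fun t => (2 ^+ n * cauchy_rV t)%:C * f y)) /\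
    complex.Im (cintegral (lebn n) (Q k)) @[k --> \oo] -->
    complex.Im (cintegral (lebn n) (fun t => (2 ^+ n * cauchy_rV t)%:C * f y)).
  have mc : cmeas (fun t : 'rV[R]_n => (2 ^+ n * cauchy_rV t)%:C).
    by apply: cmeas_real; apply: measurable_funM => //; exact: measurable_cauchy_rV.
  apply: (@cvg_cintegral_dom _ _ _ _ _ _ (fun t => 2 ^+ n * M * cauchy_rV t)).
  - move=> k; apply: cmeasM; first exact: mc.
    apply: (cmeas_comp (f := f) _ mf); exact: measurable_affine_rV.
  - apply: cmeasM; first exact: mc.
    exact: cmeas_cst.
  - move=> x; under eq_fun do rewrite ReZ.
    by rewrite ReZ; apply: cvgM; [exact: cvg_cst|exact: (fcv (re_fun f))].
  - move=> x; under eq_fun do rewrite ImZ.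
    by rewrite ImZ; apply: cvgM; [exact: cvg_cst|exact: (fcv (im_fun f))].
  - move=> k x; rewrite /Q normcM normc_real ger0_norm ?mulr_ge0 ?cauchy_rV_ge0 ?exprn_ge0//.
    by rewrite [leRHS]mulrAC ler_wpM2l// mulr_ge0 ?cauchy_rV_ge0 ?exprn_ge0.
  - have := integrableZl measurableT (2 ^+ n * M) (integrable_cauchy_rV n).
    by apply: eq_integrable => // x _; rewrite EFinM.
have -> : fourier (fourier f) (- y) =
    cintegral (lebn n) (fun xi => cis (dotv y xi) * fourier f xi).
  by apply: eq_cintegral => xi; rewrite dotvNr opprK dotvC.
have [ci ce] := @cintegral_cauchy_rV R n.
have -> : ((2 * pi) ^+ n)%:C * f y =
    cintegral (lebn n) (fun t => (2 ^+ n * cauchy_rV t)%:C * f y).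
  rewrite cintegralZr; last first.
    have := cintegrableZ ((2 ^+ n : R)%:C) ci.
    by rewrite (_ : (fun x => _) = (fun x => (2 ^+ n * cauchy_rV x)%:C))//; apply/funext => x; rewrite rmorphM.
  congr (_ * _).
  rewrite (_ : ((2 * pi) ^+ n)%:C = (2 ^+ n)%:C * (pi ^+ n)%:C); last by rewrite exprMn rmorphM.
  rewrite -ce -(cintegralZ _ ci).
  by apply: eq_cintegral => x; rewrite rmorphM.
have U (g1 g2 : R) (G : nat -> R) : G k @[k --> \oo] --> g1 -> G k @[k --> \oo] --> g2 -> g1 = g2.
  by move=> h1 h2; rewrite -(cvg_lim _ h1)// -(cvg_lim _ h2).
apply/eqP; rewrite eq_complex; apply/andP; split; apply/eqP.
- apply: U cA1 _; under eq_fun do rewrite AQ; exact: cQ1.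
- apply: U cA2 _; under eq_fun do rewrite AQ; exact: cQ2.
Qed.

End fourier_inversion.

(** * Differentiation under the Fourier integral *)

Section taylor_cis.
Context {R : realType}.
Local Open Scope complex_scope.

Lemma sin_le_id (t : R) : `|sin t| <= `|t|.
Proof.
have H (s : R) : 0 <= s -> `|sin s| <= s.
  move=> s0.
  have [c _] := @MVT_segment R (@sin R) (@cos R) 0 s s0 (fun x _ => is_derive_sin x)
    (continuous_subspaceT (@continuous_sin R)).
  rewrite sin0 !subr0 => ->; rewrite normrM (ger0_norm s0) ler_piMl//.
  by rewrite ler_norml cos_geN1 cos_le1.
have [t0|/ltW t0] := leP 0 t; first by rewrite (ger0_norm t0) H.
by rewrite -normrN -sinN -(normrN t) (ger0_norm (_ : 0 <= - t)) ?oppr_ge0// H ?oppr_ge0.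
Qed.

Lemma one_sub_cos_le (t : R) : 0 <= 1 - cos t <= t ^+ 2 / 2.
Proof.
have -> : 1 - cos t = 2 * sin (t / 2) ^+ 2.
  have {1}-> : t = t / 2 + t / 2 by field.
  rewrite cosD -expr2 cos2sin2; ring.
rewrite mulr_ge0 ?sqr_ge0//=.
have : sin (t / 2) ^+ 2 <= (t / 2) ^+ 2.
  rewrite -(real_normK (num_real (sin _))) -(real_normK (num_real (t / 2))).
  by rewrite lerXn2r ?nnegrE// sin_le_id.
lra.
Qed.

(** The mean value theorem gives [s - sin s = (1 - cos c) * s] with [0 <= c <= s], and
    [1 - cos c <= s]: by the bound [c ^+ 2 / 2] when [s <= 2], trivially beyond. A quadratic
    remainder is enough for a first derivative. *)
Lemma id_sub_sin_le (t : R) : `|t - sin t| <= t ^+ 2.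
Proof.
have H (s : R) : 0 <= s -> `|s - sin s| <= s ^+ 2.
  move=> s0.
  have dG (x : R) : is_derive x 1 (fun s : R => s - sin s) (1 - cos x).
    exact: is_deriveB.
  have cG : continuous (fun s : R => s - sin s).
    by move=> x; apply: cvgB; [exact: cvg_id|exact: continuous_sin].
  have [c cs] := @MVT_segment R (fun s => s - sin s) (fun x => 1 - cos x) 0 s s0
     (fun x _ => dG x) (continuous_subspaceT cG).
  rewrite sin0 !subr0 => ->.
  have /andP[c1 c2] := one_sub_cos_le c.
  move: cs; rewrite in_itv/= => /andP[c0 cs].
  rewrite normrM (ger0_norm s0) (ger0_norm c1).
  have c3 := cos_geN1 c.
  have [s2|s2] := leP s 2; last first.
    by rewrite expr2 ler_wpM2r//; lra.
  rewrite expr2 ler_wpM2r//; apply: (le_trans c2); rewrite expr2.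
  have : c * c <= s * s by rewrite ler_pM.
  have : s * s <= 2 * s by rewrite ler_wpM2r.
  lra.
have [t0|/ltW t0] := leP 0 t; first exact: H.
have := H (- t); rewrite oppr_ge0 => /(_ t0).
by rewrite sinN -opprD normrN sqrrN.
Qed.

Lemma cis_taylor2 (t : R) : normc (cis t - 1 - (0 +i* t)) <= 2 * t ^+ 2.
Proof.
apply: (le_trans (normc_le_ReIm _)) => /=.
have /andP[c1 c2] := one_sub_cos_le t.
have := id_sub_sin_le t.
have -> : `|cos t - 1 - 0| = 1 - cos t by rewrite subr0 distrC ger0_norm.
rewrite subr0 [`|sin t - t|]distrC; have := sqr_ge0 t; lra.
Qed.

Lemma cis_taylor1 (t : R) : normc (cis t - 1) <= 2 * `|t|.
Proof.
apply: (le_trans (normc_le_ReIm _)) => /=; rewrite subr0 [leRHS]mulr_natl mulr2n lerD ?sin_le_id//.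
have /andP[c1 c2] := one_sub_cos_le t; rewrite distrC ger0_norm//.
have [t2|t2] := leP `|t| 2.
  apply: (le_trans c2); rewrite -(real_normK (num_real t)) expr2 ler_pdivrMr//.
  by rewrite ler_wpM2l.
by have := cos_geN1 t; lra.
Qed.

End taylor_cis.

Section directional_derivative.
Context {R : realType} {n : nat}.

Lemma derive_of_quadratic_bound (g : 'rV[R]_n -> R^o) (x v : 'rV[R]_n) (D K : R) :
  (forall s : R, `|g (x + s *: v) - g x - s * D| <= K * s ^+ 2) ->
  derivable g x v /\ 'D_v g x = D.
Proof.
move=> H.
have K0 : 0 <= K by have := le_trans (normr_ge0 _) (H 1); rewrite expr1n mulr1.
have C : s^-1 *: ((g \o shift x) (s *: v) - g x) @[s --> (0 : R)^'] --> (D : R^o).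
  apply/cvgrPdist_le => e e0; near=> s.
  have s0 : s != 0 by near: s; exact: nbhs_dnbhs_neq.
  have -> : D - s^-1 *: ((g \o shift x) (s *: v) - g x) =
      - (s^-1 * (g (x + s *: v) - g x - s * D)).
    rewrite /= /shift/= (addrC (s *: v)) /GRing.scale/=; field.
    exact: s0.
  rewrite normrN normrM normfV ler_pdivrMl ?normr_gt0//.
  apply: (le_trans (H s)); rewrite -(real_normK (num_real s)) expr2 mulrCA ler_pM2l ?normr_gt0//.
  have Ks : `|s| < e / (K + 1).
    near: s; apply: dnbhs0_lt; rewrite divr_gt0//; lra.
  apply: (@le_trans _ _ (K * (e / (K + 1)))); first by rewrite ler_wpM2l// ltW.
  have K1 : 0 < K + 1 by lra.
  by rewrite mulrA ler_pdivrMr// mulrC ler_pM2l//; lra.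
split; first by apply/cvg_ex; exists D.
exact: cvg_lim C.
Unshelve. all: end_near. Qed.

End directional_derivative.

(** * Rapidly decaying functions and smoothness of their Fourier transforms *)

Section rapid_decay.
Context {R : realType} (w : R -> R) (hw : weight_function w) {n : nat}.
Local Notation lebn := (@lebesgue_rV R n).
Local Notation W := (weightv w).
Local Open Scope complex_scope.
Implicit Types (f g h : 'rV[R]_n -> R[i]) (la M : R).

Definition decay la M f := forall x, normc (f x) <= M * expR (- (la * W x)).

Definition rapid f := forall la, exists M, decay la M f.

Lemma decay_ge0 la M f : decay la M f -> 0 <= M.
Proof.
move=> /(_ 0) H; have := le_trans (normc_ge0 _) H.
by rewrite pmulr_lge0// expR_gt0.
Qed.

Lemma decay_mono la la' M M' f : la' <= la -> M <= M' -> decay la M f -> decay la' M' f.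
Proof.
move=> ll MM fM x; have M0 := decay_ge0 fM; apply: (le_trans (fM x)).
rewrite ler_pM ?expR_ge0// ler_expR lerN2 ler_wpM2r// weightv_ge0//.
Qed.

Lemma rapid_of_pos f : (forall la, 0 < la -> exists M, decay la M f) -> rapid f.
Proof.
move=> H la; have [la0|la0] := ltP 0 la; first exact: H.
have [M HM] := H 1 ltr01; exists M; apply: decay_mono HM => //; lra.
Qed.

Lemma decay_bounded M f : decay 0 M f -> forall x, normc (f x) <= M.
Proof. by move=> H x; have := H x; rewrite mul0r oppr0 expR0 mulr1. Qed.

(** One unit of the rate is traded for an integrable factor. *)
Lemma decay_cauchy : exists2 C : R, 0 < C & forall la M f, decay (la + 1) M f ->
  forall x, normc (f x) <= C * M * expR (- (la * W x)) * cauchy_rV x.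
Proof.
have [C C0 H] := expRN_weightv_le_cauchy hw n; exists C => // la M f fM x.
have M0 := decay_ge0 fM.
apply: (le_trans (fM x)); rewrite mulrDl mul1r opprD expRD.
have := ler_wpM2l (mulr_ge0 M0 (expR_ge0 (- (la * W x)))) (H x).
by rewrite -!mulrA; congr (_ <= _); ring.
Qed.

Lemma rapid_cintegrable f : cmeas f -> rapid f -> cintegrable lebn f.
Proof.
move=> mf rf; have [C C0 H] := decay_cauchy.
have [M HM] := rf (0 + 1).
apply: (@le_cintegrable _ _ _ lebn _ (fun x => C * M * cauchy_rV x)) => //.
- by move=> x; have := H _ _ _ HM x; rewrite mul0r oppr0 expR0 mulr1.
- have := integrableZl measurableT (C * M) (@integrable_cauchy_rV R n).
  by apply: eq_integrable => // x _; rewrite EFinM.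
Qed.

(** Multiplication by [- i * y_i], the operation that the Fourier transform turns into
    [pderiv i]. *)
Definition mulcoord (i : 'I_n) f : 'rV[R]_n -> R[i] := fun y => (0 +i* - y 0 i) * f y.

Definition mulcoords (s : seq 'I_n) f := foldr mulcoord f s.

Lemma normc_mulcoord i f y : normc (mulcoord i f y) = `|y 0 i| * normc (f y).
Proof. by rewrite /mulcoord normcM /= expr0n/= add0r sqrrN sqrtr_sqr. Qed.

Lemma cmeas_mulcoord i f : cmeas f -> cmeas (mulcoord i f).
Proof.
apply: cmeasM; split; first exact: measurable_cst.
by apply: measurable_funN; exact: measurable_coord.
Qed.

Lemma cmeas_mulcoords s f : cmeas f -> cmeas (mulcoords s f).
Proof. by move=> mf; elim: s => //= i s IH; exact: cmeas_mulcoord. Qed.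

Lemma decay_mulcoord : exists2 C : R, 0 < C & forall i la M f,
  decay (la + 1) M f -> decay la (C * M) (mulcoord i f).
Proof.
have [C C0 H] := enorm_le_expR hw n 1; exists C => // i la M f fM x.
have M0 := decay_ge0 fM.
rewrite normc_mulcoord.
have -> : C * M * expR (- (la * W x)) = (C * expR (W x)) * (M * expR (- ((la + 1) * W x))).
  rewrite mulrDl mul1r opprD expRD (expRN (W x)).
  by field; rewrite gt_eqF// expR_gt0.
rewrite ler_pM ?normc_ge0//; apply: (le_trans (coord_le_enorm x i)).
exact: H.
Qed.

Lemma rapid_mulcoords s f : rapid f -> rapid (mulcoords s f).
Proof.
move=> rf; elim: s => //= i s IH la; have [C C0 H] := decay_mulcoord.
by have [M HM] := IH (la + 1); exists (C * M); exact: H.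
Qed.

Lemma decay_mulcoords s : exists2 C : R, 0 < C & forall la M f,
  decay (la + (size s)%:R) M f -> decay la (C * M) (mulcoords s f).
Proof.
elim: s => [|i s [C C0 IH]]; first by exists 1 => // la M f /=; rewrite addr0 mul1r.
have [C' C'0 H] := decay_mulcoord.
exists (C' * C) => [|la M f fM]; first exact: mulr_gt0.
rewrite -mulrA; apply: H; apply: IH; move: fM; rewrite /= -natr1 => fM.
by rewrite -addrA (addrC 1).
Qed.

(** Of the rate 2, one unit absorbs the factor [|y|] produced by the difference of the two phases,
    the other makes the integral converge. *)
Lemma fourier_lipschitz : exists2 K : R, 0 < K & forall M f, cmeas f -> rapid f ->
  decay 2 M f -> forall x x', normc (fourier f x - fourier f x') <= K * M * enorm (x - x').
Proof.
have [C C0 H] := enorm_le_expR hw n 1.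
have [C' C'0 H'] := expRN_weightv_le_cauchy hw n.
have Ppos : 0 < 1 + \int[lebn]_x cauchy_rV x.
  by rewrite ltr_pwDl// Rintegral_ge0// => x _; exact: cauchy_rV_ge0.
(* The 4 combines the 2 of [cis_taylor1] with the 2 of [normc_cintegral_le]; the added 1 keeps the
   constant positive. *)
exists (4 * C * C' * (1 + \int[lebn]_x cauchy_rV x)) => [|M f mf rf fM x x'].
  by rewrite !mulr_gt0.
have M0 := decay_ge0 fM.
have fi := rapid_cintegrable mf rf.
rewrite -(cintegralB (cintegrable_fourier x fi) (cintegrable_fourier x' fi)).
set e := enorm (x - x'); have e0 : 0 <= e by exact: enorm_ge0.
apply: (@le_trans _ _ (2 * \int[lebn]_y (2 * C * C' * M * e * cauchy_rV y))).
  apply: normc_cintegral_le => [y|]; last first.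
    have := integrableZl measurableT (2 * C * C' * M * e) (@integrable_cauchy_rV R n).
    by apply: eq_integrable => // y _; rewrite EFinM.
  have -> : cis (- dotv y x) * f y - cis (- dotv y x') * f y =
      cis (- dotv y x') * ((cis (- dotv y (x - x')) - 1) * f y).
    by rewrite dotvBr mulrA mulrBr mulr1 -cisD mulrBl; congr (cis _ * _ - _); ring.
  rewrite !normcM normc_cis mul1r.
  apply: (@le_trans _ _ ((2 * (C * expR (W y) * e)) * (M * expR (- (2 * W y))))).
    rewrite ler_pM ?normc_ge0//; apply: (le_trans (cis_taylor1 _)).
    rewrite ler_pM2l// normrN (le_trans (dotv_le _ _))// ler_wpM2r//.
    exact: H.
  have -> : 2 * (C * expR (W y) * e) * (M * expR (- (2 * W y))) =
      (2 * C * M * e) * expR (- W y).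
    have -> : - (2 * W y) = - W y - W y by ring.
    by rewrite expRD (expRN (W y)); field; rewrite gt_eqF// expR_gt0.
  have := ler_wpM2l (mulr_ge0 (mulr_ge0 (mulr_ge0 (ler0n _ 2) (ltW C0)) M0) e0) (H' y).
  by congr (_ <= _); ring.
rewrite RintegralZl//; last exact: integrable_cauchy_rV.
have : 0 <= 4 * C * C' * M * e by rewrite !mulr_ge0// ltW.
lra.
Qed.

Lemma fourier_continuous f : cmeas f -> rapid f ->
  continuous (re_fun (fourier f)) /\ continuous (im_fun (fourier f)).
Proof.
move=> mf rf; have [K K0 H] := fourier_lipschitz; have [M HM] := rf 2.
have M0 := decay_ge0 HM.
have L (g : 'rV[R]_n -> R) : (forall x y, `|g x - g y| <= normc (fourier f x - fourier f y)) ->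
    continuous g.
  move=> gf x; apply/rV_continuousP => e e0.
  have KM : 0 < 1 + K * M * n%:R by rewrite ltr_pwDl// !mulr_ge0// ltW.
  exists (e / (1 + K * M * n%:R)) => [|y xy]; first exact: divr_gt0.
  apply: le_lt_trans (le_trans (gf x y) (H _ _ mf rf HM x y)) _.
  have le1 : enorm (x - y) <= n%:R * (e / (1 + K * M * n%:R)).
    rewrite (le_trans (enorm_le_sum _))//.
    rewrite mulr_natl -[X in _ *+ X]card_ord -sumr_const; apply: ler_sum => i _.
    by rewrite !mxE ltW.
  apply: (@le_lt_trans _ _ (K * M * (n%:R * (e / (1 + K * M * n%:R))))).
    by rewrite ler_wpM2l// mulr_ge0// ltW.
  by rewrite !mulrA ltr_pdivrMr// mulrC ltr_pM2l// ltrDr.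
by split; apply: L => x y; [apply: le_trans (Re_le_normc _)|apply: le_trans (Im_le_normc _)];
  rewrite /re_fun /im_fun; case: (fourier f x) (fourier f y) => ? ? [].
Qed.

(** Taylor's formula for the phase under the integral, with [|y| ^+ 2] absorbed by one unit of
    decay. Uniformity in [x] and linearity in [M] matter: besides identifying the derivative, the
    bound is used in [decay_pderivs] with a step that depends on [x]. *)
Lemma fourier_taylor : exists2 K : R, 0 < K & forall i M f, cmeas f -> rapid f ->
  decay 2 M f -> forall x s,
  normc (fourier f (x + s *: delta_mx 0 i) - fourier f x - s%:C * fourier (mulcoord i f) x)
    <= K * M * s ^+ 2.
Proof.
have [C C0 H] := enorm_le_expR hw n 2.
have [C' C'0 H'] := expRN_weightv_le_cauchy hw n.
have Ppos : 0 < 1 + \int[lebn]_x cauchy_rV x.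
  by rewrite ltr_pwDl// Rintegral_ge0// => x _; exact: cauchy_rV_ge0.
exists (4 * C * C' * (1 + \int[lebn]_x cauchy_rV x)) => [|i M f mf rf fM x s].
  by rewrite !mulr_gt0.
have M0 := decay_ge0 fM.
have fi := rapid_cintegrable mf rf.
have mfi := rapid_cintegrable (cmeas_mulcoord i mf) (@rapid_mulcoords [:: i] f rf).
have i1 := cintegrable_fourier (x + s *: delta_mx 0 i) fi.
have i2 := cintegrable_fourier x fi.
have i3 := cintegrable_fourier x mfi.
rewrite -(cintegralB i1 i2).
have i12 : cintegrable lebn (fun y => cis (- dotv y (x + s *: delta_mx 0 i)) * f y - cis (- dotv y x) * f y).
  have := cintegrableD i1 (cintegrableZ (-1) i2).
  by congr cintegrable; apply/funext => y; rewrite mulN1r.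
rewrite -(cintegralZ _ i3) -(cintegralB i12 (cintegrableZ _ i3)).
apply: (@le_trans _ _ (2 * \int[lebn]_y (2 * C * C' * M * s ^+ 2 * cauchy_rV y))).
  apply: normc_cintegral_le => [y|]; last first.
    have := integrableZl measurableT (2 * C * C' * M * s ^+ 2) (@integrable_cauchy_rV R n).
    by apply: eq_integrable => // y _; rewrite EFinM.
  have de : dotv y (delta_mx 0 i) = y 0 i.
    rewrite /dotv (bigD1 i)//= big1 => [|j ji]; first by rewrite mxE !eqxx mulr1 addr0.
    by rewrite mxE (negbTE ji) andbF mulr0.
  set t := - (s * y 0 i).
  have -> : cis (- dotv y (x + s *: delta_mx 0 i)) * f y - cis (- dotv y x) * f y -
      s%:C * (cis (- dotv y x) * mulcoord i f y) =
      cis (- dotv y x) * ((cis t - 1 - (0 +i* t)) * f y).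
    rewrite dotvDr dotvZr de opprD cisD -/t /mulcoord.
    have -> : (0 +i* t) = s%:C * (0 +i* - y 0 i).
      by apply/eqP; rewrite eq_complex/= /t; apply/andP; split; apply/eqP; ring.
    ring.
  rewrite !normcM normc_cis mul1r.
  apply: (@le_trans _ _ ((2 * (s ^+ 2 * (C * expR (W y)))) * (M * expR (- (2 * W y))))).
    rewrite ler_pM ?normc_ge0//; apply: (le_trans (cis_taylor2 _)).
    rewrite ler_pM2l// /t sqrrN exprMn ler_wpM2l ?sqr_ge0// (le_trans _ (H y))//.
    rewrite -(real_normK (num_real (y 0 i))) lerXn2r ?nnegrE ?enorm_ge0//.
    exact: coord_le_enorm.
  have -> : 2 * (s ^+ 2 * (C * expR (W y))) * (M * expR (- (2 * W y))) =
      (2 * C * M * s ^+ 2) * expR (- W y).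
    have -> : - (2 * W y) = - W y - W y by ring.
    by rewrite expRD (expRN (W y)); field; rewrite gt_eqF// expR_gt0.
  have := ler_wpM2l (mulr_ge0 (mulr_ge0 (mulr_ge0 (ler0n _ 2) (ltW C0)) M0) (sqr_ge0 s)) (H' y).
  by congr (_ <= _); ring.
rewrite RintegralZl//; last exact: integrable_cauchy_rV.
have : 0 <= 4 * C * C' * M * s ^+ 2 by rewrite mulr_ge0 ?sqr_ge0// !mulr_ge0// ltW.
lra.
Qed.

Lemma pderiv_fourier i f : cmeas f -> rapid f ->
  pderiv i (fourier f) = fourier (mulcoord i f) /\
  forall x, derivable (re_fun (fourier f)) x (delta_mx 0 i) /\
            derivable (im_fun (fourier f)) x (delta_mx 0 i).
Proof.
move=> mf rf; have [K K0 H] := fourier_taylor; have [M HM] := rf 2.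
have HT := H i M f mf rf HM.
have DR x : derivable (re_fun (fourier f)) x (delta_mx 0 i) /\
    'D_(delta_mx 0 i) (re_fun (fourier f)) x = complex.Re (fourier (mulcoord i f) x).
  apply: (@derive_of_quadratic_bound _ _ _ _ _ _ (K * M)) => s.
  apply: le_trans (HT x s); apply: le_trans (Re_le_normc _); rewrite /re_fun.
  case: (fourier f (x + _)) (fourier f x) (fourier _ x) => a b [a' b'] [a'' b''] /=.
  by rewrite mul0r subr0.
have DI x : derivable (im_fun (fourier f)) x (delta_mx 0 i) /\
    'D_(delta_mx 0 i) (im_fun (fourier f)) x = complex.Im (fourier (mulcoord i f) x).
  apply: (@derive_of_quadratic_bound _ _ _ _ _ _ (K * M)) => s.
  apply: le_trans (HT x s); apply: le_trans (Im_le_normc _); rewrite /im_fun.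
  case: (fourier f (x + _)) (fourier f x) (fourier _ x) => a b [a' b'] [a'' b''] /=.
  by rewrite mul0r addr0.
split; last by move=> x; case: (DR x) (DI x) => ? _ [? _].
apply/funext => x; rewrite /pderiv (DR x).2 (DI x).2.
by case: (fourier _ x).
Qed.

Lemma pderivs_fourier s f : cmeas f -> rapid f ->
  pderivs s (fourier f) = fourier (mulcoords s f).
Proof.
move=> mf rf; elim: s => //= i s ->.
by have [] := pderiv_fourier i (cmeas_mulcoords s mf) (rapid_mulcoords s rf).
Qed.

Lemma smooth_fourier f : cmeas f -> rapid f -> smooth (fourier f).
Proof.
move=> mf rf s; rewrite pderivs_fourier//.
have mfs := cmeas_mulcoords s mf; have rfs := rapid_mulcoords s rf.
have [c1 c2] := fourier_continuous mfs rfs.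
by split => // i x; have [_] := pderiv_fourier i mfs rfs; apply.
Qed.

End rapid_decay.

(** * The space of test functions without derivatives *)

Section test_functions.
Context {R : realType} (w : R -> R) (hw : weight_function w) {n : nat}.
Local Notation lebn := (@lebesgue_rV R n).
Local Notation W := (weightv w).
Local Open Scope complex_scope.
Implicit Types (f g h : 'rV[R]_n -> R[i]) (la M : R).

(* Derivatives are left out: by [Aw_Sw] below this describes the same functions
   as [Sw], with equivalent seminorms. *)
Definition Aw f := [/\ continuous (re_fun f), continuous (im_fun f),
  rapid w f & rapid w (fourier f)].

Definition seminorm_le la M f := decay w la M f /\ decay w la M (fourier f).

Lemma Aw_cmeas f : Aw f -> cmeas f.
Proof. by move=> [c1 c2 _ _]; split; exact: continuous_measurable_rV. Qed.

Lemma Aw_cintegrable f : Aw f -> cintegrable lebn f.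
Proof. by move=> fA; have [_ _ r _] := fA; exact: (rapid_cintegrable hw (Aw_cmeas fA) r). Qed.

Lemma Aw_fourier_cmeas f : Aw f -> cmeas (fourier f).
Proof. by move=> fA; apply: cmeas_fourier; exact: Aw_cmeas. Qed.

Lemma Aw_fourier_cintegrable f : Aw f -> cintegrable lebn (fourier f).
Proof.
by move=> fA; have [_ _ _ r] := fA; exact: (rapid_cintegrable hw (Aw_fourier_cmeas fA) r).
Qed.

Definition fourier_cst : R := (2 * pi) ^+ n.

Lemma fourier_cst_gt0 : 0 < fourier_cst.
Proof. by rewrite exprn_gt0// mulr_gt0// pi_gt0. Qed.

Lemma fourier_cst_neq0 : fourier_cst%:C != 0.
Proof. by rewrite eq_complex/= eqxx andbT gt_eqF// fourier_cst_gt0. Qed.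

Lemma fourierK f x : Aw f -> fourier (fourier f) (- x) = fourier_cst%:C * f x.
Proof.
move=> fA; have [c1 c2 r1 _] := fA; have [M HM] := r1 0.
apply: (fourier_inversion x c1 c2 (Aw_cintegrable fA) (Aw_fourier_cintegrable fA)).
exact: decay_bounded HM.
Qed.

(** The inverse Fourier transform of [f]. Writing [f] as the Fourier transform of this function
    gives access to the lemmas on differentiation under the integral. *)
Definition inv_density f : 'rV[R]_n -> R[i] :=
  fun xi => (fourier_cst^-1)%:C * fourier f (- xi).

Lemma decay_inv_density la M f : decay w la M (fourier f) ->
  decay w la (fourier_cst^-1 * M) (inv_density f).
Proof.
move=> H x; rewrite /inv_density normcM normc_real.
rewrite gtr0_norm ?invr_gt0 ?fourier_cst_gt0// -mulrA ler_pM2l ?invr_gt0 ?fourier_cst_gt0//.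
by have := H (- x); rewrite weightvN.
Qed.

Lemma rapid_inv_density f : Aw f -> rapid w (inv_density f).
Proof.
move=> [_ _ _ r] la; have [M HM] := r la.
by exists (fourier_cst^-1 * M); exact: decay_inv_density.
Qed.

Lemma measurable_opp_rV : measurable_fun setT (fun x : 'rV[R]_n => - x).
Proof.
have := @measurable_affine_rV R n 0 (-1); apply: eq_measurable_fun => x _.
by rewrite add0r scaleN1r.
Qed.

Lemma cmeas_inv_density f : Aw f -> cmeas (inv_density f).
Proof.
move=> fA; apply: cmeasM; first exact: cmeas_cst.
exact: (cmeas_comp measurable_opp_rV (Aw_fourier_cmeas fA)).
Qed.

Lemma fourier_inv_density f : Aw f -> fourier (inv_density f) = f.
Proof.
move=> fA; apply/funext => x.
have Fi := Aw_fourier_cintegrable fA.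
have i1 := cintegrable_fourier (- x) Fi.
have [i2 e2] := cintegral_opp_rV 0 i1.
have -> : fourier (inv_density f) x = (fourier_cst^-1)%:C * fourier (fourier f) (- x).
  rewrite [fourier (fourier f) (- x)]/fourier -e2 -(cintegralZ _ i2).
  by apply: eq_cintegral => y; rewrite sub0r dotvNl dotvNr opprK /inv_density mulrCA.
have cK : (fourier_cst^-1)%:C * fourier_cst%:C = 1.
  rewrite -[1]/((1 : R)%:C) -(mulVf (lt0r_neq0 fourier_cst_gt0)).
  by apply/eqP; rewrite eq_complex/= !mulr0 !mul0r subr0 addr0 !eqxx.
by rewrite (fourierK x fA) mulrA cK mul1r.
Qed.

Lemma fourier_fourier f : Aw f -> fourier (fourier f) = (fun x => fourier_cst%:C * f (- x)).
Proof. by move=> fA; apply/funext => x; rewrite -fourierK// opprK. Qed.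

Lemma decay_fourier_fourier la M f : Aw f -> decay w la M f ->
  decay w la (fourier_cst * M) (fourier (fourier f)).
Proof.
move=> fA H x; rewrite fourier_fourier// normcM normc_real gtr0_norm ?fourier_cst_gt0//.
by rewrite -mulrA ler_pM2l ?fourier_cst_gt0//; have := H (- x); rewrite weightvN.
Qed.

Lemma Aw_fourier f : Aw f -> Aw (fourier f).
Proof.
move=> fA; have [c1 c2 r1 r2] := fA.
have [d1 d2] := fourier_continuous hw (Aw_cmeas fA) r1.
split => // la; have [M HM] := r1 la.
by exists (fourier_cst * M); exact: decay_fourier_fourier.
Qed.

Lemma seminorm_le_fourier la M f : Aw f -> seminorm_le la M f ->
  seminorm_le la ((1 + fourier_cst) * M) (fourier f).
Proof.
move=> fA [H1 H2]; have M0 := decay_ge0 H1.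
have c0 := fourier_cst_gt0.
split.
  by apply: decay_mono H2 => //; rewrite mulrDl mul1r lerDl mulr_ge0// ltW.
by apply: decay_mono (decay_fourier_fourier fA H1) => //; rewrite mulrDl mul1r lerDr.
Qed.

Lemma Aw_smooth f : Aw f -> smooth f.
Proof.
move=> fA; rewrite -(fourier_inv_density fA).
exact: (smooth_fourier hw (cmeas_inv_density fA) (rapid_inv_density fA)).
Qed.

(* Interpolation: a Taylor expansion with step [exp(-la W x)] bounds the
   derivative by the decay of the function and a bound on second derivatives,
   the latter given by the integral of [y_i^2] against the Fourier transform. *)
Lemma decay_pderivs s la : 0 <= la -> exists la', exists2 C : R, 0 < C &
  forall M f, Aw f -> seminorm_le la' M f -> decay w la (C * M) (pderivs s f).
Proof.
elim: s la => [|i s IH] la la0.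
  by exists la, 1 => // M f fA []; rewrite mul1r.
have la20 : 0 <= 2 * la by rewrite mulr_ge0.
(* The rate is doubled for the lower-order derivative, because dividing by the step
   [expR (- (la * W x))] uses up [la]. *)
have [la1 [C1 C10 H1]] := IH _ la20.
have [C2 C20 H2] := decay_mulcoords hw (n := n) s.
have [K K0 HK] := fourier_taylor hw (n := n).
pose la' := Num.max la1 (2 + (size s)%:R).
pose C3 := C2 * fourier_cst^-1.
have C30 : 0 < C3 by rewrite mulr_gt0// invr_gt0 fourier_cst_gt0.
(* The terms stem from the value at the displaced point, the value at [x] and the Taylor remainder.
   The step is at most 1, so the displacement changes the weight by at most [w 1]. *)
exists la', (C1 * (expR (2 * la * w 1) + 1) + K * C3).
  by rewrite ltr_wpDr ?mulr_gt0 ?addr_gt0 ?expR_gt0// mulr_ge0// ltW.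
move=> M f fA fM.
have M0 : 0 <= M by case: fM => /decay_ge0.
have mh := cmeas_inv_density fA; have rh := rapid_inv_density fA.
set h := inv_density f in mh rh.
have fE : f = fourier h by rewrite fourier_inv_density.
have hM : decay w 2 (C3 * M) (mulcoords s h).
  rewrite /C3 -mulrA; apply: H2; apply: decay_inv_density.
  by case: fM => _; apply: decay_mono; rewrite // le_max lexx orbT.
have sM : decay w (2 * la) (C1 * M) (pderivs s f).
  apply: H1 => //; case: fM => a b; split.
    by apply: decay_mono a; rewrite // le_max lexx.
  by apply: decay_mono b; rewrite // le_max lexx.
have sE : pderivs s f = fourier (mulcoords s h) by rewrite {1}fE; exact: (pderivs_fourier hw s mh rh).
have isE : pderivs (i :: s) f = fourier (mulcoord i (mulcoords s h)).
  by rewrite {1}fE; exact: (pderivs_fourier hw (i :: s) mh rh).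
move=> x; rewrite isE; set D := fourier (mulcoord i (mulcoords s h)) x.
pose t := expR (- (la * W x)).
have t0 : 0 < t by exact: expR_gt0.
have t1 : t <= 1 by rewrite expR_le1 oppr_le0 mulr_ge0// weightv_ge0.
have := HK i _ _ (cmeas_mulcoords s mh) (rapid_mulcoords hw s rh) hM x t.
rewrite -sE -/D => HT.
have tt : expR (- (2 * la * W x)) = t ^+ 2.
  by rewrite /t expr2 -expRD; congr expR; ring.
have g1 : normc (pderivs s f x) <= C1 * M * t ^+ 2 by rewrite -tt; exact: sM.
have g2 : normc (pderivs s f (x + t *: delta_mx 0 i)) <= C1 * M * (expR (2 * la * w 1) * t ^+ 2).
  apply: (le_trans (sM _)); rewrite ler_wpM2l ?(mulr_ge0 (ltW C10) M0)//.
  rewrite -tt -expRD ler_expR.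
  have e1 : enorm (delta_mx 0 i : 'rV[R]_n) = 1.
    rewrite /enorm /dotv (bigD1 i)//= big1 => [|j ji].
      by rewrite mxE !eqxx mulr1 addr0 sqrtr1.
    by rewrite mxE (negbTE ji) andbF mulr0.
  have W1 : W x <= W (x + t *: delta_mx 0 i) + w 1.
    have := weightvB hw (x + t *: delta_mx 0 i) (t *: delta_mx 0 i); rewrite addrK.
    move/le_trans; apply; rewrite lerD2l /weightv enormZ e1 mulr1 gtr0_norm//.
    by apply: (weight_nondecreasing hw) => //; exact: ltW.
  have := ler_wpM2l la20 W1; lra.
have tD : t * normc D <= normc (pderivs s f (x + t *: delta_mx 0 i)) + normc (pderivs s f x)
    + K * (C3 * M) * t ^+ 2.
  rewrite -[t in leLHS](gtr0_norm t0) -normc_real -normcM.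
  set a := pderivs s f (x + _) in HT *; set b := pderivs s f x in HT *.
  have -> : t%:C * D = (a - b) - (a - b - t%:C * D) by ring.
  by apply: (le_trans (normcB _ _)); apply: lerD => //; exact: normcB.
rewrite -(ler_pM2l t0); apply: (le_trans tD).
have -> : t * ((C1 * (expR (2 * la * w 1) + 1) + K * C3) * M * t) =
  C1 * M * (expR (2 * la * w 1) * t ^+ 2) + C1 * M * t ^+ 2 + K * (C3 * M) * t ^+ 2 by ring.
by rewrite lerD2r lerD.
Qed.

End test_functions.

(** * Continuity of complex-valued functions *)

Section complex_continuity.
Context {R : realType} {n : nat}.
Local Open Scope complex_scope.
Implicit Types f g : 'rV[R]_n -> R[i].

Definition ccont f := continuous (re_fun f) /\ continuous (im_fun f).

Implicit Types h k : 'rV[R]_n -> R.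

Lemma rV_continuousD h k : continuous h -> continuous k -> continuous (fun x => h x + k x).
Proof. by move=> ch ck x; refine (@cvgD _ R^o _ _ _ _ _ _ _ (ch x) (ck x)). Qed.

Lemma rV_continuousN h : continuous h -> continuous (fun x => - h x).
Proof. by move=> ch x; refine (@cvgN _ R^o _ _ _ _ _ (ch x)). Qed.

Lemma rV_continuousM h k : continuous h -> continuous k -> continuous (fun x => h x * k x).
Proof. by move=> ch ck x; refine (cvgM (ch x) (ck x)). Qed.

Lemma rV_continuous_comp h (k : R -> R) : continuous h -> continuous k ->
  continuous (fun x => k (h x)).
Proof. by move=> ch ck x; apply: continuous_comp; [exact: ch|exact: ck]. Qed.

Lemma ccont_cst (c : R[i]) : ccont (fun _ => c).
Proof. by split => x; refine (@cst_continuous _ _ _ x). Qed.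

Lemma ccontD f g : ccont f -> ccont g -> ccont (fun x => f x + g x).
Proof.
move=> [f1 f2] [g1 g2]; split.
- rewrite (_ : re_fun _ = (fun x => re_fun f x + re_fun g x)).
    exact: rV_continuousD.
  by apply/funext => x; rewrite /re_fun /=; case: (f x) (g x) => ? ? [].
- rewrite (_ : im_fun _ = (fun x => im_fun f x + im_fun g x)).
    exact: rV_continuousD.
  by apply/funext => x; rewrite /im_fun /=; case: (f x) (g x) => ? ? [].
Qed.

Lemma ccontM f g : ccont f -> ccont g -> ccont (fun x => f x * g x).
Proof.
move=> [f1 f2] [g1 g2]; split.
- rewrite (_ : re_fun _ = (fun x => re_fun f x * re_fun g x - im_fun f x * im_fun g x : R^o)).
    by apply: rV_continuousD; [|apply: rV_continuousN]; exact: rV_continuousM.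
  by apply/funext => x; rewrite /re_fun /im_fun /=; case: (f x) (g x) => ? ? [].
- rewrite (_ : im_fun _ = (fun x => re_fun f x * im_fun g x + im_fun f x * re_fun g x : R^o)).
    by apply: rV_continuousD; exact: rV_continuousM.
  by apply/funext => x; rewrite /re_fun /im_fun /=; case: (f x) (g x) => ? ? [].
Qed.

Lemma ccont_conj f : ccont f -> ccont (fun x => conjc (f x)).
Proof.
move=> [f1 f2]; split.
- by rewrite (_ : re_fun _ = re_fun f)//; apply/funext => x; rewrite /re_fun; case: (f x).
- rewrite (_ : im_fun _ = (fun x => - im_fun f x : R^o)).
    exact: rV_continuousN.
  by apply/funext => x; rewrite /im_fun; case: (f x).
Qed.

Lemma ccont_shift f (x : 'rV[R]_n) : ccont f -> ccont (fun y => f (y - x)).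
Proof.
have S (g : 'rV[R]_n -> R) : continuous g -> continuous (fun y : 'rV[R]_n => g (y - x)).
  move=> cg y; apply/rV_continuousP => e e0.
  have [de de0 H] := (rV_continuousP g (y - x)).1 (cg _) e e0.
  exists de => // z yz; apply: H => i; rewrite !mxE.
  by rewrite (_ : _ - _ - _ = y 0 i - z 0 i)//; ring.
by move=> [f1 f2]; split; [exact: (S _ f1)|exact: (S _ f2)].
Qed.

Lemma lipschitz_continuous (g : 'rV[R]_n -> R) (K : R) : 0 <= K ->
  (forall x y, `|g x - g y| <= K * enorm (x - y)) -> continuous g.
Proof.
move=> K0 H x; apply/rV_continuousP => e e0.
have Kn : 0 < 1 + K * n%:R by rewrite ltr_pwDl// !mulr_ge0.
exists (e / (1 + K * n%:R)) => [|y xy]; first exact: divr_gt0.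
apply: le_lt_trans (H x y) _.
have le1 : enorm (x - y) <= n%:R * (e / (1 + K * n%:R)).
  rewrite (le_trans (enorm_le_sum _))//.
  rewrite mulr_natl -[X in _ *+ X]card_ord -sumr_const; apply: ler_sum => i _.
  by rewrite !mxE ltW.
apply: (@le_lt_trans _ _ (K * (n%:R * (e / (1 + K * n%:R))))).
  by rewrite ler_wpM2l.
by rewrite !mulrA ltr_pdivrMr// mulrC ltr_pM2l// ltrDr.
Qed.

Lemma ccont_cis_dotv (xi : 'rV[R]_n) : ccont (fun y => cis (dotv y xi)).
Proof.
have c : continuous (fun y : 'rV[R]_n => dotv y xi).
  apply: (@lipschitz_continuous _ (enorm xi)); first exact: enorm_ge0.
  by move=> x y; rewrite -dotvBl mulrC dotv_le.
split; [apply: (rV_continuous_comp (k := @cos R) c)|apply: (rV_continuous_comp (k := @sin R) c)].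
  exact: continuous_cos.
exact: continuous_sin.
Qed.

End complex_continuity.

(** * Equivalence with the space [Sw], and bounds for functionals *)

Section test_space.
Context {R : realType} (w : R -> R) (hw : weight_function w) {n : nat}.
Local Notation lebn := (@lebesgue_rV R n).
Local Notation W := (weightv w).
Local Open Scope complex_scope.
Implicit Types (f g : 'rV[R]_n -> R[i]) (la M : R) (al : {ffun 'I_n -> nat}).

Definition multi_seq al : seq 'I_n := flatten [seq nseq (al i) i | i <- enum 'I_n].

Lemma mderivE al f : mderiv al f = pderivs (multi_seq al) f.
Proof.
rewrite /mderiv /multi_seq; elim: (enum 'I_n) => //= i s ->.
by rewrite /pderivs foldr_cat; elim: (al i) => //= k ->.
Qed.

Lemma normc_Dop al f x : normc (Dop al f x) = normc (mderiv al f x).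
Proof. by rewrite /Dop normcM normcX /= expr0n/= add0r sqrrN expr1n sqrtr1 expr1n mul1r. Qed.

Lemma Dop0 f : Dop [ffun=> 0%N] f = f.
Proof.
apply/funext => x; rewrite /Dop big1; last by move=> i _; rewrite ffunE.
rewrite expr0 mul1r /mderiv.
suff -> : forall s, foldr (fun i g => iter ([ffun=> 0%N] i) (pderiv i) g) f s = f by [].
by elim => //= i s ->; rewrite ffunE.
Qed.

Lemma wsup_le la al f M : decay w la M (mderiv al f) -> (wsup w la al f <= M%:E)%E.
Proof.
move=> H; apply: ge_ereal_sup => _ [x _ <-]; rewrite lee_fin normc_Dop.
by rewrite mulrC -ler_pdivlMr ?expR_gt0// -expRN; exact: H.
Qed.

Lemma wsup_decay la al f : (wsup w la al f < +oo)%E -> exists M, decay w la M (Dop al f).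
Proof.
move=> H; pose S := wsup w la al f.
have Sx x : ((expR (la * W x) * normc (Dop al f x))%:E <= S)%E.
  by apply: ereal_sup_ubound; exists x.
have S0 : (0%:E <= S)%E by apply: le_trans (Sx 0); rewrite lee_fin mulr_ge0 ?expR_ge0 ?normc_ge0.
exists (fine S) => x; rewrite expRN ler_pdivlMr ?expR_gt0// mulrC -lee_fin.
by rewrite fineK// ge0_fin_numE.
Qed.

Lemma decay_add la M M' f g : decay w la M f -> decay w la M' g ->
  decay w la (M + M') (fun x => f x + g x).
Proof.
by move=> fM gM x; apply: (le_trans (normcD _ _)); rewrite mulrDl lerD.
Qed.

Lemma decay_scale la M (c : R[i]) f : decay w la M f ->
  decay w la (normc c * M) (fun x => c * f x).
Proof. by move=> fM x; rewrite normcM -mulrA ler_wpM2l ?normc_ge0. Qed.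

Lemma fourierD f g : cintegrable lebn f -> cintegrable lebn g ->
  fourier (fun x => f x + g x) = (fun xi => fourier f xi + fourier g xi).
Proof.
move=> fi gi; apply/funext => xi.
rewrite /fourier -(cintegralD (cintegrable_fourier xi fi) (cintegrable_fourier xi gi)).
by apply: eq_cintegral => y; rewrite mulrDr.
Qed.

Lemma fourierZ (c : R[i]) f : cintegrable lebn f ->
  fourier (fun x => c * f x) = (fun xi => c * fourier f xi).
Proof.
move=> fi; apply/funext => xi.
rewrite /fourier -(cintegralZ _ (cintegrable_fourier xi fi)).
by apply: eq_cintegral => y; rewrite mulrCA.
Qed.

Lemma AwD f g : Aw w f -> Aw w g -> Aw w (fun x => f x + g x).
Proof.
move=> fA gA; have [f1 f2 f3 f4] := fA; have [g1 g2 g3 g4] := gA.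
have [c1 c2] := ccontD (conj f1 f2) (conj g1 g2).
split => //.
- by move=> la; have [M HM] := f3 la; have [M' HM'] := g3 la; exists (M + M'); exact: decay_add.
- move=> la; have [M HM] := f4 la; have [M' HM'] := g4 la; exists (M + M').
  by rewrite (fourierD (Aw_cintegrable hw fA) (Aw_cintegrable hw gA)); exact: decay_add.
Qed.

Lemma AwZ (c : R[i]) f : Aw w f -> Aw w (fun x => c * f x).
Proof.
move=> fA; have [f1 f2 f3 f4] := fA.
have [c1 c2] := ccontM (ccont_cst c) (conj f1 f2).
split => //.
- by move=> la; have [M HM] := f3 la; exists (normc c * M); exact: decay_scale.
- move=> la; have [M HM] := f4 la; exists (normc c * M).
  by rewrite (fourierZ _ (Aw_cintegrable hw fA)); exact: decay_scale.
Qed.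

Lemma seminorm_leZ (c : R[i]) la M f : Aw w f -> seminorm_le w la M f ->
  seminorm_le w la (normc c * M) (fun x => c * f x).
Proof.
move=> fA [H1 H2]; split; first exact: decay_scale.
by rewrite (fourierZ _ (Aw_cintegrable hw fA)); exact: decay_scale.
Qed.

Lemma fourier0 : fourier (fun _ : 'rV[R]_n => 0) = (fun _ => 0) :> ('rV[R]_n -> R[i]).
Proof.
apply/funext => xi; rewrite /fourier -[RHS](cintegral0 lebn).
by apply: eq_cintegral => y; rewrite mulr0.
Qed.

Lemma decay0 la : decay w la 0 (fun _ : 'rV[R]_n => 0 : R[i]).
Proof. by move=> x; rewrite ComplexField.Normc.normc0 mul0r. Qed.

Lemma Aw0 : Aw w (fun _ : 'rV[R]_n => 0 : R[i]).
Proof.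
have [c1 c2] := @ccont_cst R n 0.
by split => // [la|]; [|rewrite fourier0 => la]; exists 0; exact: decay0.
Qed.

Lemma Aw_sum (I : Type) (s : seq I) (F : I -> 'rV[R]_n -> R[i]) :
  (forall i, Aw w (F i)) -> Aw w (fun x => \sum_(i <- s) F i x).
Proof.
move=> FA; elim: s => [|i s IH].
  rewrite (_ : (fun _ => _) = (fun=> 0)); first exact: Aw0.
  by apply/funext => x; rewrite big_nil.
rewrite (_ : (fun _ => _) = (fun x => F i x + \sum_(i <- s) F i x)).
  exact: AwD.
by apply/funext => x; rewrite big_cons.
Qed.

Lemma Sw_Aw f : Sw w f -> Aw w f.
Proof.
move=> [[sf _] H]; have [c1 c2 _] := sf [::].
split => //; apply: rapid_of_pos => // la la0.
- have [h _] := H la [ffun=> 0%N] la0; have := wsup_decay h.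
  by rewrite Dop0.
- have [_ h] := H la [ffun=> 0%N] la0; have := wsup_decay h.
  by rewrite Dop0.
Qed.

Lemma Aw_seminorm la f : Aw w f -> exists M, seminorm_le w la M f.
Proof.
move=> [_ _ r1 r2]; have [M1 H1] := r1 la; have [M2 H2] := r2 la.
exists (Num.max M1 M2); split.
  by apply: decay_mono H1 => //; rewrite le_max lexx.
by apply: decay_mono H2 => //; rewrite le_max lexx orbT.
Qed.

Lemma decay_mderiv al la : 0 <= la -> exists la', exists2 C : R, 0 < C &
  forall M f, Aw w f -> seminorm_le w la' M f ->
    decay w la (C * M) (mderiv al f) /\ decay w la (C * M) (mderiv al (fourier f)).
Proof.
move=> la0; have [la' [C C0 H]] := decay_pderivs hw (multi_seq al) la0.
have c1 : 1 <= 1 + fourier_cst (R := R) (n := n) by rewrite lerDl ltW// fourier_cst_gt0.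
exists la', (C * (1 + fourier_cst (R := R) (n := n))) => [|M f fA fM].
  by rewrite mulr_gt0//; lra.
have M0 : 0 <= M by case: fM => /decay_ge0.
rewrite !mderivE; split.
  apply: decay_mono (H _ _ fA fM) => //.
  by rewrite -mulrA ler_wpM2l ?(ltW C0)// ler_peMl.
rewrite -mulrA; apply: H; first exact: Aw_fourier.
exact: seminorm_le_fourier.
Qed.

Lemma normr_monom_le al (x : 'rV[R]_n) : `|monom al x| <= enorm x ^+ (\sum_i al i)%N.
Proof.
rewrite /monom normr_prod expr_sum; apply: ler_prod => i _.
by rewrite normr_ge0 normrX lerXn2r ?nnegrE ?enorm_ge0// coord_le_enorm.
Qed.

(** Smoothness holds because [f] is the Fourier transform of a rapidly decaying function. The
    derivatives decay by [decay_mderiv], and decay at rate 1 already beats any monomial, which gives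
    the Schwartz seminorms. *)
Lemma Aw_Sw f : Aw w f -> Sw w f.
Proof.
move=> fA; split; first split; first exact: (Aw_smooth hw fA).
- move=> al be; have [C C0 HC] := enorm_le_expR hw n (\sum_i al i)%N.
  have [la [C' C'0 H]] := decay_mderiv be (ler01 (R := R)).
  have [M HM] := Aw_seminorm la fA; have [HM' _] := H _ _ fA HM.
  apply: (@le_lt_trans _ _ ((C * (C' * M))%:E)); last exact: ltry.
  apply: ge_ereal_sup => _ [x _ <-]; rewrite lee_fin.
  apply: (@le_trans _ _ (C * expR (W x) * (C' * M * expR (- (1 * W x))))).
    by rewrite ler_pM ?normc_ge0// (le_trans (normr_monom_le al x)).
  by rewrite mul1r expRN mulrACA divff ?mulr1// gt_eqF// expR_gt0.
- move=> la al la0; have [la' [C C0 H]] := decay_mderiv al (ltW la0).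
  have [M HM] := Aw_seminorm la' fA; have [H1 H2] := H _ _ fA HM.
  by split; [apply: le_lt_trans (wsup_le H1) _|apply: le_lt_trans (wsup_le H2) _]; exact: ltry.
Qed.

(** A basic neighbourhood of 0 in [Sw] involves finitely many seminorms, and a single
    derivative-free one, at a large enough rate, controls them all. This is the comparison of
    topologies through which continuity of [u] is used. *)
Lemma decay_mderiv_seq (s : seq (R * {ffun 'I_n -> nat})) : exists la', exists2 C : R, 0 < C &
  forall la al, (la, al) \in s -> 0 < la -> forall M f, Aw w f -> seminorm_le w la' M f ->
    decay w la (C * M) (mderiv al f) /\ decay w la (C * M) (mderiv al (fourier f)).
Proof.
elim: s => [|[la al] s [la1 [C1 C10 H1]]]; first by exists 0, 1.
have [la2 [C2 C20 H2]] : exists la', exists2 C : R, 0 < C & 0 < la -> forall M f, Aw w f ->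
    seminorm_le w la' M f ->
    decay w la (C * M) (mderiv al f) /\ decay w la (C * M) (mderiv al (fourier f)).
  (* Indices with a nonpositive rate impose no condition, so any rate and constant will do for
     them. *)
  have [la0|la0] := ltP 0 la; last by exists 0, 1 => // /(le_lt_trans la0); rewrite ltxx.
  by have [la' [C C0 H]] := decay_mderiv al (ltW la0); exists la', C.
exists (Num.max la1 la2), (C1 + C2) => [|la' al']; first exact: addr_gt0.
move=> lin la'0 M f fA [fM fM'].
have M0 : 0 <= M by exact: decay_ge0 fM.
have D (C : R) g : C <= C1 + C2 -> decay w la' (C * M) g -> decay w la' ((C1 + C2) * M) g.
  by move=> CC; apply: decay_mono => //; rewrite ler_wpM2r.
move: lin; rewrite inE => /predU1P[[la'E al'E]|lin].
- subst la' al'.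
  have [|d1 d2] := H2 la'0 M f fA; last by split; apply: D (_ : C2 <= _) _ => //; lra.
  by split; [apply: decay_mono fM|apply: decay_mono fM'] => //; rewrite le_max lexx orbT.
- have [|d1 d2] := H1 _ _ lin la'0 M f fA; last by split; apply: D (_ : C1 <= _) _ => //; lra.
  by split; [apply: decay_mono fM|apply: decay_mono fM'] => //; rewrite le_max lexx.
Qed.

Lemma Sw_dual0 (u : functional) : Sw_dual w u -> u (fun _ : 'rV[R]_n => 0) = 0.
Proof.
move=> [_ uZ _]; have := uZ 0 _ (Aw_Sw Aw0).
rewrite (_ : (fun x : 'rV[R]_n => _) = (fun _ => 0)); last by apply/funext => x; rewrite mul0r.
by move=> ->; rewrite (_ : conjc 0 = 0) ?mul0r// /conjc /= oppr0.
Qed.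

(** Continuity at 0 with tolerance 1, extended by homogeneity: [g] is scaled into the neighbourhood
    and the scalar is taken out of [u]. *)
Lemma Sw_dual_bound (u : functional) : Sw_dual w u -> exists la, exists2 C : R, 0 < C &
  forall M g, Aw w g -> seminorm_le w la M g -> normc (u g) <= C * M.
Proof.
move=> uD; have u0 := Sw_dual0 uD; have [_ uZ uc] := uD.
have [s [de de0 H]] := uc _ 1 (Aw_Sw Aw0) ltr01.
have [la [C C0 HC]] := decay_mderiv_seq s.
exists la, (2 * C / de) => [|M g gA gM]; first by rewrite divr_gt0// mulr_gt0.
have M0 : 0 <= M by case: gM => /decay_ge0.
apply/ler_addgt0Pr => e e0.
(* [M] may be 0, so the scaling uses a slightly larger positive bound, whose excess contributes
   exactly [e]. *)
pose M' := M + e / (2 * C / de).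
have K0 : 0 < 2 * C / de by rewrite divr_gt0// mulr_gt0.
have M'0 : 0 < M' by rewrite ltr_wpDl// divr_gt0.
have -> : 2 * C / de * M + e = 2 * C / de * M'.
  by rewrite /M' mulrDr; congr (_ + _); field; rewrite !gt_eqF.
(* The scaled function has all relevant seminorms at most [de / 2]; the halving gives the strict
   inequality asked for by [Sw_nbhs0]. *)
pose r : R := de / (2 * C * M').
have r0 : 0 < r by rewrite divr_gt0// !mulr_gt0.
have rA := AwZ r%:C gA.
have rM : seminorm_le w la (r * M') (fun x => r%:C * g x).
  have rE : normc r%:C = r by rewrite normc_real gtr0_norm.
  have MM' : M <= M' by rewrite /M' lerDl divr_ge0// ltW.
  have [a b] := seminorm_leZ r%:C gA gM; rewrite rE in a b.
  by split; [apply: decay_mono a|apply: decay_mono b]; rewrite // ler_pM2l.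
have Cr : C * (r * M') = de / 2 by rewrite /r; field; rewrite !gt_eqF.
have := H _ (Aw_Sw rA); rewrite u0 uZ ?subr0; last exact: Aw_Sw.
have -> : (fun x : 'rV[R]_n => r%:C * g x - 0) = (fun x => r%:C * g x).
  by apply/funext => x; rewrite subr0.
move=> /(_ _)/wrap[].
  move=> la' al' lin la'0; have [d1 d2] := HC _ _ lin la'0 _ _ rA rM.
  rewrite Cr in d1 d2.
  have dd : ((de / 2)%:E < de%:E)%E by rewrite lte_fin; lra.
  by split; [apply: le_lt_trans (wsup_le d1) dd|apply: le_lt_trans (wsup_le d2) dd].
rewrite normcM normc_conj normc_real gtr0_norm// => /ltW ur.
have -> : 2 * C / de * M' = r^-1 by rewrite /r; field; rewrite !gt_eqF.
by rewrite -(ler_pM2l r0) divff ?gt_eqF.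
Qed.

End test_space.

(** * Time-frequency shifts *)

Section time_frequency_shifts.
Context {R : realType} (w : R -> R) (hw : weight_function w) {n : nat}.
Local Notation lebn := (@lebesgue_rV R n).
Local Notation W := (weightv w).
Local Open Scope complex_scope.
Implicit Types (f g : 'rV[R]_n -> R[i]) (la M : R) (x xi : 'rV[R]_n) (z : 'rV[R]_(n + n)).

Lemma tfshift_row x xi f y : tfshift (row_mx x xi) f y = cis (dotv y xi) * f (y - x).
Proof. by rewrite /tfshift row_mxKl row_mxKr. Qed.

Lemma ccont_tfshift z f : ccont f -> ccont (tfshift z f).
Proof. by move=> fc; apply: ccontM; [exact: ccont_cis_dotv|exact: ccont_shift]. Qed.

Lemma normc_tfshift z f y : normc (tfshift z f y) = normc (f (y - lsubmx z)).
Proof. by rewrite /tfshift normcM normc_cis mul1r. Qed.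

Lemma decay_tfshift la M z f : 0 <= la -> decay w la M f ->
  decay w la (M * expR (la * W (lsubmx z))) (tfshift z f).
Proof.
move=> la0 fM y; have M0 := decay_ge0 fM.
rewrite normc_tfshift (le_trans (fM _))// -mulrA ler_wpM2l// -expRD ler_expR.
have := ler_wpM2l la0 (weightv_triangle hw y (lsubmx z)); lra.
Qed.

Lemma fourier_tfshift x xi f : cintegrable lebn f ->
  fourier (tfshift (row_mx x xi) f) =
  (fun eta => cis (dotv x xi) * tfshift (row_mx xi (- x)) (fourier f) eta).
Proof.
move=> fi; apply/funext => eta; rewrite tfshift_row.
have i1 := cintegrable_fourier (eta - xi) fi.
have i2 : cintegrable lebn (fun y => cis (- dotv y eta) * tfshift (row_mx x xi) f y).
  have [j1 _] := cintegral_shift_rV (- x) i1.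
  have := cintegrableZ (cis (- dotv x (eta - xi))) j1.
  congr cintegrable; apply/funext => y; rewrite tfshift_row !mulrA -!cisD.
  by congr (cis _ * _); rewrite !dotvBr !dotvDl !dotvNl; ring.
have [_ e2] := cintegral_shift_rV x i2.
rewrite /fourier -e2 mulrA -cisD.
rewrite -(cintegralZ _ i1); apply: eq_cintegral => y.
rewrite tfshift_row addrK !mulrA -!cisD; congr (cis _ * _).
by rewrite !dotvNr !dotvDl !dotvBr (dotvC eta); ring.
Qed.

Lemma row_submxK z : row_mx (lsubmx z) (rsubmx z) = z.
Proof. exact: hsubmxK. Qed.

Lemma seminorm_le_tfshift la M z f : 0 <= la -> cintegrable lebn f ->
  seminorm_le w la M f -> seminorm_le w la (M * expR (la * W z)) (tfshift z f).
Proof.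
move=> la0 fi [H1 H2]; have M0 := decay_ge0 H1.
have le1 : expR (la * W (lsubmx z)) <= expR (la * W z).
  rewrite ler_expR ler_wpM2l// weightv_le// -[in leRHS](row_submxK z).
  exact: enorm_row_mx_gel.
have le2 : expR (la * W (rsubmx z)) <= expR (la * W z).
  rewrite ler_expR ler_wpM2l// weightv_le// -[in leRHS](row_submxK z).
  exact: enorm_row_mx_ger.
split.
  by apply: decay_mono (decay_tfshift z la0 H1) => //; rewrite ler_wpM2l.
rewrite -(row_submxK z) fourier_tfshift// row_submxK => y.
rewrite normcM normc_cis mul1r.
have := decay_tfshift (row_mx (rsubmx z) (- lsubmx z)) la0 H2.
rewrite row_mxKl => H; apply: (le_trans (H y)).
by rewrite ler_wpM2r ?expR_ge0// ler_wpM2l.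
Qed.

Lemma Aw_tfshift z f : Aw w f -> Aw w (tfshift z f).
Proof.
move=> fA; have [c1 c2 _ _] := fA.
have [d1 d2] := ccont_tfshift z (conj c1 c2).
have S la : exists M, seminorm_le w la M (tfshift z f).
  have [M HM] := Aw_seminorm hw (Num.max la 0) fA.
  have la0 : 0 <= Num.max la 0 by rewrite le_max lexx orbT.
  have [a b] := seminorm_le_tfshift z la0 (Aw_cintegrable hw fA) HM.
  exists (M * expR (Num.max la 0 * W z)); split.
    by apply: decay_mono a; rewrite // le_max lexx.
  by apply: decay_mono b; rewrite // le_max lexx.
by split => // la; have [M [a b]] := S la; exists M.
Qed.

(** Replace [f] by its inversion formula and exchange the two integrals; the inner one becomes the
    conjugate of [fourier g]. *)
Lemma parseval f g : Aw w f -> Aw w g ->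
  (fourier_cst (R := R) (n := n))%:C * bracket f g = bracket (fourier f) (fourier g).
Proof.
move=> fA gA.
have fi := Aw_cintegrable hw fA; have gi := Aw_cintegrable hw gA.
have Fi := Aw_fourier_cintegrable hw fA; have Gi := Aw_fourier_cintegrable hw gA.
pose H (p : 'rV[R]_n * 'rV[R]_n) := cis (dotv p.2 p.1) * fourier f p.2 * conjc (g p.1).
have mH : cmeas H.
  apply: cmeasM; first apply: cmeasM.
  - by apply: cmeas_cis; apply: measurable_dotv.
  - exact: (cmeas_comp (g := snd) _ (Aw_fourier_cmeas fA)).
  - by apply: cmeas_conj; exact: (cmeas_comp (g := fst) _ (Aw_cmeas gA)).
have HB y ze : normc (H (y, ze)) <= normc (g y) * normc (fourier f ze).
  by rewrite /H/= !normcM normc_cis normc_conj mul1r mulrC.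
have B1 y : 0 <= normc (g y) by exact: normc_ge0.
have B2 y : 0 <= normc (fourier f y) by exact: normc_ge0.
have := cintegral_fubini (m1 := lebn) (m2 := lebn) B1 B2
  (cintegrable_normc gi) (cintegrable_normc Fi) mH HB.
rewrite /H/= => E.
transitivity (cintegral lebn (fun y => cintegral lebn
    (fun ze => cis (dotv ze y) * fourier f ze * conjc (g y)))).
  have fgi : cintegrable lebn (fun y => f y * conjc (g y)).
    have [_ _ r _] := fA; have [M HM] := r 0.
    apply: (@le_cintegrable _ _ _ lebn _ (fun y => M * normc (g y))).
    - by apply: cmeasM; [exact: (Aw_cmeas fA)|apply: cmeas_conj; exact: (Aw_cmeas gA)].
    - move=> y; rewrite normcM normc_conj.
      exact: (ler_wpM2r (normc_ge0 (g y)) (decay_bounded HM y)).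
    - have := integrableZl measurableT M (cintegrable_normc gi).
      by apply: eq_integrable => // y _; rewrite EFinM.
  rewrite /bracket -(cintegralZ _ fgi); apply: eq_cintegral => y.
  rewrite mulrA -(fourierK hw y fA) /fourier -(cintegralZr _ (cintegrable_fourier (- y) Fi)).
  by apply: eq_cintegral => ze; rewrite dotvNr opprK.
rewrite {}E; apply: eq_cintegral => ze.
have i1 := cintegrable_fourier ze gi.
rewrite /fourier -(cintegral_conj i1) -/(fourier f ze).
have ci : cintegrable lebn (fun y => conjc (cis (- dotv y ze) * g y)).
  apply: le_cintegrable (cintegrable_normc gi).
    by apply: cmeas_conj; exact: cintegrable_cmeas i1.
  by move=> y; rewrite normc_conj normcM normc_cis mul1r.
rewrite -(cintegralZ _ ci); apply: eq_cintegral => y.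
have -> : conjc (cis (- dotv y ze) * g y) = cis (dotv y ze) * conjc (g y).
  by rewrite cisN rmorphM; congr (_ * _); exact: conjcK.
by rewrite (dotvC ze y) -mulrA mulrCA.
Qed.

(** Subadditivity gives [W (x' - x) <= W (y - x) + W (y - x')], so the two decays together yield the
    one in [x' - x]; the extra unit on [f] pays for the integral over [y]. *)
Lemma bracket_bound la : 0 <= la -> exists2 K : R, 0 < K & forall M M' x x' f g,
  0 <= M' ->
  (forall y, normc (f y) <= M * expR (- ((la + 1) * W (y - x)))) ->
  (forall y, normc (g y) <= M' * expR (- (la * W (y - x')))) ->
  normc (bracket f g) <= K * M * M' * expR (- (la * W (x' - x))).
Proof.
move=> la0; have [C C0 HC] := expRN_weightv_le_cauchy hw n.
exists (2 * C * pi ^+ n) => [|M M' x x' f g M'0 fM gM].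
  by rewrite !mulr_gt0// exprn_gt0// pi_gt0.
have M0 : 0 <= M.
  by have := le_trans (normc_ge0 _) (fM 0); rewrite pmulr_lge0// expR_gt0.
have [i1 e1] := Rintegral_shift_rV (- x) (@integrable_cauchy_rV R n).
set e := expR (- (la * W (x' - x))).
apply: (@le_trans _ _ (2 * \int[lebn]_y (M * M' * C * e * cauchy_rV (y - x)))).
  apply: normc_cintegral_le => [y|]; last first.
    have := integrableZl measurableT (M * M' * C * e) i1.
    by apply: eq_integrable => // y _; rewrite EFinM.
  rewrite normcM normc_conj.
  apply: (@le_trans _ _ (M * expR (- ((la + 1) * W (y - x))) * (M' * expR (- (la * W (y - x')))))).
    by rewrite ler_pM ?normc_ge0.
  apply: (@le_trans _ _ (M * M' * (e * expR (- W (y - x))))).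
    rewrite mulrACA ler_wpM2l ?mulr_ge0// /e -!expRD ler_expR.
    have := weightvB hw (y - x) (y - x').
    rewrite (_ : y - x - (y - x') = x' - x); last by rewrite opprB addrC addrA subrK.
    by move=> /(ler_wpM2l la0); lra.
  have := ler_wpM2l (mulr_ge0 (mulr_ge0 M0 M'0) (expR_ge0 (- (la * W (x' - x))))) (HC (y - x)).
  by rewrite -/e; congr (_ <= _); ring.
rewrite RintegralZl// e1 Rintegral_cauchy_rV le_eqVlt; apply/orP; left; apply/eqP; ring.
Qed.

(** [bracket_bound] sees only the translations. Decay in the frequency difference comes from
    Parseval's identity, since the Fourier transform makes a translation of a modulation. Both
    decays are taken at rate [2 * la]: the larger of the two weights is at least half of
    [W (z - z')]. *)
Lemma bracket_tfshift_bound la f g : 0 <= la -> Aw w f -> Aw w g ->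
  exists2 K : R, 0 < K & forall z z',
    normc (bracket (tfshift z' f) (tfshift z g)) <= K * expR (- (la * W (z - z'))).
Proof.
move=> la0 fA gA.
have la20 : 0 <= 2 * la by rewrite mulr_ge0.
have [K K0 HK] := bracket_bound la20.
have [Mf [f1 f2]] := Aw_seminorm hw (2 * la + 1) fA.
have [Mg [g1 g2]] := Aw_seminorm hw (2 * la) gA.
have Mf0 := decay_ge0 f1; have Mg0 := decay_ge0 g1.
pose c := fourier_cst (R := R) (n := n).
have c0 : 0 < c by exact: fourier_cst_gt0.
pose L := K * Mf * Mg.
have L0 : 0 <= L by rewrite !mulr_ge0// ltW.
exists (L + L / c + 1) => [|z z'].
  by rewrite ltr_wpDl// addr_ge0// divr_ge0// ltW.
have tE (h : 'rV[R]_n -> R[i]) (u : 'rV[R]_(n + n)) y : normc (tfshift u h y) = normc (h (y - lsubmx u)) by exact: normc_tfshift.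
set v := normc _.
have v1 : v <= L * expR (- (2 * la * W (lsubmx z - lsubmx z'))).
  apply: HK => [|y|y]; rewrite ?tE; [exact: Mg0|exact: f1|exact: g1].
have v2 : v <= L / c * expR (- (2 * la * W (rsubmx z - rsubmx z'))).
  have : normc (c%:C * bracket (tfshift z' f) (tfshift z g)) <=
      L * expR (- (2 * la * W (rsubmx z - rsubmx z'))).
    rewrite (parseval (Aw_tfshift z' fA) (Aw_tfshift z gA)).
    rewrite -[z in tfshift z g](row_submxK z) -[z' in tfshift z' f](row_submxK z').
    rewrite (fourier_tfshift _ _ (Aw_cintegrable hw fA)) (fourier_tfshift _ _ (Aw_cintegrable hw gA)).
    apply: HK => [|y|y]; rewrite ?normcM ?normc_cis ?mul1r ?tE ?row_mxKl; [exact: Mg0|exact: f2|exact: g2].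
  rewrite normcM normc_real (gtr0_norm c0) -/v => H.
  rewrite mulrAC (ler_pdivlMr _ _ c0) mulrC; exact: H.
clear HK f1 f2 g1 g2 tE.
have WW : W (z - z') <= W (lsubmx z - lsubmx z') + W (rsubmx z - rsubmx z').
  apply: (weightv_le_add hw); rewrite -{1}(row_submxK z) -{1}(row_submxK z').
  by rewrite opp_row_mx add_row_mx; exact: enorm_row_mx_le.
have W1 := weightv_ge0 hw (lsubmx z - lsubmx z').
have W2 := weightv_ge0 hw (rsubmx z - rsubmx z').
have [le|/ltW le] := leP (W (rsubmx z - rsubmx z')) (W (lsubmx z - lsubmx z')).
- apply: (le_trans v1); rewrite ler_pM ?expR_ge0//.
    have : 0 <= L / c by rewrite divr_ge0// ltW.
    lra.
  rewrite ler_expR lerN2 (le_trans (ler_wpM2l la0 WW))//.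
  by have := ler_wpM2l la0 le; lra.
- apply: (le_trans v2); rewrite ler_pM ?expR_ge0//.
  + by rewrite divr_ge0// ltW.
  + lra.
  rewrite ler_expR lerN2 (le_trans (ler_wpM2l la0 WW))//.
  by have := ler_wpM2l la0 le; lra.
Qed.

End time_frequency_shifts.

Section product_sigma_finite.
Context {d1 d2} {T1 : measurableType d1} {T2 : measurableType d2} {R : realType}.
Variables (m1 : {sigma_finite_measure set T1 -> \bar R})
  (m2 : {sigma_finite_measure set T2 -> \bar R}).

Let product_sigma_finite : sigma_finite setT (m1 \x m2)%E.
Proof.
have /sigma_finiteP[F [TF ndF Foo]] := sigma_finiteT m1.
have /sigma_finiteP[G [TG ndG Goo]] := sigma_finiteT m2.
exists (fun k => F k `*` G k).
  rewrite -setXTT TF TG predeqE => -[x y]; split=> [|[k _ []/= ? ?]].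
    move=> [/= [i _ Fix] [j _ Gjy]]; exists (maxn i j) => //; split.
    - by move: x Fix; exact/subsetPset/ndF/leq_maxl.
    - by move: y Gjy; exact/subsetPset/ndG/leq_maxr.
  by split; exists k.
move=> k; have [mF Fk] := Foo k; have [mG Gk] := Goo k; split.
  exact: measurableX.
by rewrite product_measure1E// lte_mul_pinfty// ge0_fin_numE.
Qed.

(** This packaging lets phase space be one of the two factors in Fubini's theorem, as in
    [fourier_reconstruction]. *)
Definition sigma_finite_product : {sigma_finite_measure set (T1 * T2)%type -> \bar R} :=
  HB.pack (m1 \x m2)%E (Measure_isSigmaFinite.Build _ _ _ (m1 \x m2)%E product_sigma_finite).

End product_sigma_finite.

(** * Reconstruction from the short-time Fourier transform *)

Section reconstruction.
Context {R : realType} (w : R -> R) (hw : weight_function w) {n : nat}.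
Local Notation lebn := (@lebesgue_rV R n).
Local Notation lebnn := (@sigma_finite_product _ _ _ _ R (@lebesgue_rV R n) (@lebesgue_rV R n)).
Local Notation W := (weightv w).
Local Notation phase := ('rV[R]_n * 'rV[R]_n)%type.
Local Open Scope complex_scope.
Variables (g phi : 'rV[R]_n -> R[i]).
Hypotheses (gA : Aw w g) (phiA : Aw w phi).

(** Reconstruction integrates over pairs [(x, xi)] with the product measure, where Fubini applies at
    once, while [locop] integrates over ['rV_(n + n)]. The two measures are never compared:
    reconstruction enters the final argument only through a bound. *)
Definition pt (p : phase) : 'rV[R]_(n + n) := row_mx p.1 p.2.

(** The short-time Fourier transform of [g] with window [phi]. *)
Definition coef (p : phase) : R[i] := bracket g (tfshift (pt p) phi).

Lemma measurable_rV_sub d (T : measurableType d) (f h : T -> 'rV[R]_n) :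
  measurable_fun setT f -> measurable_fun setT h ->
  measurable_fun setT (fun t => f t - h t).
Proof.
move=> mf mh; apply: measurable_fun_rV => i.
rewrite (_ : (fun _ => _) = (fun t => f t 0 i - h t 0 i)); last by apply/funext => t; rewrite !mxE.
apply: measurable_funB.
- exact: (measurableT_comp (measurable_coord i) mf).
- exact: (measurableT_comp (measurable_coord i) mh).
Qed.

Lemma cmeas_tfshift (f : 'rV[R]_n -> R[i]) :
  cmeas f -> cmeas (fun q : phase * 'rV[R]_n => tfshift (pt q.1) f q.2).
Proof.
move=> mf; rewrite (_ : (fun _ => _) =
  (fun q : phase * 'rV[R]_n => cis (dotv q.2 q.1.2) * f (q.2 - q.1.1))); last first.
  by apply/funext => q; rewrite tfshift_row.
have m1 : measurable_fun setT (fun q : phase * 'rV[R]_n => q.1.1).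
  exact: (measurableT_comp (measurable_fst) (measurable_fst)).
have m2 : measurable_fun setT (fun q : phase * 'rV[R]_n => q.1.2).
  exact: (measurableT_comp (measurable_snd) (measurable_fst)).
apply: cmeasM; first by apply: cmeas_cis; apply: measurable_dotv.
apply: (cmeas_comp (g := fun q : phase * 'rV[R]_n => q.2 - q.1.1) _ mf).
exact: measurable_rV_sub.
Qed.

Lemma cmeas_coef : cmeas coef.
Proof.
apply: (@cmeas_cintegral _ _ _ _ _ lebn
  (fun q : phase * 'rV[R]_n => g q.2 * conjc (tfshift (pt q.1) phi q.2))).
apply: cmeasM; first exact: (cmeas_comp (g := snd) _ (Aw_cmeas gA)).
by apply: cmeas_conj; apply: cmeas_tfshift; exact: Aw_cmeas phiA.
Qed.

Lemma coef_decay la : 0 <= la ->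
  exists2 K : R, 0 < K & forall p, normc (coef p) <= K * expR (- (la * W (pt p))).
Proof.
move=> la0; have [K K0 H] := bracket_tfshift_bound hw la0 gA phiA.
exists K => // p; have := H (pt p) 0; rewrite subr0.
suff -> : tfshift 0 g = g by [].
apply/funext => y; rewrite -(row_submxK 0) tfshift_row.
have -> : lsubmx (0 : 'rV[R]_(n + n)) = 0 by apply/rowP => i; rewrite !mxE.
have -> : rsubmx (0 : 'rV[R]_(n + n)) = 0 by apply/rowP => i; rewrite !mxE.
by rewrite subr0 -(scale0r (0 : 'rV[R]_n)) dotvZr mul0r cis0 mul1r.
Qed.

Lemma weightv_pt_ge (p : phase) : W p.1 <= W (pt p) /\ W p.2 <= W (pt p).
Proof.
by split; apply: (weightv_le hw); [exact: enorm_row_mx_gel|exact: enorm_row_mx_ger].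
Qed.

Lemma expRN_weightv_pt_le : exists2 C : R, 0 < C & forall p : phase,
  expR (- (2 * W (pt p))) <= C * (cauchy_rV p.1 * cauchy_rV p.2).
Proof.
have [C C0 H] := expRN_weightv_le_cauchy hw n.
exists (C * C) => [|p]; first exact: mulr_gt0.
have [W1 W2] := weightv_pt_ge p.
apply: (@le_trans _ _ (expR (- W p.1) * expR (- W p.2))).
  by rewrite -expRD ler_expR; lra.
by rewrite mulrACA; apply: ler_pM; rewrite ?expR_ge0.
Qed.

(* The product [g(y) conj(phi(y - x))], whose Fourier transform is
   [coef (x, .)]. *)
Let slice x : 'rV[R]_n -> R[i] := fun y => g y * conjc (phi (y - x)).

Let fourier_slice x xi : fourier (slice x) xi = coef (x, xi).
Proof.
apply: eq_cintegral => y; rewrite /slice /pt tfshift_row.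
have -> : conjc (cis (dotv y xi) * phi (y - x)) = cis (- dotv y xi) * conjc (phi (y - x)).
  by rewrite cisN rmorphM.
by rewrite mulrCA.
Qed.

(** Decay of the product itself comes from [g], as [phi] is bounded. Decay of its Fourier transform
    is that of [coef (x, .)], already known from [coef_decay]. *)
Let Aw_slice x : Aw w (slice x).
Proof.
have [g1 g2 g3 _] := gA; have [p1 p2 p3 _] := phiA.
have [c1 c2] := ccontM (conj g1 g2) (ccont_conj (ccont_shift x (conj p1 p2))).
have [M0 HM0] := p3 0.
split => //.
- move=> la; have [M HM] := g3 la; exists (M * M0) => y.
  rewrite normcM normc_conj mulrAC; apply: ler_pM; rewrite ?normc_ge0//.
  exact: (decay_bounded HM0).
- apply: rapid_of_pos => // la la0; have [K K0 H] := coef_decay (ltW la0).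
  exists K => xi; rewrite fourier_slice; apply: (le_trans (H _)).
  rewrite ler_pM2l// ler_expR lerN2 ler_pM2l//.
  by have [_] := weightv_pt_ge (x, xi).
Qed.

Definition recon_cst : R[i] := (fourier_cst (R := R) (n := n))%:C * bracket phi phi.

Lemma coef_cauchy la : 0 <= la -> exists2 C : R, 0 < C & forall p,
  normc (coef p) * expR (la * W (pt p)) <= C * (cauchy_rV p.1 * cauchy_rV p.2).
Proof.
move=> la0; have [K K0 HK] := coef_decay (addr_ge0 la0 (ler0n _ 2)).
have [C C0 HC] := expRN_weightv_pt_le.
exists (K * C) => [|p]; first exact: mulr_gt0.
apply: (@le_trans _ _ (K * expR (- ((la + 2) * W (pt p))) * expR (la * W (pt p)))).
  by rewrite ler_wpM2r ?expR_ge0//; exact: HK.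
rewrite -mulrA -expRD -mulrA ler_pM2l//; apply: le_trans (HC p).
by rewrite ler_expR; lra.
Qed.

Lemma coef_le_cauchy : exists2 C : R, 0 < C & forall p,
  normc (coef p) <= C * (cauchy_rV p.1 * cauchy_rV p.2).
Proof.
have [C C0 H] := coef_cauchy (lexx 0); exists C => // p.
by have := H p; rewrite mul0r expR0 mulr1.
Qed.

Lemma integrable_cauchy2 : lebnn.-integrable setT
  (fun p : phase => (cauchy_rV p.1 * cauchy_rV p.2)%:E) /\
  \int[lebnn]_p (cauchy_rV p.1 * cauchy_rV p.2) = pi ^+ n * pi ^+ n.
Proof.
have := integrable_prod (@cauchy_rV_ge0 R n) (@cauchy_rV_ge0 R n)
  (@integrable_cauchy_rV R n) (@integrable_cauchy_rV R n).
by rewrite Rintegral_cauchy_rV.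
Qed.

(** For fixed [x], the integral over [xi] is Fourier inversion for [slice x] and gives a multiple of
    [g y] times [|phi (y - x)| ^+ 2]. The integral over [x] then produces [bracket phi phi]. *)
Lemma reconstruction y :
  cintegral lebnn (fun p => coef p * tfshift (pt p) phi y) = recon_cst * g y.
Proof.
have [C C0 HC] := coef_le_cauchy.
have [_ _ p3 _] := phiA; have [M HM] := p3 0.
have M0 := decay_ge0 HM.
have B1 (x : 'rV[R]_n) : 0 <= C * M * cauchy_rV x.
  by rewrite !mulr_ge0 ?cauchy_rV_ge0// ltW.
have i1 : lebn.-integrable setT (fun x => (C * M * cauchy_rV x)%:E).
  have := integrableZl measurableT (C * M) (@integrable_cauchy_rV R n).
  by apply: eq_integrable => // x _; rewrite EFinM.
have mF : cmeas (fun p : phase => coef p * tfshift (pt p) phi y).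
  apply: cmeasM; first exact: cmeas_coef.
  exact: (cmeas_pair1 y (cmeas_tfshift (Aw_cmeas phiA))).
have FB x xi : normc (coef (x, xi) * tfshift (pt (x, xi)) phi y) <=
    C * M * cauchy_rV x * cauchy_rV xi.
  rewrite normcM normc_tfshift.
  have := ler_pM (normc_ge0 _) (normc_ge0 _) (HC (x, xi)) (decay_bounded HM (y - lsubmx (pt (x, xi)))).
  by move/le_trans; apply; rewrite le_eqVlt; apply/orP; left; apply/eqP => /=; ring.
rewrite (cintegral_prod12 (m1 := lebn) (m2 := lebn) B1 (@cauchy_rV_ge0 R n) i1
  (@integrable_cauchy_rV R n) mF FB).
pose c := (fourier_cst (R := R) (n := n))%:C.
pose b t := phi t * conjc (phi t).
have bi : cintegrable lebn b.
  apply: (@le_cintegrable _ _ _ lebn _ (fun y => M * normc (phi y))).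
  - by apply: cmeasM; [exact: (Aw_cmeas phiA)|apply: cmeas_conj; exact: (Aw_cmeas phiA)].
  - move=> t; rewrite /b normcM normc_conj.
    exact: (ler_wpM2r (normc_ge0 (phi t)) (decay_bounded HM t)).
  - have := integrableZl measurableT M (cintegrable_normc (Aw_cintegrable hw phiA)).
    by apply: eq_integrable => // t _; rewrite EFinM.
have [ib eb] := cintegral_opp_rV y bi.
transitivity (cintegral lebn (fun x => (c * g y) * b (y - x))).
  apply: eq_cintegral => x.
  have sA := Aw_slice x.
  have -> : c * g y * b (y - x) = fourier (fourier (slice x)) (- y) * phi (y - x).
    by rewrite (fourierK hw y sA) /slice /b -/c; ring.
  rewrite -(cintegralZr _ (cintegrable_fourier (- y) (Aw_fourier_cintegrable hw sA))).
  apply: eq_cintegral => xi.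
  by rewrite fourier_slice /pt tfshift_row dotvNr opprK (dotvC xi y); ring.
by rewrite (cintegralZ _ ib) eb /recon_cst -/c -/b mulrAC.
Qed.

(** The Fourier half of the seminorm of the Riemann error needs this version. It is obtained from
    [reconstruction] by Fubini in [p] and [y]; decay of [phi (y - p.1)] in [y] costs
    [expR (W (pt p))], which [coef] absorbs. *)
Lemma fourier_reconstruction eta :
  cintegral lebnn (fun p => coef p * fourier (tfshift (pt p) phi) eta) =
  recon_cst * fourier g eta.
Proof.
have [C C0 HC] := coef_cauchy (ler01 (R := R)).
have [C' C'0 HC'] := expRN_weightv_le_cauchy hw n.
have [_ _ p3 _] := phiA; have [M HM] := p3 1.
have M0 := decay_ge0 HM.
have [i1 _] := integrable_cauchy2.
pose F (q : phase * 'rV[R]_n) := coef q.1 * (cis (- dotv q.2 eta) * tfshift (pt q.1) phi q.2).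
have mt := cmeas_tfshift (Aw_cmeas phiA).
have mF : cmeas F.
  apply: cmeasM; first exact: (cmeas_comp (g := fst) _ cmeas_coef).
  apply: cmeasM; last exact: mt.
  apply: cmeas_cis; apply: measurable_funN; apply: measurable_dotv => //.
have B1 (p : phase) : 0 <= cauchy_rV p.1 * cauchy_rV p.2 by rewrite mulr_ge0 ?cauchy_rV_ge0.
have K0 : 0 <= C * M * C' by rewrite !mulr_ge0// ltW.
have B2 (y : 'rV[R]_n) : 0 <= C * M * C' * cauchy_rV y by rewrite mulr_ge0 ?cauchy_rV_ge0.
have i2 : lebn.-integrable setT (fun y => (C * M * C' * cauchy_rV y)%:E).
  have := integrableZl measurableT (C * M * C') (@integrable_cauchy_rV R n).
  by apply: eq_integrable => // x _; rewrite EFinM.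
have FB p y : normc (F (p, y)) <= cauchy_rV p.1 * cauchy_rV p.2 * (C * M * C' * cauchy_rV y).
  rewrite /F 2!normcM normc_cis mul1r normc_tfshift /= row_mxKl.
  have h1 : normc (phi (y - p.1)) <= M * (expR (W (pt p)) * (C' * cauchy_rV y)).
    apply: (le_trans (HM _)); rewrite ler_wpM2l// mul1r.
    apply: (@le_trans _ _ (expR (W (pt p)) * expR (- W y))).
      rewrite -expRD ler_expR; have [+ _] := weightv_pt_ge p.
      have := weightv_triangle hw y p.1; lra.
    by rewrite ler_wpM2l ?expR_ge0.
  apply: (@le_trans _ _ (normc (coef p) * (M * (expR (W (pt p)) * (C' * cauchy_rV y))))).
    by rewrite ler_wpM2l ?normc_ge0.
  have := HC p; rewrite mul1r => /(ler_wpM2r (mulr_ge0 M0 (mulr_ge0 (ltW C'0) (cauchy_rV_ge0 y)))).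
  by congr (_ <= _); ring.
have := cintegral_fubini (m1 := lebnn) (m2 := lebn) B1 B2 i1 i2 mF FB.
rewrite /F/= => E.
transitivity (cintegral lebnn (fun x : phase => cintegral lebn (fun y : 'rV[R]_n =>
    coef x * (cis (- dotv y eta) * tfshift (pt x) phi y)))).
  apply: eq_cintegral => p.
  by rewrite -(cintegralZ _ (cintegrable_fourier eta (Aw_cintegrable hw (Aw_tfshift hw (pt p) phiA)))).
rewrite {}E /fourier -(cintegralZ _ (cintegrable_fourier eta (Aw_cintegrable hw gA))).
apply: eq_cintegral => y.
have ir : cintegrable lebnn (fun p => coef p * tfshift (pt p) phi y).
  have := cintegrableZ (cis (dotv y eta)) (cintegrable_dom_pair1 (m1 := lebnn) i1 mF FB y).
  congr cintegrable; apply/funext => p; rewrite /F/= mulrCA; congr (_ * _).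
  by rewrite mulrA cisK mul1r.
rewrite mulrCA -reconstruction -(cintegralZ _ ir).
by apply: eq_cintegral => p; rewrite mulrCA.
Qed.

End reconstruction.

(** * Nonvanishing of the reconstruction constant *)

Section nonzero_window.
Context {R : realType} (w : R -> R) (hw : weight_function w) {n : nat}.
Local Notation lebn := (@lebesgue_rV R n).
Local Open Scope complex_scope.

(** The integral of [|phi| ^+ 2] vanishes, so [phi] is 0 almost everywhere. Hence its Fourier
    transform is 0 everywhere, and Fourier inversion recovers [phi = 0] at every point. *)
Lemma bracket_self_eq0 (phi : 'rV[R]_n -> R[i]) : Aw w phi -> bracket phi phi = 0 ->
  forall y, phi y = 0.
Proof.
move=> phiA b0.
have phii := Aw_cintegrable hw phiA.
have [_ _ p3 _] := phiA; have [M HM] := p3 0.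
have mn := cmeas_normc (Aw_cmeas phiA).
have mn2 : measurable_fun setT (fun x => (normc (phi x) ^+ 2)%:E).
  by apply/measurable_EFinP; exact: measurable_funX.
have i2 : lebn.-integrable setT (fun x => (normc (phi x) ^+ 2)%:E).
  have := integrableZl measurableT M (cintegrable_normc phii).
  apply: le_integrable => // x _ /=; rewrite lee_fin.
  rewrite ger0_norm ?exprn_ge0 ?normc_ge0// ger0_norm; last first.
    by rewrite mulr_ge0 ?normc_ge0// (decay_ge0 HM).
  by rewrite expr2; exact: (ler_wpM2r (normc_ge0 (phi x)) (decay_bounded HM x)).
have I0 : (\int[lebn]_x `|(normc (phi x) ^+ 2)%:E| = 0)%E.
  have := b0; rewrite /bracket.
  rewrite (eq_cintegral lebn (g := fun x => (normc (phi x) ^+ 2)%:C)); last first.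
    by move=> x; exact: mul_conjc.
  rewrite cintegral_real => /(congr1 (@complex.Re R))/= h.
  transitivity (\int[lebn]_x (normc (phi x) ^+ 2)%:E)%E.
    by apply: eq_integral => x _; rewrite /= ger0_norm// exprn_ge0// normc_ge0.
  by rewrite -(fineK (integrable_fin_num measurableT i2)) -/(Rintegral _ _ _) h.
have ae0 : ae_eq lebn setT (fun x => (normc (phi x) ^+ 2)%:E) (cst 0%E).
  exact/(ae_eq_integral_abs lebn measurableT mn2).
have F0 xi : fourier phi xi = 0.
  have [j1 j2] := cintegrable_fourier xi phii.
  have Z (h : 'rV[R]_n -> R) : lebn.-integrable setT (fun x => (h x)%:E) ->
      (forall x, `|h x| <= normc (phi x)) -> \int[lebn]_x h x = 0.
    move=> ih hx; rewrite /Rintegral (@ae_eq_integral _ _ _ lebn setT (cst 0%E)) ?integral0//.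
      exact: measurable_int ih.
    apply: filterS ae0 => x /= H _; have := H Logic.I; move/eqP.
    rewrite eqe sqrf_eq0 => /eqP px; have := hx x.
    by rewrite px normr_le0 => /eqP ->.
  rewrite /fourier /cintegral; congr (_ +i* _); apply: Z => // x.
    by apply: le_trans (Re_le_normc _) _; rewrite normcM normc_cis mul1r.
  by apply: le_trans (Im_le_normc _) _; rewrite normcM normc_cis mul1r.
move=> y; have := fourierK hw y phiA.
have -> : fourier phi = (fun _ => 0) by apply/funext.
rewrite fourier0 => /esym/eqP; rewrite mulf_eq0 (negbTE (fourier_cst_neq0 (R := R) (n := n)))/=.
by move/eqP.
Qed.

Lemma recon_cst_neq0 (phi : 'rV[R]_n -> R[i]) : Aw w phi -> phi <> cst 0 ->
  recon_cst phi != 0.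
Proof.
move=> phiA phi0; rewrite mulf_neq0 ?fourier_cst_neq0//.
apply/eqP => /(bracket_self_eq0 phiA) H; apply: phi0.
exact/funext.
Qed.

End nonzero_window.

(** The mesh is of order [1 / N.+1 ^+ 2] because [decay_tfshift_sub] loses a square root: points at
    distance [e ^+ 2] give shifts that differ by order [e]. The cells cover a box growing with [N],
    and the decay of [coef] takes care of the rest. *)
Lemma rV_grid (R : realType) (m N : nat) :
  exists (J : finType) (zp : J -> 'rV[R]_m) (ind : J -> 'rV[R]_m -> bool),
  [/\ forall j, measurable [set z | ind j z],
      forall j z, ind j z -> enorm (z - zp j) <= m%:R / N.+1%:R ^+ 2,
      forall z j j', ind j z -> ind j' z -> j = j' &
      forall z : 'rV[R]_m, (forall i, `|z 0 i| < N.+1%:R) -> exists j, ind j z].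
Proof.
(* Cells have side [1 / s]. For coordinates below [N.+1] in absolute value, the floors of
   [s * z 0 i] lie between [- L] and [L], as [L = s * N.+1]; hence [2 * L + 1] indices per
   coordinate. *)
pose s : R := N.+1%:R ^+ 2; pose L := (N.+1 ^ 3)%N.
have s0 : 0 < s by rewrite exprn_gt0// ltr0n.
pose J : finType := {ffun 'I_m -> 'I_(2 * L).+1}.
pose fl (j : J) (i : 'I_m) : int := (j i)%:Z - L%:Z.
exists J, (fun j => \row_i ((fl j i)%:~R / s)),
  (fun j z => [forall i, Num.floor (s * z 0 i) == fl j i]).
split.
- move=> j; have := measurable_floor_coord s (\row_i fl j i).
  congr measurable; apply/seteqP; split => z /=.
    by move=> H; apply/forallP => i; apply/eqP; rewrite H mxE.
  by move=> /forallP H i; rewrite mxE; exact/eqP/H.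
- move=> j z /forallP H; apply: (le_trans (enorm_le_sum _)).
  apply: (@le_trans _ _ (\sum_(i < m) s^-1)); last first.
    by rewrite sumr_const card_ord mulr_natl.
  apply: ler_sum => i _; rewrite !mxE -(eqP (H i)).
  have h1 := floor_le (s * z 0 i); have h2 := floorD1_gt (s * z 0 i).
  rewrite intrD in h2.
  have -> : z 0 i - (Num.floor (s * z 0 i))%:~R / s = (s * z 0 i - (Num.floor (s * z 0 i))%:~R) / s.
    by field; rewrite gt_eqF.
  rewrite ger0_norm; last by rewrite divr_ge0 ?subr_ge0// ltW.
  by rewrite -[leRHS]mul1r ler_pM2r ?invr_gt0//; lra.
- move=> z j j' /forallP H /forallP H'; apply/ffunP => i; apply/val_inj => /=.
  have := eqP (H i); rewrite (eqP (H' i)) /fl => /addIr [].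
  by [].
- move=> z zN.
  exists [ffun i => inord (absz (Num.floor (s * z 0 i) + L%:Z))].
  apply/forallP => i; rewrite /fl ffunE.
  have LE : (L%:Z)%:~R = s * N.+1%:R :> R by rewrite /L /s -pmulrn natrX -exprSr.
  have := zN i; rewrite ltr_norml => /andP[z1 z2].
  have f1 : - L%:Z <= Num.floor (s * z 0 i).
    by rewrite floor_ge_int mulrNz LE -mulrN ler_pM2l// ltW.
  have f2 : Num.floor (s * z 0 i) < L%:Z by rewrite floor_lt_int LE ltr_pM2l.
  have f0 : 0 <= Num.floor (s * z 0 i) + L%:Z by lra.
  have af : (absz (Num.floor (s * z 0 i) + L%:Z))%:Z = Num.floor (s * z 0 i) + L%:Z.
    by rewrite gez0_abs.
  rewrite inordK; first by rewrite af addrK.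
  rewrite ltnS -lez_nat af mul2n -addnn PoszD; lra.
Qed.

(** * Riemann sums of the reconstruction formula *)

Section shift_modulus.
Context {R : realType} (w : R -> R) (hw : weight_function w) {n : nat}.
Local Notation lebn := (@lebesgue_rV R n).
Local Notation W := (weightv w).
Local Open Scope complex_scope.
Implicit Types (f : 'rV[R]_n -> R[i]).

Lemma normc_cisB (s t : R) : normc (cis s - cis t) <= 2 * `|s - t|.
Proof.
have -> : cis s - cis t = cis t * (cis (s - t) - 1).
  by rewrite mulrBr mulr1 -cisD; congr (cis _ - _); ring.
by rewrite normcM normc_cis mul1r cis_taylor1.
Qed.

(** [f] is the Fourier transform of [inv_density f], to which [fourier_lipschitz] applies. *)
Lemma Aw_lipschitz f : Aw w f -> exists2 L : R, 0 < L &
  forall x y, normc (f x - f y) <= L * enorm (x - y).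
Proof.
move=> fA; have [K K0 H] := fourier_lipschitz hw (n := n).
have rh := rapid_inv_density fA; have [M HM] := rh 2.
have M0 := decay_ge0 HM.
exists (K * (M + 1)) => [|x y]; first by rewrite mulr_gt0//; lra.
rewrite -(fourier_inv_density hw fA).
apply: (le_trans (H _ _ (cmeas_inv_density fA) rh HM x y)).
by rewrite ler_wpM2r ?enorm_ge0// ler_wpM2l ?(ltW K0)//; lra.
Qed.

Lemma weightv_near p (x x' : 'rV[R]_p) : enorm (x - x') <= 1 -> W x' <= W x + w 1.
Proof.
move=> xx'; have := weightv_triangle hw x' x; rewrite addrC => /le_trans; apply.
rewrite lerD2l -[W _](weightvN w) opprB.
by apply: (weight_nondecreasing hw) => //; exact: enorm_ge0.
Qed.

(* The geometric mean of a weightless Lipschitz bound and of the decay of [f]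
   at the doubled rate. *)
Lemma decay_tfshift_sub la f : 0 <= la -> Aw w f -> exists2 C : R, 0 < C &
  forall x xi x' xi' e, 0 < e -> e <= 1 ->
    enorm (x - x') <= e ^+ 2 -> enorm (xi - xi') <= e ^+ 2 ->
    decay w la (C * e * expR ((la + 1) * W x))
      (fun y => tfshift (row_mx x xi) f y - tfshift (row_mx x' xi') f y).
Proof.
move=> la0 fA; have la20 : 0 <= 2 * la by rewrite mulr_ge0.
have [L L0 HL] := Aw_lipschitz fA.
have [Cw Cw0 HCw] := enorm_le_expR hw n 1.
have [_ _ r _] := fA; have [M HM] := r 1; have [M2 HM2] := r (2 * la).
have M0 := decay_ge0 HM; have M20 := decay_ge0 HM2.
pose A1 := 4 * Cw * M + L; pose A2 := M2 * (1 + expR (2 * la * w 1)).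
have A10 : 0 <= A1 by rewrite addr_ge0 ?mulr_ge0// ltW.
have A20 : 0 <= A2 by rewrite mulr_ge0// addr_ge0 ?expR_ge0.
exists (A1 + A2 + 1) => [|x xi x' xi' e e0 e1 xx xixi y]; first by lra.
have ee1 : e ^+ 2 <= 1 by rewrite exprn_ile1// ltW.
set a := normc _; have a0 : 0 <= a by exact: normc_ge0.
have b1 : a <= A1 * e ^+ 2 * expR (W x).
  rewrite /a !tfshift_row.
  have -> : cis (dotv y xi) * f (y - x) - cis (dotv y xi') * f (y - x') =
     (cis (dotv y xi) - cis (dotv y xi')) * f (y - x) + cis (dotv y xi') * (f (y - x) - f (y - x')) by ring.
  apply: (le_trans (normcD _ _)); rewrite !normcM normc_cis mul1r.
  have e1W : 1 <= expR (W x) by rewrite -expR0 ler_expR weightv_ge0.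
  have t2 : normc (f (y - x) - f (y - x')) <= L * e ^+ 2 * expR (W x).
    apply: (le_trans (HL _ _)).
    have -> : y - x - (y - x') = - (x - x') by apply/rowP => i; rewrite !mxE; ring.
    by rewrite enormN -mulrA ler_pM2l// (le_trans xx)// ler_peMr// sqr_ge0.
  have t1 : normc (cis (dotv y xi) - cis (dotv y xi')) * normc (f (y - x)) <=
      4 * Cw * M * e ^+ 2 * expR (W x).
    (* The difference of phases costs [|y| * e ^+ 2]. In [|y| <= |y - x| + |x|], the first term is
       absorbed by the decay of [f (y - x)], the second by [expR (W x)]. *)
    have d1 : normc (cis (dotv y xi) - cis (dotv y xi')) <= 2 * ((enorm (y - x) + enorm x) * e ^+ 2).
      apply: (le_trans (normc_cisB _ _)); rewrite ler_pM2l// -dotvBr.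
      apply: (le_trans (dotv_le _ _)); rewrite ler_pM ?enorm_ge0//.
      by rewrite -{1}(subrK x y) enormD.
    apply: (le_trans (ler_wpM2r (normc_ge0 _) d1)).
    have s1 : enorm (y - x) * normc (f (y - x)) <= Cw * M.
      apply: (@le_trans _ _ (Cw * expR (W (y - x)) * (M * expR (- (1 * W (y - x)))))).
        apply: ler_pM; [exact: enorm_ge0|exact: normc_ge0|exact: HCw|exact: HM].
      by rewrite mul1r mulrACA -expRD subrr expR0 mulr1.
    have s2 : enorm x * normc (f (y - x)) <= Cw * M * expR (W x).
      rewrite mulrAC; apply: ler_pM; [exact: enorm_ge0|exact: normc_ge0|exact: HCw|].
      apply: (le_trans (HM _)); rewrite ler_piMr// expR_le1 mul1r oppr_le0 weightv_ge0//.
    have s3 : Cw * M <= Cw * M * expR (W x) by rewrite ler_peMr// mulr_ge0// ltW.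
    have -> : 2 * ((enorm (y - x) + enorm x) * e ^+ 2) * normc (f (y - x)) =
      e ^+ 2 * (2 * (enorm (y - x) * normc (f (y - x)) + enorm x * normc (f (y - x)))) by ring.
    have -> : 4 * Cw * M * e ^+ 2 * expR (W x) = e ^+ 2 * (4 * (Cw * M * expR (W x))) by ring.
    by rewrite ler_wpM2l ?sqr_ge0//; lra.
  by rewrite /A1 2!mulrDl; apply: lerD.
have b2 : a <= A2 * expR (2 * la * W x) * expR (- (2 * la * W y)).
  apply: (le_trans (normcB _ _)).
  have h1 := decay_tfshift hw (row_mx x xi) la20 HM2 y.
  have h2 := decay_tfshift hw (row_mx x' xi') la20 HM2 y.
  rewrite !row_mxKl in h1 h2.
  have h3 : expR (2 * la * W x') <= expR (2 * la * w 1) * expR (2 * la * W x).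
    rewrite -expRD ler_expR.
    have := ler_wpM2l la20 (weightv_near (le_trans xx ee1)); lra.
  apply: (le_trans (lerD h1 h2)); rewrite -mulrDl ler_wpM2r ?expR_ge0//.
  rewrite (_ : A2 * _ = M2 * expR (2 * la * W x) + M2 * (expR (2 * la * w 1) * expR (2 * la * W x))).
    by rewrite lerD2l ler_wpM2l.
  by rewrite /A2; ring.
(* The square of [a] is bounded by the product of [b1] and [b2]: taking roots, [e ^+ 2] becomes [e],
   the rate [2 * la] becomes [la], and the growth [(2 * la + 1) * W x] stays below twice
   [(la + 1) * W x]. *)
rewrite -ler_sqr ?nnegrE//; last first.
  by rewrite mulr_ge0 ?expR_ge0// mulr_ge0 ?expR_ge0// mulr_ge0 ?(ltW e0)//; lra.
rewrite expr2; apply: (le_trans (ler_pM a0 a0 b1 b2)).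
have W0 := weightv_ge0 hw x.
have -> : A1 * e ^+ 2 * expR (W x) * (A2 * expR (2 * la * W x) * expR (- (2 * la * W y))) =
  (A1 * A2) * (e ^+ 2 * (expR (W x) * expR (2 * la * W x) * expR (- (2 * la * W y)))) by ring.
have -> : ((A1 + A2 + 1) * e * expR ((la + 1) * W x) * expR (- (la * W y))) ^+ 2 =
  (A1 + A2 + 1) ^+ 2 * (e ^+ 2 * (expR ((la + 1) * W x) ^+ 2 * expR (- (la * W y)) ^+ 2)) by ring.
apply: ler_pM; [exact: mulr_ge0|by rewrite mulr_ge0 ?sqr_ge0// mulr_ge0 ?expR_ge0// mulr_ge0 ?expR_ge0| |].
  rewrite sqrrD1 sqrrD; have := sqr_ge0 A1; have := sqr_ge0 A2; have := mulr_ge0 A10 A20; lra.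
rewrite ler_wpM2l ?sqr_ge0// -!expRM_natl -!expRD ler_expR; lra.
Qed.

(** On the Fourier side the shift by [(x, xi)] becomes the one by [(xi, - x)], so
    [decay_tfshift_sub] applies to [fourier f]. The phase [cis (dotv x xi)] also varies with the
    point; its variation is the source of the constant [B]. *)
Lemma tfshift_modulus la f : 0 <= la -> Aw w f -> exists2 C : R, 0 < C &
  forall z z' e, 0 < e -> e <= 1 -> enorm (z - z') <= e ^+ 2 ->
    seminorm_le w la (C * e * expR ((la + 1) * W z))
      (fun y => tfshift z f y - tfshift z' f y).
Proof.
move=> la0 fA; have FA := Aw_fourier hw fA.
have [C C0 HC] := decay_tfshift_sub la0 fA.
have [C' C'0 HC'] := decay_tfshift_sub la0 FA.
have [Cw Cw0 HCw] := enorm_le_expR hw n 1.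
have [_ _ r _] := FA; have [M HM] := r la; have M0 := decay_ge0 HM.
pose B := 2 * (2 * Cw + 1) * (M * expR (la * w 1)).
have B0 : 0 <= B by rewrite !mulr_ge0 ?expR_ge0// addr_ge0// mulr_ge0// ltW.
exists (C + C' + B) => [|z z' e e0 e1 zz]; first by rewrite ltr_wpDr// addr_gt0.
have ee1 : e ^+ 2 <= 1 by rewrite exprn_ile1// ltW.
set x := lsubmx z; set xi := rsubmx z; set x' := lsubmx z'; set xi' := rsubmx z'.
have zE : z = row_mx x xi by rewrite row_submxK.
have z'E : z' = row_mx x' xi' by rewrite row_submxK.
have zz' : z - z' = row_mx (x - x') (xi - xi') by rewrite zE z'E opp_row_mx add_row_mx.
have xx : enorm (x - x') <= e ^+ 2 by apply: le_trans zz; rewrite zz' enorm_row_mx_gel.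
have xixi : enorm (xi - xi') <= e ^+ 2 by apply: le_trans zz; rewrite zz' enorm_row_mx_ger.
have Wx : W x <= W z by rewrite zE; apply: (weightv_le hw); exact: enorm_row_mx_gel.
have Wxi : W xi <= W z by rewrite zE; apply: (weightv_le hw); exact: enorm_row_mx_ger.
have la10 : 0 <= la + 1 by lra.
have mon (u : 'rV[R]_n) (D : R) : W u <= W z -> 0 <= D -> D <= C + C' + B ->
    D * e * expR ((la + 1) * W u) <= (C + C' + B) * e * expR ((la + 1) * W z).
  move=> uz D0 DC; apply: ler_pM; [by rewrite mulr_ge0// ltW|exact: expR_ge0| |].
    by rewrite ler_wpM2r// ltW.
  by rewrite ler_expR ler_wpM2l.
split.
  rewrite zE z'E; apply: decay_mono (HC x xi x' xi' e e0 e1 xx xixi) => //.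
  by rewrite -zE; apply: mon => //; [exact: ltW|lra].
have fi := Aw_cintegrable hw fA.
have tz := Aw_cintegrable hw (Aw_tfshift hw z fA).
have tz' := Aw_cintegrable hw (Aw_tfshift hw z' fA).
have -> : fourier (fun y => tfshift z f y - tfshift z' f y) =
   (fun eta => fourier (tfshift z f) eta - fourier (tfshift z' f) eta).
  apply/funext => eta; rewrite /fourier -(cintegralB (cintegrable_fourier eta tz) (cintegrable_fourier eta tz')).
  by apply: eq_cintegral => y; rewrite mulrBr.
move=> eta.
rewrite {1}zE {1}z'E !(fourier_tfshift _ _ fi).
set a := tfshift _ _ _; set b := tfshift _ _ _.
have -> : cis (dotv x xi) * a - cis (dotv x' xi') * b =
  cis (dotv x xi) * (a - b) + (cis (dotv x xi) - cis (dotv x' xi')) * b by ring.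
apply: (le_trans (normcD _ _)); rewrite normcM normc_cis mul1r normcM.
have nx : enorm (- x - - x') <= e ^+ 2 by rewrite -opprD enormN.
have t1 : normc (a - b) <= C' * e * expR ((la + 1) * W z) * expR (- (la * W eta)).
  apply: (le_trans (HC' xi (- x) xi' (- x') e e0 e1 xixi nx eta)).
  by rewrite ler_wpM2r ?expR_ge0// ler_wpM2l ?(mulr_ge0 (ltW C'0) (ltW e0))// ler_expR ler_wpM2l.
have e1W : 1 <= expR (W z) by rewrite -expR0 ler_expR weightv_ge0.
have t2 : normc (cis (dotv x xi) - cis (dotv x' xi')) <= 2 * (2 * Cw + 1) * e * expR (W z).
  apply: (le_trans (normc_cisB _ _)).
  have -> : dotv x xi - dotv x' xi' = dotv x (xi - xi') + dotv (x - x') xi'.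
    by rewrite dotvBr dotvBl; ring.
  rewrite -!mulrA ler_pM2l//; apply: (le_trans (ler_normD _ _)).
  have d1 : `|dotv x (xi - xi')| <= Cw * expR (W z) * e.
    apply: (le_trans (dotv_le _ _)); apply: ler_pM; rewrite ?enorm_ge0//.
      apply: (le_trans (HCw x)); rewrite ler_pM2l// ler_expR//.
    by rewrite (le_trans xixi)// expr2 ler_piMr// ltW.
  have d2 : `|dotv (x - x') xi'| <= e * (Cw * expR (W z) + expR (W z)).
    apply: (le_trans (dotv_le _ _)); apply: ler_pM; rewrite ?enorm_ge0//.
      by rewrite (le_trans xx)// expr2 ler_piMr// ltW.
    have := enormD xi (xi' - xi); rewrite addrC subrK => /le_trans; apply.
    apply: lerD; last by rewrite -enormN opprB (le_trans xixi)// (le_trans ee1).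
    apply: (le_trans (HCw xi)); rewrite ler_pM2l// ler_expR//.
  apply: (le_trans (lerD d1 d2)).
  by rewrite le_eqVlt; apply/orP; left; apply/eqP; ring.
have t3 : normc b <= M * expR (la * w 1) * expR (la * W z) * expR (- (la * W eta)).
  have := decay_tfshift hw (row_mx xi' (- x')) la0 HM eta.
  rewrite row_mxKl => /le_trans; apply; rewrite ler_wpM2r ?expR_ge0// -mulrA ler_wpM2l//.
  rewrite -expRD ler_expR.
  have := ler_wpM2l la0 (le_trans (weightv_near (le_trans xixi ee1)) (lerD Wxi (lexx (w 1)))); lra.
apply: (le_trans (lerD t1 (ler_pM (normc_ge0 _) (normc_ge0 _) t2 t3))).
have -> : C' * e * expR ((la + 1) * W z) * expR (- (la * W eta)) +
   2 * (2 * Cw + 1) * e * expR (W z) * (M * expR (la * w 1) * expR (la * W z) * expR (- (la * W eta))) =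
   (C' + B) * e * expR ((la + 1) * W z) * expR (- (la * W eta)).
  by rewrite /B mulrDl mul1r expRD; ring.
rewrite ler_wpM2r ?expR_ge0// ler_wpM2r ?expR_ge0// ler_wpM2r ?(ltW e0)//; lra.
Qed.

End shift_modulus.

Section riemann_sums.
Context {R : realType} (w : R -> R) (hw : weight_function w) {n : nat}.
Local Notation lebn := (@lebesgue_rV R n).
Local Notation lebnn := (@sigma_finite_product _ _ _ _ R (@lebesgue_rV R n) (@lebesgue_rV R n)).
Local Notation W := (weightv w).
Local Notation phase := ('rV[R]_n * 'rV[R]_n)%type.
Local Open Scope complex_scope.
Variables (g phi : 'rV[R]_n -> R[i]).
Hypotheses (gA : Aw w g) (phiA : Aw w phi).
Local Notation K := (coef g phi).

Lemma measurable_pt : measurable_fun setT (@pt R n).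
Proof.
apply: measurable_fun_rV => i; rewrite /pt; case: (split_ordP i) => j ->.
- rewrite (_ : (fun _ => _) = (fun p : phase => p.1 0 j)).
    by apply: (measurableT_comp (measurable_coord j)); exact: measurable_fst.
  by apply/funext => p; rewrite row_mxEl.
- rewrite (_ : (fun _ => _) = (fun p : phase => p.2 0 j)).
    by apply: (measurableT_comp (measurable_coord j)); exact: measurable_snd.
  by apply/funext => p; rewrite row_mxEr.
Qed.

Section grid.
Variables (N : nat) (J : finType) (zp : J -> 'rV[R]_(n + n)) (ind : J -> 'rV[R]_(n + n) -> bool).
Hypotheses (mind : forall j, measurable [set z | ind j z])
  (mesh : forall j z, ind j z -> enorm (z - zp j) <= (n + n)%:R / N.+1%:R ^+ 2)
  (uind : forall z j j', ind j z -> ind j' z -> j = j')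
  (cover : forall z : 'rV[R]_(n + n), (forall i, `|z 0 i| < N.+1%:R) -> exists j, ind j z).

Definition cell j (p : phase) : R := \1_[set z | ind j z] (pt p).

(** The coefficient is integrated exactly over the cell instead of being sampled, so the error of a
    Riemann sum involves only the variation of the shifted window. *)
Definition cell_coef j : R[i] := cintegral lebnn (fun p => K p * (cell j p)%:C).

Lemma cellE j p : cell j p = (ind j (pt p))%:R.
Proof.
rewrite /cell indicE; case: (boolP (ind j (pt p))) => h.
  by rewrite mem_set.
by rewrite memNset//; exact/negP.
Qed.

Lemma measurable_cell j : measurable_fun setT (cell j).
Proof. by apply: (measurableT_comp (measurable_indic _) measurable_pt). Qed.

Lemma cintegrable_cell j : cintegrable lebnn (fun p => K p * (cell j p)%:C).
Proof.
have [C C0 HC] := coef_le_cauchy hw gA phiA.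
have [i1 _] := @integrable_cauchy2 R n.
apply: (@le_cintegrable _ _ _ lebnn _ (fun p => C * (cauchy_rV p.1 * cauchy_rV p.2))).
- by apply: cmeasM; [exact: (cmeas_coef gA phiA)|apply: cmeas_real; exact: measurable_cell].
- move=> p; rewrite normcM normc_real cellE normr_nat; apply: le_trans (HC p).
  by rewrite ler_piMr ?normc_ge0//; case: (ind j (pt p)).
- by have := integrableZl measurableT C i1; apply: eq_integrable => // p _; rewrite EFinM.
Qed.

Lemma sum_cell (X : J -> R[i]) p :
  (exists2 j, ind j (pt p) & \sum_j (cell j p)%:C * X j = X j) \/
  (\sum_j (cell j p)%:C * X j = 0 /\ N.+1%:R <= enorm (pt p)).
Proof.
have [[j jp]|h] := pselect (exists j, ind j (pt p)).
  left; exists j => //; rewrite (bigD1 j)//= big1 => [|i ij].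
    by rewrite cellE jp mul1r addr0.
  rewrite cellE (_ : ind i (pt p) = false) ?mul0r//.
  by apply/negP => /(uind jp) ji; rewrite ji eqxx in ij.
right; split.
  rewrite big1// => j _; rewrite cellE (_ : ind j (pt p) = false) ?mul0r//.
  by apply/negP => jp; apply: h; exists j.
rewrite leNgt; apply/negP => H; apply: h; apply: cover => i.
exact: le_lt_trans (coord_le_enorm _ _) H.
Qed.

Lemma sum_cell_le1 p : \sum_j cell j p <= 1.
Proof.
have [[j jp]|h] := pselect (exists j, ind j (pt p)).
  rewrite (bigD1 j)//= big1 => [|i ij]; first by rewrite cellE jp addr0.
  rewrite cellE (_ : ind i (pt p) = false)//.
  by apply/negP => /(uind jp) ji; rewrite ji eqxx in ij.
rewrite big1// => j _; rewrite cellE (_ : ind j (pt p) = false)//.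
by apply/negP => jp; apply: h; exists j.
Qed.

End grid.

(* [X z] is the value at a given point of [tfshift z phi], or of its Fourier
   transform, and [E] the weight at that point. *)
Lemma riemann_error la C1 M : 0 <= la -> 0 <= C1 -> 0 <= M -> exists2 C : R, 0 < C &
  forall N (J : finType) (zp : J -> 'rV[R]_(n + n)) (ind : J -> 'rV[R]_(n + n) -> bool),
  (n + n <= N)%N ->
  (forall j, measurable [set z | ind j z]) ->
  (forall j z, ind j z -> enorm (z - zp j) <= (n + n)%:R / N.+1%:R ^+ 2) ->
  (forall z j j', ind j z -> ind j' z -> j = j') ->
  (forall z : 'rV[R]_(n + n), (forall i, `|z 0 i| < N.+1%:R) -> exists j, ind j z) ->
  forall (X : 'rV[R]_(n + n) -> R[i]) (E : R), 0 <= E ->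
  cmeas (fun p : phase => X (pt p)) ->
  (forall z, normc (X z) <= M * expR (la * W z) * E) ->
  (forall z z' e, 0 < e -> e <= 1 -> enorm (z - z') <= e ^+ 2 ->
     normc (X z - X z') <= C1 * e * expR ((la + 1) * W z) * E) ->
  normc (cintegral lebnn (fun p => K p * X (pt p)) - \sum_j cell_coef ind j * X (zp j))
    <= C / N.+1%:R * E.
Proof.
move=> la0 C10 M0.
have [C2 C20 HC2] := coef_cauchy hw gA phiA (addr_ge0 la0 (ler01 (R := R))).
have [Cw Cw0 HCw] := enorm_le_expR hw (n + n) 1.
have [i1 e1] := @integrable_cauchy2 R n.
pose m : R := (n + n).+1%:R.
have m0 : 0 < m by rewrite ltr0n.
pose C3 := C1 * m + M * Cw.
have C30 : 0 <= C3 by rewrite addr_ge0 ?mulr_ge0// ltW.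
have pp : 0 < pi ^+ n * pi ^+ n :> R by rewrite mulr_gt0// exprn_gt0// pi_gt0.
exists (2 * ((C3 + 1) * C2) * (pi ^+ n * pi ^+ n)) => [|N J zp ind nN mind mesh uind cover X E E0 mX XM Xmod].
  by rewrite mulr_gt0// mulr_gt0// mulr_gt0//; lra.
have N0 : 0 < N.+1%:R :> R by rewrite ltr0n.
have iX : cintegrable lebnn (fun p => K p * X (pt p)).
  apply: (@le_cintegrable _ _ _ lebnn _ (fun p => M * E * C2 * (cauchy_rV p.1 * cauchy_rV p.2))).
  - by apply: cmeasM => //; exact: (cmeas_coef gA phiA).
  - move=> p; rewrite normcM.
    apply: (le_trans (ler_wpM2l (normc_ge0 _) (XM (pt p)))).
    have h : expR (la * W (pt p)) <= expR ((la + 1) * W (pt p)).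
      by rewrite ler_expR ler_wpM2r ?weightv_ge0//; lra.
    have ME : 0 <= M * E by exact: mulr_ge0.
    have := ler_wpM2l ME (le_trans (ler_wpM2l (normc_ge0 (K p)) h) (HC2 p)).
    by congr (_ <= _); ring.
  - by have := integrableZl measurableT (M * E * C2) i1; apply: eq_integrable => // p _; rewrite EFinM.
have iS j : cintegrable lebnn (fun p => K p * (cell ind j p)%:C * X (zp j)).
  have := cintegrableZ (X (zp j)) (cintegrable_cell mind j).
  by congr cintegrable; apply/funext => p; rewrite mulrC.
have sE : \sum_j cell_coef ind j * X (zp j) =
    cintegral lebnn (fun p => K p * \sum_j ((cell ind j p)%:C * X (zp j))).
  under eq_bigr do rewrite /cell_coef -(cintegralZr _ (cintegrable_cell mind _)).
  rewrite -(cintegral_sum _ iS); apply: eq_cintegral => p.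
  by rewrite mulr_sumr; apply: eq_bigr => j _; rewrite mulrA.
have iS' : cintegrable lebnn (fun p => K p * \sum_j ((cell ind j p)%:C * X (zp j))).
  rewrite (_ : (fun _ => _) = (fun p => \sum_j (K p * (cell ind j p)%:C * X (zp j)))).
    exact: (cintegrable_sum _ iS).
  by apply/funext => p; rewrite mulr_sumr; apply: eq_bigr => j _; rewrite mulrA.
rewrite sE -(cintegralB iX iS').
(* The mesh is then at most [e ^+ 2], and [n + n <= N] gives [e <= 1]. The successor in [m] keeps
   [e] positive when [n = 0]. *)
pose e : R := m / N.+1%:R.
have e0 : 0 < e by rewrite divr_gt0.
have e1' : e <= 1 by rewrite ler_pdivrMr// mul1r ler_nat.
have ee : (n + n)%:R / N.+1%:R ^+ 2 <= e ^+ 2.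
  rewrite /e expr_div_n ler_pM2r ?invr_gt0 ?exprn_gt0// /m -natrX ler_nat.
  by rewrite (leq_trans (leqnSn _))// expnS expn1 leq_pmulr.
have D p : normc (X (pt p) - \sum_j (cell ind j p)%:C * X (zp j)) <=
    C3 / N.+1%:R * expR ((la + 1) * W (pt p)) * E.
  have [[j jp ->]|[-> far]] := sum_cell uind cover (fun j => X (zp j)) p.
    apply: (le_trans (Xmod _ _ e e0 e1' (le_trans (mesh _ _ jp) ee))).
    rewrite ler_wpM2r// ler_wpM2r ?expR_ge0// /e mulrA ler_wpM2r ?invr_ge0//.
    by rewrite lerDl mulr_ge0// ltW.
  rewrite subr0; apply: (le_trans (XM _)); rewrite ler_wpM2r//.
  (* Outside the grid nothing approximates [X]. There [|pt p| >= N.+1], so a factor [1 / N.+1] is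
     bought with one more unit of growth, which the decay of [coef] covers. *)
  have h1 : 1 <= Cw / N.+1%:R * expR (W (pt p)).
    by rewrite mulrAC ler_pdivlMr// mul1r (le_trans far)//; exact: HCw.
  apply: (@le_trans _ _ (M * expR (la * W (pt p)) * (Cw / N.+1%:R * expR (W (pt p))))).
    by rewrite ler_peMr// mulr_ge0 ?expR_ge0.
  rewrite (_ : M * _ * _ = M * Cw / N.+1%:R * expR ((la + 1) * W (pt p))); last first.
    by rewrite mulrDl mul1r expRD; ring.
  rewrite ler_wpM2r ?expR_ge0// ler_wpM2r ?invr_ge0// lerDr mulr_ge0// ltW.
apply: (@le_trans _ _ (2 * \int[lebnn]_p (C3 / N.+1%:R * E * C2 * (cauchy_rV p.1 * cauchy_rV p.2)))).
  apply: normc_cintegral_le => [p|]; last first.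
    have := integrableZl measurableT (C3 / N.+1%:R * E * C2) i1.
    by apply: eq_integrable => // p _; rewrite EFinM.
  rewrite -mulrBr normcM; apply: (le_trans (ler_wpM2l (normc_ge0 _) (D p))).
  have CE : 0 <= C3 / N.+1%:R * E by rewrite mulr_ge0// divr_ge0.
  by have := ler_wpM2l CE (HC2 p); congr (_ <= _); ring.
rewrite (RintegralZl _ measurableT i1) e1.
have -> : 2 * ((C3 + 1) * C2) * (pi ^+ n * pi ^+ n) / N.+1%:R * E =
  2 * (C3 / N.+1%:R * E * C2 * (pi ^+ n * pi ^+ n)) + 2 * (C2 * (pi ^+ n * pi ^+ n) / N.+1%:R * E) by ring.
by rewrite lerDl mulr_ge0// mulr_ge0// divr_ge0// mulr_ge0// ltW.
Qed.

Variable (u : @functional R n).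
Hypothesis uD : Sw_dual w u.

Lemma Sw_dual_sum (I : Type) (s : seq I) (k : I -> R[i]) (F : I -> 'rV[R]_n -> R[i]) :
  (forall i, Aw w (F i)) ->
  u (fun y => \sum_(i <- s) k i * F i y) = \sum_(i <- s) conjc (k i) * u (F i).
Proof.
move=> FA; have [uA uZ _] := uD; elim: s => [|i s IH].
  rewrite big_nil -[RHS](Sw_dual0 hw uD); congr u.
  by apply/funext => y; rewrite big_nil.
rewrite big_cons -IH -(uZ (k i) (F i) (Aw_Sw hw (FA i))) -uA.
- by congr u; apply/funext => y; rewrite big_cons.
- by apply: (Aw_Sw hw); apply: (AwZ hw).
- by apply: (Aw_Sw hw); apply: (Aw_sum hw) => j; apply: (AwZ hw).
Qed.

Lemma integrable_cauchy2_shift (a b : 'rV[R]_n) : lebnn.-integrable setT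
  (fun p : phase => (cauchy_rV (p.1 - a) * cauchy_rV (p.2 - b))%:E) /\
  \int[lebnn]_p (cauchy_rV (p.1 - a) * cauchy_rV (p.2 - b)) = pi ^+ n * pi ^+ n.
Proof.
have [ia ea] := Rintegral_shift_rV (- a) (@integrable_cauchy_rV R n).
have [ib eb] := Rintegral_shift_rV (- b) (@integrable_cauchy_rV R n).
have := integrable_prod (fun x : 'rV[R]_n => cauchy_rV_ge0 (x - a)) (fun x : 'rV[R]_n => cauchy_rV_ge0 (x - b)) ia ib.
by rewrite ea eb Rintegral_cauchy_rV.
Qed.

(** A multiple of [g] is split into the Riemann sum [psi] and the error [err]. Cell by cell, the sum
    is dominated by the integral of the assumed majorant, whatever the mesh, while [u err] falls
    below any [e]. The hypothesis pairs [coef] at [p] with [u] at a nearby [z'] because the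
    coefficient is integrated over a cell and [u] is evaluated at its node. The centre [(a, b)] lets
    the bound follow a shifted [g]. *)
Lemma window_bound (B : R) (a b : 'rV[R]_n) : 0 <= B ->
  (forall p z', enorm (pt p - z') <= 1 ->
     normc (K p) * normc (u (tfshift z' phi)) <= B * (cauchy_rV (p.1 - a) * cauchy_rV (p.2 - b))) ->
  normc (recon_cst phi) * normc (u g) <= 2 * B * (pi ^+ n * pi ^+ n).
Proof.
move=> B0 HB.
have [la' [Cu Cu0 Hu]] := Sw_dual_bound hw uD.
pose la := Num.max la' 0.
have la0 : 0 <= la by rewrite le_max lexx orbT.
have [C1 C10 HC1] := tfshift_modulus hw la0 phiA.
have [M HM] := Aw_seminorm hw la phiA.
have M0 : 0 <= M by case: HM => /decay_ge0.
have [C C0 HC] := riemann_error la0 (ltW C10) M0.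
have [i1 e1] := integrable_cauchy2_shift a b.
have phii := Aw_cintegrable hw phiA.
apply/ler_addgt0Pr => e e0.
(* The first part meets the condition of [riemann_error] and puts every cell within distance 1 of
   its node; the second makes [Cu * C / N.+1%:R] at most [e]. *)
pose N := (n + n + Num.truncn (Cu * C / e))%N.
have N0 : 0 < N.+1%:R :> R by rewrite ltr0n.
have [J [zp [ind [mind mesh uind cover]]]] := rV_grid R (n + n) N.
have nN : (n + n <= N)%N by exact: leq_addr.
have HCN := HC N J zp ind nN mind mesh uind cover.
pose psi y := \sum_j cell_coef ind j * tfshift (zp j) phi y.
have tA z : Aw w (tfshift z phi) by exact: Aw_tfshift.
have psiA : Aw w psi by apply: (Aw_sum hw) => j; apply: (AwZ hw).
have rgA := AwZ hw (recon_cst phi) gA.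
pose err y := recon_cst phi * g y + -1 * psi y.
have errA : Aw w err by apply: (AwD hw) => //; exact: (AwZ hw).
have errE y : err y = recon_cst phi * g y - psi y by rewrite /err mulN1r.
have Fpsi eta : fourier psi eta = \sum_j cell_coef ind j * fourier (tfshift (zp j) phi) eta.
  rewrite /fourier; under eq_bigr do rewrite -(cintegralZ _ (cintegrable_fourier eta (Aw_cintegrable hw (tA _)))).
  rewrite -cintegral_sum; last first.
    by move=> j; exact: (cintegrableZ _ (cintegrable_fourier eta (Aw_cintegrable hw (tA _)))).
  by apply: eq_cintegral => y; rewrite mulr_sumr; apply: eq_bigr => j _; rewrite mulrCA.
have Ferr eta : fourier err eta = recon_cst phi * fourier g eta - fourier psi eta.
  rewrite /err (fourierD (Aw_cintegrable hw rgA) (Aw_cintegrable hw (AwZ hw (-1) psiA))).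
  by rewrite (fourierZ _ (Aw_cintegrable hw gA)) (fourierZ _ (Aw_cintegrable hw psiA)) mulN1r.
(* At a fixed [y], each half is an instance of [riemann_error], for the shifted window and for its
   Fourier transform, with [E = expR (- (la * W y))]. Since [C] is independent of [X] and [E], the
   bound is uniform in [y]. *)
have S1 : seminorm_le w la (C / N.+1%:R) err.
  split=> y.
  - rewrite errE -(reconstruction hw gA phiA).
    apply: (HCN (fun z => tfshift z phi y) (expR (- (la * W y))) (expR_ge0 _)).
    + exact: (cmeas_pair1 y (cmeas_tfshift (Aw_cmeas phiA))).
    + by move=> z; have [h _] := seminorm_le_tfshift hw z la0 phii HM; exact: h.
    + by move=> z z' e' e'0 e'1 zz; have [h _] := HC1 z z' e' e'0 e'1 zz; exact: h.
  - rewrite Ferr Fpsi -(fourier_reconstruction hw gA phiA).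
    apply: (HCN (fun z => fourier (tfshift z phi) y) (expR (- (la * W y))) (expR_ge0 _)).
    + apply: (@cmeas_cintegral _ _ _ _ _ lebn (fun q : phase * 'rV[R]_n =>
        cis (- dotv q.2 y) * tfshift (pt q.1) phi q.2)).
      apply: cmeasM; last exact: (cmeas_tfshift (Aw_cmeas phiA)).
      by apply: cmeas_cis; apply: measurable_funN; apply: measurable_dotv.
    + by move=> z; have [_ h] := seminorm_le_tfshift hw z la0 phii HM; exact: h.
    + move=> z z' e' e'0 e'1 zz; have [_ h] := HC1 z z' e' e'0 e'1 zz.
      have := h y; congr (normc _ <= _).
      rewrite /fourier -(cintegralB (cintegrable_fourier y (Aw_cintegrable hw (tA z)))
        (cintegrable_fourier y (Aw_cintegrable hw (tA z')))).
      by apply: eq_cintegral => t; rewrite mulrBr.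
have uerr : normc (u err) <= Cu * (C / N.+1%:R).
  apply: Hu => //; case: S1 => s1 s2; split.
    by apply: decay_mono s1; rewrite // le_max lexx.
  by apply: decay_mono s2; rewrite // le_max lexx.
have [uA uZ _] := uD.
have uerrE : u err = conjc (recon_cst phi) * u g - u psi.
  rewrite /err uA ?uZ; [|exact: (Aw_Sw hw psiA)|exact: (Aw_Sw hw gA)|exact: (Aw_Sw hw rgA)|exact: (Aw_Sw hw (AwZ hw (-1) psiA))].
  by congr (_ + _); rewrite rmorphN1 mulN1r.
have upsi : normc (u psi) <= 2 * B * (pi ^+ n * pi ^+ n).
  rewrite /psi Sw_dual_sum// (le_trans (normc_sum _ _))//.
  pose h j (p : phase) : R := B * (cauchy_rV (p.1 - a) * cauchy_rV (p.2 - b)) * cell ind j p.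
  have i2 : lebnn.-integrable setT
      (fun p : phase => (B * (cauchy_rV (p.1 - a) * cauchy_rV (p.2 - b)))%:E).
    by have := integrableZl measurableT B i1; apply: eq_integrable => // p _; rewrite EFinM.
  have cc0 (p : phase) : 0 <= B * (cauchy_rV (p.1 - a) * cauchy_rV (p.2 - b)).
    by rewrite !mulr_ge0 ?cauchy_rV_ge0.
  have ih j : lebnn.-integrable setT (fun p => (h j p)%:E).
    apply: (le_integrable measurableT _ _ i2).
      apply/measurable_EFinP; apply: measurable_funM; last exact: measurable_cell.
      by have /measurable_EFinP := measurable_int _ i2.
    move=> p _ /=; rewrite lee_fin normrM ler_piMr// cellE normr_nat.
    by case: (ind j (pt p)).
  (* The value of [u] at the node is moved into the integral over the cell, where [HB] applies at
     every point. Disjointness of the cells then lets the [h j] add up to at most the majorant. *)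
  apply: (@le_trans _ _ (\sum_j 2 * \int[lebnn]_p h j p)).
    apply: ler_sum => j _; rewrite normcM normc_conj.
    have -> : normc (cell_coef ind j) * normc (u (tfshift (zp j) phi)) =
        normc (cintegral lebnn (fun p => (normc (u (tfshift (zp j) phi)))%:C * (K p * (cell ind j p)%:C))).
      rewrite (cintegralZ _ (cintegrable_cell mind j)) normcM normc_real.
      by rewrite (ger0_norm (normc_ge0 _)) mulrC.
    apply: normc_cintegral_le => [p|]; last exact: ih.
    rewrite !normcM !normc_real (ger0_norm (normc_ge0 _)) /h cellE normr_nat.
    case: (boolP (ind j (pt p))) => jp; last by rewrite !mulr0.
    rewrite !mulr1 mulrC; apply: HB; apply: (le_trans (mesh _ _ jp)).
    rewrite ler_pdivrMr ?exprn_gt0// mul1r -natrX ler_nat.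
    by rewrite (leq_trans nN)// (leq_trans (leqnSn _))// expnS expn1 leq_pmulr.
  rewrite -mulr_sumr -mulrA ler_pM2l//.
  rewrite -e1 -(RintegralZl _ measurableT i1).
  have -> : \sum_j \int[lebnn]_p h j p = \int[lebnn]_p \sum_j h j p.
    have ihC j : cintegrable lebnn (fun p => (h j p)%:C).
      apply: (@le_cintegrable _ _ _ lebnn _ (h j)) => //.
        by apply: cmeas_real; have /measurable_EFinP := measurable_int _ (ih j).
      move=> p; rewrite normc_real ger0_norm// /h mulr_ge0// cellE ler0n//.
    have := cintegral_sum (index_enum J) ihC.
    have E1 : cintegral lebnn (fun p => \sum_j (h j p)%:C) = (\int[lebnn]_p \sum_j h j p)%:C.
      rewrite -cintegral_real; apply: eq_cintegral => p.
      by rewrite -rmorph_sum.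
    rewrite E1; under eq_bigr do rewrite cintegral_real.
    by rewrite -rmorph_sum => /(congr1 (@complex.Re R)).
  apply: le_trans (ler_norm _) _; apply: normr_Rintegral_le => // p.
  rewrite -mulr_sumr ger0_norm.
    by rewrite ler_piMr// (sum_cell_le1 uind).
  by rewrite mulr_ge0// sumr_ge0// => j _; rewrite cellE ler0n.
have : normc (conjc (recon_cst phi) * u g) <= normc (u psi) + normc (u err).
  rewrite (_ : conjc (recon_cst phi) * u g = u psi + u err); first exact: normcD.
  by rewrite uerrE addrC subrK.
rewrite normcM normc_conj => /le_trans; apply; apply: lerD => //.
apply: (le_trans uerr); rewrite mulrA ler_pdivrMr// [leRHS]mulrC -ler_pdivrMr//.
rewrite (le_trans (ltW (truncnS_gt _)))// ler_nat ltnS; exact: leq_addl.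
Qed.

End riemann_sums.

(** * Cones and the wave front set *)

Section cones.
Context {R : realType} (w : R -> R) (hw : weight_function w) {d : nat}.
Local Notation W := (weightv w).
Implicit Types (z : 'rV[R]_(d + d)) (G : set 'rV[R]_(d + d)).

Lemma open_rV_enormP m (G : set 'rV[R]_m) :
  open G <-> forall z : 'rV[R]_m, G z -> exists2 de : R, 0 < de &
    forall y : 'rV[R]_m, enorm (z - y) < de -> G y.
Proof.
split=> [oG z Gz|H].
  have /nbhs_ballP[de /= de0 H] : nbhs z G by exact: open_nbhs_nbhs.
  exists de => // y zy; apply: H; split => // i j; rewrite (ord1 i).
  have := coord_le_enorm (z - y) j; rewrite !mxE => h.
  exact: le_lt_trans h zy.
rewrite openE => z /H[de de0 Hd]; apply/nbhs_ballP.
have m0 : 0 < (1 + m%:R : R) by rewrite ltr_pwDl.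
exists (de / (1 + m%:R)) => /=; first exact: divr_gt0.
move=> y [_ zy]; apply: Hd; apply: le_lt_trans (enorm_le_sum _) _.
apply: (@le_lt_trans _ _ (m%:R * (de / (1 + m%:R)))).
  rewrite mulr_natl -[X in _ *+ X]card_ord -sumr_const; apply: ler_sum => i _.
  by rewrite !mxE; apply: ltW; exact: zy.
by rewrite mulrA ltr_pdivrMr// mulrC ltr_pM2l// ltrDr.
Qed.

(* Away from [G], points of the smaller cone [G'] are controlled by their
   distance to the complement of [G]. *)
Lemma subcone G z0 : open G -> conic G -> ~ G 0 -> G z0 ->
  exists G' (k : nat), [/\ open G', conic G', ~ G' 0, G' z0 &
    forall z' z, G' z' -> ~ G z -> W z' <= k.+1%:R * W (z - z')].
Proof.
move=> oG cG G0 Gz0; have [de de0 Hde] := (open_rV_enormP G).1 oG z0 Gz0.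
(* The cone over the ball of half the radius around [z0], leaving a margin of [de / 2] inside
   [G]. *)
pose G' : set 'rV[R]_(d + d) := [set z | exists t s, [/\ 0 < t, enorm (z0 - s) < de / 2 & z = t *: s]].
(* If [|z - z'| < kap * |z'|] with [z' = t *: s], then [z / t] is within [kap * |s| <= de / 2] of
   [s], hence within [de] of [z0], and [z] lies in [G]. *)
pose kap := de / 2 / (enorm z0 + de).
have n0 := enorm_ge0 z0.
have kap0 : 0 < kap by rewrite !divr_gt0// ltr_wpDl.
(* The ratio [kap^-1] is rounded up to an integer because subadditivity carries integer multiples
   through the weight. *)
exists G', (Num.truncn kap^-1); split.
- apply/open_rV_enormP => z [t [s [t0 sz ->]]].
  exists (t * (de / 2 - enorm (z0 - s))); first by rewrite mulr_gt0// subr_gt0.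
  move=> y ty; exists t, (t^-1 *: y); split => //; last first.
    by rewrite scalerA divff ?gt_eqF// scale1r.
  have -> : z0 - t^-1 *: y = (z0 - s) + t^-1 *: (t *: s - y).
    by rewrite scalerBr scalerA mulVf ?gt_eqF// scale1r addrA subrK.
  apply: le_lt_trans (enormD _ _) _.
  by rewrite enormZ gtr0_norm ?invr_gt0// -ltrBrDl ltr_pdivrMl.
- move=> z r [t [s [t0 sz ->]]] r0; exists (r * t), s; split => //.
    exact: mulr_gt0.
  by rewrite scalerA.
- move=> [t [s [t0 sz /esym/eqP]]]; rewrite scaler_eq0 gt_eqF//= => /eqP s0.
  by apply: G0; apply: Hde; rewrite -s0; lra.
- exists 1, z0; split => //; last by rewrite scale1r.
  by rewrite subrr enorm0 divr_gt0.
- move=> z' z [t [s [t0 sz z'E]]] Gz.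
  have far : kap * enorm z' <= enorm (z - z').
    rewrite leNgt; apply/negP => H; apply: Gz.
    have -> : z = t *: (t^-1 *: z) by rewrite scalerA divff ?gt_eqF// scale1r.
    apply: cG => //; apply: Hde.
    have -> : z0 - t^-1 *: z = (z0 - s) + t^-1 *: (z' - z).
      by rewrite z'E scalerBr scalerA mulVf ?gt_eqF// scale1r addrA subrK.
    apply: le_lt_trans (enormD _ _) _.
    rewrite enormZ gtr0_norm ?invr_gt0//.
    have h1 : t^-1 * enorm (z' - z) < kap * enorm s.
      rewrite ltr_pdivrMl// -enormN opprB mulrCA.
      by move: H; rewrite {2}z'E enormZ gtr0_norm.
    have h2 : enorm s <= enorm z0 + de.
      have := enormD z0 (s - z0); rewrite addrC subrK => /le_trans; apply.
      by rewrite lerD2l -enormN opprB; lra.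
    have h3 : kap * enorm s <= de / 2.
      apply: (@le_trans _ _ (kap * (enorm z0 + de))); first by rewrite ler_pM2l.
      by rewrite /kap divfK// gt_eqF// ltr_wpDl.
    lra.
  rewrite mulr_natl; apply: (weight_le_muln hw); rewrite ?enorm_ge0//.
  rewrite -mulr_natl; apply: (@le_trans _ _ (kap^-1 * enorm (z - z'))).
    by rewrite -ler_pdivrMl ?invr_gt0// invrK.
  by rewrite ler_wpM2r ?enorm_ge0// ltW// truncnS_gt.
Qed.

Lemma cone_split G G' (k : nat) (F : 'rV[R]_(d + d) -> R) (mu C : R) :
  (forall z' z, G' z' -> ~ G z -> W z' <= k.+1%:R * W (z - z')) ->
  0 <= mu -> (forall z, 0 <= F z) -> (forall z, F z <= C * expR (mu * W z)) ->
  (forall la, 0 < la -> exists M, forall z, G z -> F z <= M * expR (- (la * W z))) ->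
  forall la, 0 < la -> exists Lam M, [/\ 0 <= Lam, 0 <= M &
    forall z' z, G' z' -> F z * expR (la * W z') <= M * expR (Lam * W (z - z'))].
Proof.
move=> HG mu0 F0 FC FG la la0; have [M HM] := FG la la0.
have C0 : 0 <= C by have := le_trans (F0 0) (FC 0); rewrite pmulr_lge0// expR_gt0.
(* For [z] in [G], [la * W (z - z')] suffices. Outside, [mu * W z] is at most
   [mu * W (z - z') + mu * W z'], and the total [(la + mu) * W z'] is paid for by the cone
   condition. *)
pose Lam := la + (la + mu) * k.+1%:R + mu.
have k0 : 0 <= (la + mu) * k.+1%:R by rewrite mulr_ge0// addr_ge0// ltW.
exists Lam, (`|M| + C); split; [by rewrite /Lam; lra|exact: addr_ge0|move=> z' z G'z'].
have W0 := weightv_ge0 hw (z - z').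
have Wz' := weightv_ge0 hw z'.
have Ws : W (z' - z) = W (z - z') by rewrite -(weightvN w) opprB.
have [Gz|Gz] := pselect (G z).
- have h1 : F z <= `|M| * expR (- (la * W z)).
    by apply: (le_trans (HM _ Gz)); rewrite ler_wpM2r ?expR_ge0// ler_norm.
  apply: (le_trans (ler_wpM2r (expR_ge0 _) h1)); rewrite -mulrA -expRD.
  apply: ler_pM; rewrite ?expR_ge0//; first by rewrite lerDl.
  rewrite ler_expR.
  have := weightv_triangle hw z' z; rewrite Ws => /(ler_wpM2l (ltW la0)).
  have : la * W (z - z') <= Lam * W (z - z') by rewrite ler_wpM2r// /Lam; lra.
  lra.
- apply: (le_trans (ler_wpM2r (expR_ge0 _) (FC z))); rewrite -mulrA -expRD.
  apply: ler_pM; rewrite ?expR_ge0//; first by rewrite lerDr.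
  rewrite ler_expR.
  have h1 := ler_wpM2l mu0 (weightv_triangle hw z z').
  have h2 := ler_wpM2l (addr_ge0 (ltW la0) mu0) (HG _ _ G'z' Gz).
  have h3 : (la + mu) * (k.+1%:R * W (z - z')) + mu * W (z - z') <= Lam * W (z - z').
    by rewrite mulrA -mulrDl ler_wpM2r// /Lam; lra.
  lra.
Qed.

End cones.

(** * Decay of short-time Fourier transforms on cones *)

Section wave_front.
Context {R : realType} (w : R -> R) (hw : weight_function w) {d : nat}.
Local Notation W := (weightv w).
Implicit Types (z : 'rV[R]_(d + d)) (G : set 'rV[R]_(d + d)).
Variable (u : @functional R d).
Hypothesis uD : Sw_dual w u.

(** The seminorm that bounds [u] grows at most by [expR (mu * W z)] under the shift by [z]. *)
Lemma stft_growth (psi : 'rV[R]_d -> R[i]) : Aw w psi -> exists mu C : R,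
  [/\ 0 <= mu, 0 <= C & forall z, normc (u (tfshift z psi)) <= C * expR (mu * W z)].
Proof.
move=> psiA; have [la [Cu Cu0 Hu]] := Sw_dual_bound hw uD.
pose mu := Num.max la 0.
have mu0 : 0 <= mu by rewrite le_max lexx orbT.
have [M HM] := Aw_seminorm hw mu psiA.
have M0 : 0 <= M by case: HM => /decay_ge0.
exists mu, (Cu * M); split => // [|z]; first by rewrite mulr_ge0// ltW.
rewrite -mulrA; apply: Hu; first exact: Aw_tfshift.
have [a b] := seminorm_le_tfshift hw z mu0 (Aw_cintegrable hw psiA) HM.
split; [apply: decay_mono a|apply: decay_mono b] => //; by rewrite le_max lexx.
Qed.

(** [window_bound] is applied to [g = tfshift z' psi], whose coefficients are concentrated near
    [z']. Their decay at rate [Lam + 2] beats the growth [Lam] allowed by [cone_split] and leaves 2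
    units for the two Cauchy kernels centred at the components of [z']. *)
Lemma stft_change_window (psi phi : 'rV[R]_d -> R[i]) (G G' : set 'rV[R]_(d + d)) (k : nat) :
  Aw w psi -> Aw w phi -> phi <> cst 0 ->
  (forall z' z, G' z' -> ~ G z -> W z' <= k.+1%:R * W (z - z')) ->
  (forall la, 0 < la -> exists M, forall z, G z ->
     normc (u (tfshift z phi)) <= M * expR (- (la * W z))) ->
  forall la, 0 < la -> exists M, forall z, G' z ->
     normc (u (tfshift z psi)) <= M * expR (- (la * W z)).
Proof.
move=> psiA phiA phi0 HG uG la la0.
have [mu [C [mu0 C0 HC]]] := stft_growth phiA.
have [Lam [M [Lam0 M0 HM]]] := cone_split hw HG mu0 (fun z => normc_ge0 _) HC uG la0.
have [K K0 HK] := bracket_tfshift_bound hw (addr_ge0 Lam0 (ler0n _ 2)) psiA phiA.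
have [Cc Cc0 HCc] := expRN_weightv_pt_le hw (n := d).
(* [expR (Lam * w 1)] accounts for evaluating [u] at a node up to distance 1 from the point
   [pt p]. *)
pose B := K * M * expR (Lam * w 1) * Cc.
have B0 : 0 <= B by rewrite !mulr_ge0 ?expR_ge0// ltW.
have r0 : 0 < normc (recon_cst phi).
  rewrite lt_neqAle normc_ge0 andbT eq_sym; apply/eqP => /ComplexField.Normc.eq0_normc/eqP.
  by rewrite (negbTE (recon_cst_neq0 hw phiA phi0)).
exists (2 * B * (pi ^+ d * pi ^+ d) / normc (recon_cst phi)) => z' Gz'.
pose e := expR (- (la * W z')).
have e0 : 0 < e by exact: expR_gt0.
have := window_bound hw (Aw_tfshift hw z' psiA) phiA uD (a := lsubmx z') (b := rsubmx z')
  (mulr_ge0 B0 (ltW e0)).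
rewrite -/e => H.
have -> : 2 * B * (pi ^+ d * pi ^+ d) / normc (recon_cst phi) * e =
    2 * (B * e) * (pi ^+ d * pi ^+ d) / normc (recon_cst phi) by ring.
rewrite ler_pdivlMr// mulrC; apply: H => p z pz.
have h1 : normc (coef (tfshift z' psi) phi p) <= K * expR (- ((Lam + 2) * W (pt p - z'))).
  exact: HK.
have h2 : normc (u (tfshift z phi)) <= M * expR (Lam * W (z - z')) * e.
  by rewrite /e expRN ler_pdivlMr ?expR_gt0//; exact: HM.
have h3 : W (z - z') <= W (pt p - z') + w 1.
  by apply: (weightv_near hw); rewrite opprB addrA subrK.
have h4 := HCc (p.1 - lsubmx z', p.2 - rsubmx z').
have ptE : pt (p.1 - lsubmx z', p.2 - rsubmx z') = pt p - z'.
  by rewrite /pt /= -[in RHS](row_submxK z') opp_row_mx add_row_mx.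
rewrite ptE /= in h4.
apply: (le_trans (ler_pM (normc_ge0 _) (normc_ge0 _) h1 h2)).
have h5 : expR (- ((Lam + 2) * W (pt p - z'))) * expR (Lam * W (z - z')) <=
    expR (Lam * w 1) * expR (- (2 * W (pt p - z'))).
  by rewrite -!expRD ler_expR; have := ler_wpM2l Lam0 h3; lra.
have KMe : 0 <= K * M * e by rewrite !mulr_ge0// ltW.
have := ler_wpM2l KMe (le_trans h5 (ler_wpM2l (expR_ge0 _) h4)).
by congr (_ <= _); rewrite /B; ring.
Qed.

(** The kernel is integrated over ['rV_(d + d)] directly, where a single Cauchy product, hence one
    unit of rate beyond [Lam], makes the integral converge. *)
Lemma locop_decay (a : 'rV[R]_(d + d) -> R[i]) (tau Ca : R)
    (psi gam phi : 'rV[R]_d -> R[i]) (G G' : set 'rV[R]_(d + d)) (k : nat) :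
  0 < tau -> (forall z, normc (a z) <= Ca * expR (tau * W z)) ->
  Aw w psi -> Aw w gam -> Aw w phi ->
  (forall z' z, G' z' -> ~ G z -> W z' <= k.+1%:R * W (z - z')) ->
  (forall la, 0 < la -> exists M, forall z, G z ->
     normc (u (tfshift z psi)) <= M * expR (- (la * W z))) ->
  forall la, 0 < la -> exists M, forall z, G' z ->
     normc (locop a psi gam u (tfshift z phi)) <= M * expR (- (la * W z)).
Proof.
move=> tau0 aC psiA gamA phiA HG uG la la0.
have [mu [C [mu0 C0 HC]]] := stft_growth psiA.
pose F z := normc (a z) * normc (u (tfshift z psi)).
have Ca0 : 0 <= Ca by have := le_trans (normc_ge0 _) (aC 0); rewrite pmulr_lge0// expR_gt0.
have F0 z : 0 <= F z by rewrite mulr_ge0 ?normc_ge0.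
have FC z : F z <= Ca * C * expR ((tau + mu) * W z).
  apply: (le_trans (ler_pM (normc_ge0 _) (normc_ge0 _) (aC z) (HC z))).
  by rewrite mulrACA -expRD mulrDl.
have FG l : 0 < l -> exists M, forall z, G z -> F z <= M * expR (- (l * W z)).
  (* Inside the cone, the growth of the symbol is compensated by asking the transform of [u] for the
     extra rate [tau]. *)
  move=> l0; have [M HM] := uG (l + tau) (addr_gt0 l0 tau0).
  exists (Ca * M) => z Gz.
  apply: (le_trans (ler_pM (normc_ge0 _) (normc_ge0 _) (aC z) (HM z Gz))).
  rewrite mulrACA -expRD le_eqVlt; apply/orP; left; apply/eqP.
  by congr (_ * expR _); ring.
have [Lam [M [Lam0 M0 HM]]] := cone_split hw HG (addr_ge0 (ltW tau0) mu0) F0 FC FG la0.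
have [K K0 HK] := bracket_tfshift_bound hw (addr_ge0 Lam0 (ler01 (R := R))) phiA gamA.
have [Cc Cc0 HCc] := expRN_weightv_le_cauchy hw (d + d).
exists (2 * (M * K * Cc * pi ^+ (d + d))) => z' Gz'.
pose e := expR (- (la * W z')).
have e0 : 0 < e by exact: expR_gt0.
have [ic ec] := Rintegral_shift_rV (- z') (@integrable_cauchy_rV R (d + d)).
apply: (@le_trans _ _ (2 * \int[lebesgue_rV (d + d)]_z (M * K * Cc * e * cauchy_rV (z - z')))).
  apply: normc_cintegral_le => [z|]; last first.
    have := integrableZl measurableT (M * K * Cc * e) ic.
    by apply: eq_integrable => // z _; rewrite EFinM.
  rewrite /stft 2!normcM normc_conj -/(F z).
  have h1 : F z <= M * expR (Lam * W (z - z')) * e.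
    by rewrite /e expRN ler_pdivlMr ?expR_gt0//; exact: HM.
  apply: (le_trans (ler_pM (F0 z) (normc_ge0 _) h1 (HK z z'))).
  have MKe : 0 <= M * K * e by rewrite !mulr_ge0// ltW.
  have h2 : expR (Lam * W (z - z')) * expR (- ((Lam + 1) * W (z - z'))) <= Cc * cauchy_rV (z - z').
    by apply: le_trans (HCc (z - z')); rewrite -expRD ler_expR; lra.
  by have := ler_wpM2l MKe h2; congr (_ <= _); ring.
rewrite (RintegralZl _ measurableT ic) ec Rintegral_cauchy_rV -/e.
by rewrite le_eqVlt; apply/orP; left; apply/eqP; ring.
Qed.

Lemma ereal_sup_decayP (v : @functional R d) (phi : 'rV[R]_d -> R[i]) (G : set 'rV[R]_(d + d)) la :
  (ereal_sup [set (expR (la * w (enorm z)) * normc (stft phi v z))%:E | z in G] < +oo)%E <->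
  exists M, forall z, G z -> normc (v (tfshift z phi)) <= M * expR (- (la * W z)).
Proof.
split=> [H|[M HM]].
- set S := ereal_sup _ in H.
  have Sz z : G z -> ((expR (la * W z) * normc (v (tfshift z phi)))%:E <= S)%E.
    by move=> Gz; apply: ereal_sup_ubound; exists z.
  exists (fine S) => z Gz; rewrite expRN ler_pdivlMr ?expR_gt0// mulrC -lee_fin fineK ?Sz//.
  rewrite ge0_fin_numE//; apply: le_trans (Sz z Gz).
  by rewrite lee_fin mulr_ge0 ?expR_ge0 ?normc_ge0.
- apply: (@le_lt_trans _ _ M%:E); last exact: ltry.
  apply: ge_ereal_sup => _ [z Gz <-]; rewrite lee_fin mulrC -ler_pdivlMr ?expR_gt0// -expRN.
  exact: HM.
Qed.

End wave_front.

Unset Implicit Arguments.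

Theorem theorem4p14 (R : realType) (d : nat) (w : R -> R)
    (hw : weight_function w)
    (psi gam : 'rV[R]_d -> R[i])
    (hpsi : Sw w psi) (hpsi0 : psi <> cst 0)
    (hgam : Sw w gam) (hgam0 : gam <> cst 0)
    (a : 'rV[R]_(d + d) -> R[i]) (ha : lebesgue_measurable a)
    (ha_bound : exists tau C : R, [/\ 0 < tau, 0 < C &
       forall z, normc (a z) <= C * expR (tau * w (enorm z))])
    (phi : 'rV[R]_d -> R[i]) (hphi : Sw w phi) (hphi0 : phi <> cst 0)
    (u : functional) (hu : Sw_dual w u) :
  WF w phi (locop a psi gam u) `<=` WF w phi u.
Proof.
move=> z0 [z00 nG]; split => // -[G [oG cG G0 Gz0 HG]]; apply: nG.
have [tau [Ca [tau0 _ aC]]] := ha_bound.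
have psiA := Sw_Aw hw hpsi; have gamA := Sw_Aw hw hgam; have phiA := Sw_Aw hw hphi.
(* Two nested cones: decay passes from window [phi] on [G] to window [psi] on [G1], and from there
   to the localized functional on [G2]. *)
have [G1 [k1 [oG1 cG1 G10 G1z0 HG1]]] := subcone hw oG cG G0 Gz0.
have [G2 [k2 [oG2 cG2 G20 G2z0 HG2]]] := subcone hw oG1 cG1 G10 G1z0.
exists G2; split => // la la0; apply/ereal_sup_decayP.
have u1 := stft_change_window hw hu psiA phiA hphi0 HG1
  (fun l l0 => (ereal_sup_decayP _ _ _ _ _).1 (HG l l0)).
exact: (locop_decay hw hu tau0 aC psiA gamA phiA HG2 u1 la0).
Qed.
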